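(* For every $S\in\mathcal{HS}$ with $\|S\|_{\mathcal{HS}}=1$, the mapping $T\mapsto Q_S(T)$ is an isometry from $\mathcal{HS}$ to $L^2(\mathbb{R}^{4d})$.
   Context: For $z=(z_1,z_2)\in\mathbb{R}^d\times\mathbb{R}^d$, $(\pi(z)f)(t)=e^{2\pi i z_2\cdot t}f(t-z_1)$ on $L^2(\mathbb{R}^d)$. $\mathcal{HS}$ is the Hilbert space of Hilbert–Schmidt operators on $L^2(\mathbb{R}^d)$ with $\langle S,T\rangle_{\mathcal{HS}}=\mathrm{tr}(ST^* )$. For $w,z\in\mathbb{R}^{2d}$, $\gamma_{w,z}(S):=\pi(z)S\pi(w)^*$, and the polarised Cohen's class is the function on $\mathbb{R}^{4d}$ given by $Q_ST(w,z):=\langle T,\gamma_{w,z}(S)\rangle_{\mathcal{HS}}$. *)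

(* Defs.v *)
From HB Require Import structures.
From mathcomp Require Import all_boot all_order all_algebra.
From mathcomp Require Import all_classical all_reals all_analysis.
From mathcomp Require Import measurable_realfun complex ring.
Set Implicit Arguments.
Unset Strict Implicit.
Unset Printing Implicit Defensive.
Import Order.TTheory GRing.Theory Num.Theory.
Import numFieldNormedType.Exports.

Local Open Scope classical_set_scope.
Local Open Scope ring_scope.
Local Open Scope complex_scope.
Local Open Scope quotient_scope.

Import Normc.

Section NormcSqr.
Context {R : realType}.

Lemma normc_sqr (z : R[i]) :
  normc z ^+ 2 = complex.Re z ^+ 2 + complex.Im z ^+ 2.
Proof. by case: z => a b; rewrite /= sqr_sqrtr// addr_ge0// sqr_ge0. Qed.

Lemma normc_sqrD (a f g : R[i]) :
  normc (a * f + g) ^+ 2 <=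
  2 * normc a ^+ 2 * normc f ^+ 2 + 2 * normc g ^+ 2.
Proof.
rewrite -mulrA -exprMn -normcM; set h := a * f.
rewrite !normc_sqr; case: h g => [x y] [u v] /=.
rewrite -subr_ge0.
have -> : 2 * (x ^+ 2 + y ^+ 2) + 2 * (u ^+ 2 + v ^+ 2)
   - ((x + u) ^+ 2 + (y + v) ^+ 2) = (x - u) ^+ 2 + (y - v) ^+ 2 by ring.
by rewrite addr_ge0// sqr_ge0.
Qed.

End NormcSqr.

Section L2.
Context d (T : measurableType d) (R : realType) (mu : {measure set T -> \bar R}).

Definition square_integrable (f : T -> R[i]) : Prop :=
  [/\ measurable_fun setT (fun x => complex.Re (f x)),
      measurable_fun setT (fun x => complex.Im (f x)) &
      (\int[mu]_x (normc (f x) ^+ 2 : R)%:E < +oo)%E].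

Definition sqint : {pred T -> R[i]} := fun f => `[< square_integrable f >].

Lemma sqint_submod_closed : submod_closed sqint.
Proof.
have mnormc (f : T -> R[i]) :
    measurable_fun setT (fun x => complex.Re (f x)) ->
    measurable_fun setT (fun x => complex.Im (f x)) ->
    measurable_fun setT (fun x => (normc (f x) ^+ 2 : R)%:E).
  move=> mr mi; apply/measurable_EFinP.
  under eq_fun do rewrite normc_sqr.
  by apply: measurable_funD; exact: measurable_funX.
split.
  apply/asboolP; split; [exact: measurable_cst|exact: measurable_cst|].
  rewrite (eq_integral (cst 0%E)) ?integral0// => x _.
  by rewrite /= expr0n addr0 sqrtr0 expr0n.
move=> a f g /asboolP[mfr mfi ff] /asboolP[mgr mgi fg].
have ReE x : complex.Re ((a *: f + g) x) =
    complex.Re a * complex.Re (f x) - complex.Im a * complex.Im (f x)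
    + complex.Re (g x).
  rewrite -[(a *: f + g) x]/(a * f x + g x).
  by case: (a) (f x) (g x) => [? ?] [? ?] [? ?].
have ImE x : complex.Im ((a *: f + g) x) =
    complex.Re a * complex.Im (f x) + complex.Im a * complex.Re (f x)
    + complex.Im (g x).
  rewrite -[(a *: f + g) x]/(a * f x + g x).
  by case: (a) (f x) (g x) => [? ?] [? ?] [? ?].
have mr : measurable_fun setT (fun x => complex.Re ((a *: f + g) x)).
  under eq_fun do rewrite ReE.
  by apply: measurable_funD => //; apply: measurable_funB;
    exact: measurable_funM.
have mi : measurable_fun setT (fun x => complex.Im ((a *: f + g) x)).
  under eq_fun do rewrite ImE.
  by apply: measurable_funD => //; apply: measurable_funD;
    exact: measurable_funM.
apply/asboolP; split => //.
pose c := 2 * normc a ^+ 2.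
apply: (@le_lt_trans _ _ (\int[mu]_x
   (c%:E * (normc (f x) ^+ 2 : R)%:E + 2%:E * (normc (g x) ^+ 2 : R)%:E))%E).
  apply: ge0_le_integral => //.
  - by move=> x _; rewrite lee_fin sqr_ge0.
  - exact: mnormc.
  - by apply: emeasurable_funD; apply: measurable_funeM; exact: mnormc.
  - by move=> x _; rewrite -!EFinM -EFinD lee_fin; exact: normc_sqrD.
have c0 : (0 <= c%:E)%E by rewrite lee_fin mulr_ge0// sqr_ge0.
rewrite ge0_integralD//=.
- rewrite !ge0_integralZl//=.
  + by apply: lte_add_pinfty; apply: lte_mul_pinfty => //; rewrite ltry.
  + exact: mnormc.
  + by move=> x _; rewrite lee_fin sqr_ge0.
  + exact: mnormc.
  + by move=> x _; rewrite lee_fin sqr_ge0.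
- by move=> x _; rewrite mule_ge0// lee_fin sqr_ge0.
- by apply: measurable_funeM; exact: mnormc.
- by move=> x _; rewrite mule_ge0// lee_fin sqr_ge0.
- by apply: measurable_funeM; exact: mnormc.
Qed.

HB.instance Definition _ :=
  GRing.isSubmodClosed.Build R[i] (T -> R[i]) sqint sqint_submod_closed.

Record L2fun := L2Fun { L2fun_val :> T -> R[i]; _ : L2fun_val \in sqint }.

HB.instance Definition _ := [isSub for L2fun_val].
HB.instance Definition _ := [Choice of L2fun by <:].
HB.instance Definition _ := [SubChoice_isSubLmodule of L2fun by <:].

Definition L2null : {pred L2fun} :=
  fun f => `[< {ae mu, forall x, f x = 0} >].

Lemma L2null_zmod_closed : zmod_closed L2null.
Proof.
split; first by apply/asboolP; exact: nearW.
move=> f g /asboolP f0 /asboolP g0; apply/asboolP.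
apply: filterS2 f0 g0 => x fx0 gx0.
by rewrite -[LHS]/(f x - g x) fx0 gx0 subrr.
Qed.

HB.instance Definition _ :=
  GRing.isZmodClosed.Build L2fun L2null L2null_zmod_closed.

Definition L2 := Quotient.quot L2null.
HB.instance Definition _ := GRing.Zmodule.on L2.
HB.instance Definition _ := EqQuotient.on L2.

Definition L2scale (a : R[i]) : L2 -> L2 := lift_op1 L2 ( *:%R a).

Lemma pi_L2scale a : {morph (\pi_L2) : f / a *: f >-> L2scale a f}.
Proof.
move=> f; rewrite /L2scale; unlock; apply/eqP; rewrite piE Quotient.equivE; apply/asboolP.
have /asboolP : f - repr (\pi_L2 f) \in L2null.
  by rewrite Quotient.idealrBE reprK.
apply: filterS => x fx0.
by rewrite -[LHS]/(a * f x - a * repr (\pi_L2 f) x) -mulrBr [X in a * X]fx0 mulr0.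
Qed.

Fact L2scaleA a b (u : L2) : L2scale a (L2scale b u) = L2scale (a * b) u.
Proof. by elim/quotW: u => f; rewrite -!pi_L2scale scalerA. Qed.

Fact L2scale1 : left_id 1 L2scale.
Proof. by elim/quotW => f; rewrite -pi_L2scale scale1r. Qed.

Fact L2scaleDr : right_distributive L2scale +%R.
Proof.
move=> a u v; elim/quotW: u => f; elim/quotW: v => g.
by rewrite -!raddfD -!pi_L2scale scalerDr raddfD.
Qed.

Fact L2scaleDl (u : L2) : {morph L2scale^~ u : a b / a + b}.
Proof.
by elim/quotW: u => f a b; rewrite -!pi_L2scale scalerDl raddfD.
Qed.

HB.instance Definition _ := GRing.Zmodule_isLmodule.Build R[i] L2
  L2scaleA L2scale1 L2scaleDr L2scaleDl.

(* The class of f; the default value 0 is taken only if f is not square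
   integrable. *)
Definition toL2 (f : T -> R[i]) : L2 := \pi_L2 (insubd 0 f).

Definition cintegral (f : T -> R[i]) : R[i] :=
  (\int[mu]_x complex.Re (f x)) +i* (\int[mu]_x complex.Im (f x)).

(* Linear in the first argument. *)
Definition L2dot (u v : L2) : R[i] :=
  cintegral (fun x => L2fun_val (repr u) x * (L2fun_val (repr v) x)^*).

Definition L2norm (u : L2) : R := Num.sqrt (complex.Re (L2dot u u)).

(* Orthonormal bases are indexed by nat: the Hilbert spaces on which operators
   are considered below are separable and infinite-dimensional. *)
Definition orthonormal_basis (e : nat -> L2) : Prop :=
  (forall i j, L2dot (e i) (e j) = (i == j)%:R) /\
  (forall u, L2norm (u - \sum_(i < n) L2dot u (e i) *: e i) @[n --> \oo]
             --> (0 : R)).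

Implicit Types A B : L2 -> L2.

Definition bounded_operator A : Prop :=
  linear A /\ exists M : R, forall u, L2norm (A u) <= M * L2norm u.

(* The vector representing u |-> <A u, v>; unique, and given by the Riesz
   theorem when A is bounded. *)
Definition adjoint A (v : L2) : L2 :=
  xget 0 [set w : L2 | forall u, L2dot (A u) v = L2dot u w].

(* The common value of sum_n <A e_n, e_n> over all orthonormal bases (0 by
   convention if there is none). *)
Definition trace A : R[i] :=
  xget 0 [set t : R[i] | forall e, orthonormal_basis e ->
    series (fun n => L2dot (A (e n)) (e n) : (R[i])^o) @ \oo
      --> (t : (R[i])^o)].

(* The sum does not depend on the orthonormal basis. *)
Definition hilbert_schmidt A : Prop :=
  bounded_operator A /\
  exists2 e, orthonormal_basis e &
    (\sum_(0 <= n <oo) (L2norm (A (e n)) ^+ 2)%:E < +oo)%E.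

Definition hs_dot A B : R[i] := trace (A \o adjoint B).

Definition hs_norm A : R := Num.sqrt (complex.Re (hs_dot A A)).

End L2.

(* The library's canonical [{sigma_finite_measure set _ -> \bar R}] structure on
   [m1 \x m2] only fires for subprobabilities, so a named copy is used. *)
Section SigmaFiniteProduct.
Local Open Scope ereal_scope.
Context d1 d2 (T1 : measurableType d1) (T2 : measurableType d2) (R : realType).
Variable m1 : {sigma_finite_measure set T1 -> \bar R}.
Variable m2 : {sigma_finite_measure set T2 -> \bar R}.

Definition sfprod : set (T1 * T2) -> \bar R := m1 \x m2.

HB.instance Definition _ := Measure.copy sfprod (m1 \x m2).

Fact sfprod_sigma_finite : sigma_finite setT sfprod.
Proof.
have /sigma_finiteP[F [TF ndF Foo]] := sigma_finiteT m1.
have /sigma_finiteP[G [TG ndG Goo]] := sigma_finiteT m2.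
exists (fun n => F n `*` G n).
  rewrite -setXTT TF TG predeqE => -[x y]; split.
    move=> [/= [n _ Fnx] [k _ Gky]]; exists (maxn n k) => //; split.
    - by move: x Fnx; exact/subsetPset/ndF/leq_maxl.
    - by move: y Gky; exact/subsetPset/ndG/leq_maxr.
  by move=> [n _ []/= ? ?]; split; exists n.
move=> k; have [? ?] := Foo k; have [? ?] := Goo k.
split; first exact: measurableX.
by rewrite /sfprod product_measure1E// lte_mul_pinfty// ge0_fin_numE.
Qed.

HB.instance Definition _ :=
  Measure_isSigmaFinite.Build _ _ _ sfprod sfprod_sigma_finite.

End SigmaFiniteProduct.

Section LebesgueTuple.
Context (R : realType).
Local Notation RT := (measurableTypeR R).

Section cons.
Context n (m : {sigma_finite_measure set (n.-tuple RT) -> \bar R}).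

Definition cons_pair (x : RT * n.-tuple RT) : n.+1.-tuple RT :=
  [tuple of x.1 :: x.2].

Definition uncons (t : n.+1.-tuple RT) : RT * n.-tuple RT :=
  (thead t, [tuple of behead t]).

Lemma measurable_cons_pair : measurable_fun setT cons_pair.
Proof. by apply: measurable_cons. Qed.

Lemma measurable_uncons : measurable_fun setT uncons.
Proof.
apply: measurable_fun_pair; last exact: measurable_behead.
exact: measurable_tnth.
Qed.

Lemma uncons_cons_pair : cancel cons_pair uncons.
Proof. by move=> [x t]; rewrite /uncons/= theadE; congr pair; apply/val_inj. Qed.

Definition lebesgue_cons : set (n.+1.-tuple RT) -> \bar R :=
  pushforward (sfprod (@lebesgue_measure R) m) cons_pair.

Fact lebesgue_cons0 : lebesgue_cons set0 = 0%E.
Proof. by rewrite /lebesgue_cons /pushforward preimage_set0 measure0. Qed.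

Fact lebesgue_cons_ge0 A : (0 <= lebesgue_cons A)%E.
Proof. by rewrite /lebesgue_cons /pushforward measure_ge0. Qed.

Fact lebesgue_cons_sigma_additive : semi_sigma_additive lebesgue_cons.
Proof.
exact: (@measure_semi_sigma_additive _ _ _
  (measure_function_pushforward__canonical__measure_function_Measure
     (sfprod (@lebesgue_measure R) m) measurable_cons_pair)).
Qed.

HB.instance Definition _ := isMeasure.Build _ _ _ lebesgue_cons
  lebesgue_cons0 lebesgue_cons_ge0 lebesgue_cons_sigma_additive.

Fact lebesgue_cons_sigma_finite : sigma_finite setT lebesgue_cons.
Proof.
have [F UF mF] := @sigma_finiteT _ _ _ (sfprod (@lebesgue_measure R) m).
exists (fun k => uncons @^-1` F k).
  by rewrite -preimage_bigcup -UF preimage_setT.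
move=> k; have [mFk Fkoo] := mF k; split.
  by rewrite -[X in measurable X]setTI; exact: measurable_uncons.
rewrite /lebesgue_cons /pushforward -comp_preimage.
by rewrite (_ : uncons \o cons_pair = id) ?preimage_id//; apply/funext/uncons_cons_pair.
Qed.

HB.instance Definition _ :=
  Measure_isSigmaFinite.Build _ _ _ lebesgue_cons lebesgue_cons_sigma_finite.
End cons.

(* Lebesgue measure on R^n; see [lebesgueT_box]. *)
Fixpoint lebesgueT (n : nat) :
    {sigma_finite_measure set (n.-tuple RT) -> \bar R} :=
  match n with
  | 0 => \d_([tuple])
  | k.+1 => lebesgue_cons (lebesgueT k)
  end.

Lemma lebesgueT_box n (A : 'I_n -> set RT) :
  (forall i, measurable (A i)) ->
  lebesgueT n [set t | forall i, A i (tnth t i)] = (\prod_i lebesgue_measure (A i))%E.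
Proof.
elim: n A => [|n IH] A mA.
  rewrite big_ord0 /= diracE mem_set//= => -[//].
rewrite big_ord_recl -IH; last by move=> i; exact: mA.
rewrite -product_measure1E//; last first.
  rewrite [X in measurable X](_ : _ = \bigcap_(i in [set: 'I_n])
     ((fun t : n.-tuple RT => tnth t i) @^-1` A (lift ord0 i))).
    apply: fin_bigcap_measurable => // i _.
    by rewrite -[X in measurable X]setTI; apply: measurable_tnth.
  by apply/seteqP; split=> t /= At i; [move=> _; exact: At|exact: At].
rewrite /= /lebesgue_cons /pushforward; congr (_ _).
apply/seteqP; split => -[x t] /=.
  move=> Axt; split; first by have := Axt ord0; rewrite (tnth_nth x).
  by move=> i; have := Axt (lift ord0 i); rewrite tnthS.
move=> [Ax At] i; case: (unliftP ord0 i) => [j ->|->].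
  by rewrite tnthS.
by rewrite (tnth_nth x).
Qed.
End LebesgueTuple.

Section TimeFrequency.
Context (R : realType) (d : nat).

Local Notation Rd := (d.-tuple (measurableTypeR R)).

Definition lebesgue2T : {sigma_finite_measure set (Rd * Rd)%type -> \bar R} :=
  sfprod (lebesgueT R d) (lebesgueT R d).

(* R^(4d), seen as pairs (w, z) of points of R^(2d) = R^d * R^d. *)
Definition lebesgue4T :
    {sigma_finite_measure set ((Rd * Rd) * (Rd * Rd))%type -> \bar R} :=
  sfprod lebesgue2T lebesgue2T.

Local Notation L2Rd := (L2 (lebesgueT R d)).

Definition vdot (x y : Rd) : R := \sum_(i < d) tnth x i * tnth y i.

Definition vsub (x y : Rd) : Rd := [tuple tnth x i - tnth y i | i < d].

(* e^(2 pi i x) *)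
Definition expi2pi (x : R) : R[i] := cos (2 * pi * x) +i* sin (2 * pi * x).

Definition tf_shift (z : Rd * Rd) (f : L2Rd) : L2Rd :=
  toL2 (lebesgueT R d)
    (fun t => expi2pi (vdot z.2 t) * L2fun_val (repr f) (vsub t z.1)).

Definition op_shift (w z : Rd * Rd) (S : L2Rd -> L2Rd) : L2Rd -> L2Rd :=
  tf_shift z \o S \o adjoint (tf_shift w).

Definition polarised_cohen (S T : L2Rd -> L2Rd)
    (wz : (Rd * Rd) * (Rd * Rd)) : R[i] :=
  hs_dot T (op_shift wz.1 wz.2 S).

Definition polarised_cohen_L2 (S T : L2Rd -> L2Rd) : L2 lebesgue4T :=
  toL2 lebesgue4T (polarised_cohen S T).

End TimeFrequency.

(* Main.v *)
(* By Plancherel's theorem <u, pi(z) v> is square integrable in z with norm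
   |u| |v|, and polarising gives Moyal's identity: for an orthonormal basis
   (e_n), the functions <e_m, pi(w) e_n> of w are orthonormal.  The trace
   defining Q_S T may be computed in the basis (pi(w) e_n)_n, where
   gamma_(w,z)(S) maps pi(w) e_n to pi(z) S e_n; expanding also pi(w) e_n in
   (e_m),
     Q_S T (w, z) = sum_n sum_m conj <e_m, pi(w) e_n> <T e_m, pi(z) S e_n>.
   Integrating first in w and then in z, this expansion is orthogonal, and its
   squared norm is sum_(m,n) |T e_m|^2 |S e_n|^2 = |T|_HS^2 |S|_HS^2.
   Plancherel's theorem on R is obtained by damping the Fourier transform with
   exp (- e |x|), whose own transform is the Cauchy kernel, an approximate
   identity as e -> 0; it passes to R^n because the class of kernels satisfying
   it is stable under products. *)

Require Import Defs.
From HB Require Import structures.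
From mathcomp Require Import all_boot all_order all_algebra.
From mathcomp Require Import all_classical all_reals all_analysis.
From mathcomp Require Import measurable_realfun complex ring lra.
Set Implicit Arguments.
Unset Strict Implicit.
Unset Printing Implicit Defensive.
Import Order.TTheory GRing.Theory Num.Theory.
Import numFieldNormedType.Exports.
Local Open Scope classical_set_scope.
Local Open Scope quotient_scope.
Local Open Scope complex_scope.
Local Open Scope ring_scope.
Import Normc.

(** * Complex-valued integrals and L2 *)

(** [trace] and [adjoint] are chosen by [xget], so they carry no information until the chosen object
    is shown to exist and to be unique. The adjoint of a Hilbert-Schmidt operator is therefore built
    as an explicit series, which converges because [L2] is complete. Independence of the basis goes
    through squares: for an adjoint pair the two sums of squares agree in any two bases, by
    interchanging a nonnegative double series. Polarising with the unimodular constants 1, -1, i, -i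
    then carries this over to the inner product, so that no conditionally convergent double series
    has to be rearranged. All bases are obtained from the one that [hilbert_schmidt] supplies.

    The expansion of Q_S T is available only pointwise and as an iterated limit, and measurability
    of Q_S T is not known in advance. [orthogonal_limit] settles both points: a pointwise limit of
    partial sums whose increments have known norms is measurable, and Fatou's lemma identifies its
    norm. It is applied once in m and once in n.

    Plancherel's theorem enters as an equality of norms on L1 ∩ L2, where the Fourier integral
    converges absolutely. *)

Section ComplexFacts.
Context {R : realType}.
Implicit Types z w : R[i].

Lemma cReD z w : complex.Re (z + w) = complex.Re z + complex.Re w.
Proof. by case: z w => [? ?] [? ?]. Qed.
Lemma cImD z w : complex.Im (z + w) = complex.Im z + complex.Im w.
Proof. by case: z w => [? ?] [? ?]. Qed.
Lemma cReN z : complex.Re (- z) = - complex.Re z.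
Proof. by case: z => [? ?]. Qed.
Lemma cImN z : complex.Im (- z) = - complex.Im z.
Proof. by case: z => [? ?]. Qed.
Lemma cReM z w : complex.Re (z * w) =
  complex.Re z * complex.Re w - complex.Im z * complex.Im w.
Proof. by case: z w => [? ?] [? ?]. Qed.
Lemma cImM z w : complex.Im (z * w) =
  complex.Re z * complex.Im w + complex.Im z * complex.Re w.
Proof. by case: z w => [? ?] [? ?]. Qed.
Lemma cReJ z : complex.Re (z^*) = complex.Re z.
Proof. by case: z. Qed.
Lemma cImJ z : complex.Im (z^*) = - complex.Im z.
Proof. by case: z. Qed.
Lemma complexP z w : complex.Re z = complex.Re w ->
  complex.Im z = complex.Im w -> z = w.
Proof. by case: z w => [? ?] [? ?] /= -> ->. Qed.
Lemma normc_ge0' z : 0 <= normc z :> R.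
Proof. by case: z => a b /=; rewrite sqrtr_ge0. Qed.
Lemma normc_conjC z : normc (z^*) = normc z.
Proof. by case: z => a b /=; rewrite sqrrN. Qed.
Lemma normc_Re z : `|complex.Re z| <= normc z.
Proof.
rewrite -(@ler_pXn2r _ 2)// ?nnegrE ?normc_ge0'// normc_sqr real_normK ?num_real//.
by rewrite lerDl sqr_ge0.
Qed.
Lemma normc_Im z : `|complex.Im z| <= normc z.
Proof.
rewrite -(@ler_pXn2r _ 2)// ?nnegrE ?normc_ge0'// normc_sqr real_normK ?num_real//.
by rewrite lerDr sqr_ge0.
Qed.
Lemma normc_le z : normc z <= `|complex.Re z| + `|complex.Im z|.
Proof.
rewrite -(@ler_pXn2r _ 2)// ?nnegrE ?normc_ge0' ?addr_ge0// normc_sqr.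
by rewrite sqrrD !real_normK ?num_real// -addrA lerD2l lerDr mulrn_wge0// mulr_ge0.
Qed.
Lemma mul_conjC z : z * z^* = (normc z ^+ 2)%:C.
Proof. by rewrite normc_sqr; case: z => a b; apply: complexP => /=; ring. Qed.
Lemma Re_real (r : R) : complex.Re r%:C = r. Proof. by []. Qed.
Lemma Im_real (r : R) : complex.Im r%:C = 0. Proof. by []. Qed.
Lemma conj_real (r : R) : (r%:C)^* = r%:C :> R[i].
Proof. by apply: complexP => //=; rewrite oppr0. Qed.
End ComplexFacts.

Section ComplexIntegral.
Context d (T : measurableType d) (R : realType) (mu : {measure set T -> \bar R}).
Implicit Types f g : T -> R[i].

Definition cmeasurable f : Prop :=
  measurable_fun setT (fun x => complex.Re (f x)) /\
  measurable_fun setT (fun x => complex.Im (f x)).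

Definition cintegrable f : Prop :=
  mu.-integrable setT (fun x => (complex.Re (f x))%:E) /\
  mu.-integrable setT (fun x => (complex.Im (f x))%:E).

Lemma cmeasurableD f g : cmeasurable f -> cmeasurable g ->
  cmeasurable (fun x => f x + g x).
Proof.
move=> [fr fi] [gr gi]; split.
- by under eq_fun do rewrite cReD; exact: measurable_funD.
- by under eq_fun do rewrite cImD; exact: measurable_funD.
Qed.

Lemma cmeasurableN f : cmeasurable f -> cmeasurable (fun x => - f x).
Proof.
move=> [fr fi]; split.
- by under eq_fun do rewrite cReN; exact: measurableT_comp.
- by under eq_fun do rewrite cImN; exact: measurableT_comp.
Qed.

Lemma cmeasurableB f g : cmeasurable f -> cmeasurable g ->
  cmeasurable (fun x => f x - g x).
Proof. by move=> mf mg; apply: cmeasurableD => //; exact: cmeasurableN. Qed.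

Lemma cmeasurableM f g : cmeasurable f -> cmeasurable g ->
  cmeasurable (fun x => f x * g x).
Proof.
move=> [fr fi] [gr gi]; split.
- by under eq_fun do rewrite cReM; apply: measurable_funB; exact: measurable_funM.
- by under eq_fun do rewrite cImM; apply: measurable_funD; exact: measurable_funM.
Qed.

Lemma cmeasurableJ f : cmeasurable f -> cmeasurable (fun x => (f x)^*).
Proof.
move=> [fr fi]; split.
- by under eq_fun do rewrite cReJ.
- by under eq_fun do rewrite cImJ; exact: measurableT_comp.
Qed.

Lemma cmeasurable_cst (a : R[i]) : cmeasurable (fun=> a).
Proof. by split; exact: measurable_cst. Qed.

Lemma cmeasurable_sum I (s : seq I) (f : I -> T -> R[i]) :
  (forall i, cmeasurable (f i)) -> cmeasurable (fun x => \sum_(i <- s) f i x).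
Proof.
move=> mf; elim: s => [|i s IH].
  by under eq_fun do rewrite big_nil; exact: cmeasurable_cst.
by under eq_fun do rewrite big_cons; exact: cmeasurableD.
Qed.

Lemma cmeasurable_normc f : cmeasurable f ->
  measurable_fun setT (fun x => normc (f x)).
Proof.
move=> [fr fi].
rewrite (_ : (fun x => _) = (fun x => Num.sqrt (complex.Re (f x) ^+ 2 + complex.Im (f x) ^+ 2))).
  have msqrt : measurable_fun [set: R] (@Num.sqrt R).
    by apply: continuous_measurable_fun => x; exact: sqrt_continuous.
  apply: (measurableT_comp msqrt).
  by apply: measurable_funD; exact: measurable_funX.
by apply/funext => x; case: (f x).
Qed.

Lemma cmeasurable_normc2 f : cmeasurable f ->
  measurable_fun setT (fun x => (normc (f x) ^+ 2)%:E).
Proof.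
by move=> mf; apply/measurable_EFinP; apply: measurable_funX; exact: cmeasurable_normc.
Qed.

Lemma cintegrable_cmeasurable f : cintegrable f -> cmeasurable f.
Proof.
by move=> [/integrableP[/measurable_EFinP ? _] /integrableP[/measurable_EFinP ? _]].
Qed.

Lemma cintegrableP f : cmeasurable f ->
  (\int[mu]_x (normc (f x))%:E < +oo)%E -> cintegrable f.
Proof.
move=> mf foo; have mn := cmeasurable_normc mf; case: (mf) => fr fi.
have inorm : mu.-integrable setT (fun x => (normc (f x))%:E).
  apply/integrableP; split; first exact/measurable_EFinP.
  under eq_integral do rewrite gee0_abs ?lee_fin ?normc_ge0'//.
  by [].
split; apply: le_integrable inorm => //; try exact/measurable_EFinP.
- by move=> x _ /=; rewrite lee_fin (ger0_norm (normc_ge0' _)) normc_Re.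
- by move=> x _ /=; rewrite lee_fin (ger0_norm (normc_ge0' _)) normc_Im.
Qed.

Lemma cintegrable_normc f : cintegrable f ->
  mu.-integrable setT (fun x => (normc (f x))%:E).
Proof.
move=> fi; have mf := cintegrable_cmeasurable fi; case: fi => fr fi.
apply: (le_integrable _ _ _ (integrableD _ (integrable_abse fr) (integrable_abse fi))) => //.
- by apply/measurable_EFinP; exact: cmeasurable_normc.
- move=> x _ /=; rewrite lee_fin (ger0_norm (normc_ge0' _)).
  by rewrite (le_trans (normc_le _))// ler_norm.
Qed.

Lemma cintegrable_lty f : cintegrable f -> (\int[mu]_x (normc (f x))%:E < +oo)%E.
Proof.
move=> /cintegrable_normc /integrableP[_].
by under eq_integral do rewrite gee0_abs ?lee_fin ?normc_ge0'//.
Qed.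

Lemma cintegrableZ (a : R[i]) f : cintegrable f -> cintegrable (fun x => a * f x).
Proof.
move=> [fr fi]; split.
- under eq_fun do rewrite cReM EFinB !EFinM.
  by apply: integrableB => //; exact: integrableZl.
- under eq_fun do rewrite cImM EFinD !EFinM.
  by apply: integrableD => //; exact: integrableZl.
Qed.

Lemma integrableRZ (r : R) (h : T -> R) : mu.-integrable setT (EFin \o h) ->
  mu.-integrable setT (EFin \o (fun x => r * h x)).
Proof. by move=> ih; apply: eq_integrable (integrableZl measurableT r ih). Qed.

Lemma cintegralD f g : cintegrable f -> cintegrable g ->
  cintegral mu (fun x => f x + g x) = cintegral mu f + cintegral mu g.
Proof.
move=> [fr fi] [gr gi]; apply: complexP; rewrite ?cReD ?cImD /=.
- by under eq_Rintegral do rewrite cReD; rewrite RintegralD.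
- by under eq_Rintegral do rewrite cImD; rewrite RintegralD.
Qed.

Lemma cintegralZ (a : R[i]) f : cintegrable f ->
  cintegral mu (fun x => a * f x) = a * cintegral mu f.
Proof.
move=> [fr fi]; apply: complexP; rewrite ?cReM ?cImM /=.
- under eq_Rintegral do rewrite cReM.
  by rewrite RintegralB ?RintegralZl//; exact: integrableRZ.
- under eq_Rintegral do rewrite cImM.
  by rewrite RintegralD ?RintegralZl//; exact: integrableRZ.
Qed.

Lemma cintegralJ f : cintegrable f ->
  cintegral mu (fun x => (f x)^*) = (cintegral mu f)^*.
Proof.
move=> [fr fi]; apply: complexP; rewrite ?cReJ ?cImJ /=.
- by under eq_Rintegral do rewrite cReJ.
- under eq_Rintegral do rewrite cImJ -mulN1r.
  by rewrite RintegralZl// mulN1r.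
Qed.

Lemma ae_eq_cintegral f g : cmeasurable f -> cmeasurable g ->
  {ae mu, forall x, f x = g x} -> cintegral mu f = cintegral mu g.
Proof.
move=> [fr fi] [gr gi] fg; rewrite /cintegral; congr (_ +i* _);
  congr fine; apply: ae_eq_integral => //; try exact/measurable_EFinP;
  by apply: filterS fg => x /= -> _.
Qed.

Lemma eq_cintegral f g : f =1 g -> cintegral mu f = cintegral mu g.
Proof. by move=> /funext ->. Qed.

(** Rotating by the conjugate of I = ∫ f gives |I|^2 = Re ∫ conj(I) f <= |I| ∫ |f|, and |I| cancels
    when it is nonzero. *)
Lemma le_normc_cintegral f : cintegrable f ->
  ((normc (cintegral mu f))%:E <= \int[mu]_x (normc (f x))%:E)%E.
Proof.
move=> fint; have inorm := cintegrable_normc fint.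
set I := cintegral mu f.
have [I0|I0] := eqVneq (normc I) 0.
  by rewrite I0; apply: integral_ge0 => x _; rewrite lee_fin normc_ge0'.
have Igt : 0 < normc I by rewrite lt_neqAle eq_sym I0 normc_ge0'.
rewrite -[leRHS]fineK; last exact: integrable_fin_num.
rewrite lee_fin -(ler_pM2l Igt) -expr2.
have -> : normc I ^+ 2 = complex.Re (cintegral mu (fun x => I^* * f x)).
  rewrite cintegralZ// -/I mulrC mul_conjC//.
rewrite /= -[fine _]/(\int[mu]_x (normc (f x))) -RintegralZl//.
apply: le_Rintegral => //.
- by have [] := cintegrableZ (I^*) fint.
- exact: integrableRZ.
- move=> x _; apply: le_trans (ler_norm _) _; apply: le_trans (normc_Re _) _.
  by rewrite normcM normc_conjC.
Qed.

End ComplexIntegral.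

(** * The inner product space L2 *)

Section L2Hilbert.
Context d (T : measurableType d) (R : realType) (mu : {measure set T -> \bar R}).
Implicit Types (f g : T -> R[i]) (u v w : L2 mu).

(** The representative is picked arbitrarily in its class, so it respects the vector operations only
    almost everywhere; [repD], [repZ], [repB] record this, and every pointwise argument on classes
    goes through them. *)
Definition rep (u : L2 mu) : T -> R[i] := L2fun_val (repr u).

Lemma square_integrableM f g : square_integrable mu f -> square_integrable mu g ->
  cintegrable mu (fun x => f x * (g x)^*).
Proof.
move=> [fr fi foo] [gr gi goo].
have mf : cmeasurable f by [].
have mg : cmeasurable g by [].
apply: cintegrableP; first by apply: cmeasurableM => //; exact: cmeasurableJ.
apply: (@le_lt_trans _ _ (\int[mu]_x ((normc (f x) ^+ 2)%:E + (normc (g x) ^+ 2)%:E))%E).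
  apply: ge0_le_integral => //.
  - by move=> x _; rewrite lee_fin normc_ge0'.
  - apply/measurable_EFinP; apply: cmeasurable_normc; apply: cmeasurableM => //.
    exact: cmeasurableJ.
  - by apply: emeasurable_funD; exact: cmeasurable_normc2.
  - move=> x _; rewrite -EFinD lee_fin normcM normc_conjC.
    have := sqr_ge0 (normc (f x) - normc (g x)).
    have := mulr_ge0 (normc_ge0' (f x)) (normc_ge0' (g x)).
    nra.
rewrite ge0_integralD//.
- exact: lte_add_pinfty.
- by move=> x _; rewrite lee_fin sqr_ge0.
- exact: cmeasurable_normc2.
- by move=> x _; rewrite lee_fin sqr_ge0.
- exact: cmeasurable_normc2.
Qed.

Lemma square_integrable_rep u : square_integrable mu (rep u).
Proof. by rewrite /rep; case: (repr u) => f /= /asboolP. Qed.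

Lemma cmeasurable_rep u : cmeasurable (rep u).
Proof. by have [] := square_integrable_rep u. Qed.

Lemma rep_pi (f : L2fun mu) : {ae mu, forall x, rep (\pi_(L2 mu) f) x = L2fun_val f x}.
Proof.
have /asboolP : f - repr (\pi_(L2 mu) f) \in L2null (mu := mu).
  by rewrite Quotient.idealrBE reprK.
apply: filterS => x fx0; apply/esym/eqP; rewrite -subr_eq0; apply/eqP.
exact: fx0.
Qed.

Lemma rep_toL2 f : square_integrable mu f ->
  {ae mu, forall x, rep (toL2 mu f) x = f x}.
Proof.
move=> sf; rewrite /toL2.
have fE : L2fun_val (insubd (0 : L2fun mu) f) = f.
  by rewrite -[LHS]/(val _) insubdK//; exact/asboolP.
by have := rep_pi (insubd (0 : L2fun mu) f); rewrite fE.
Qed.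

Lemma L2P u v : {ae mu, forall x, rep u x = rep v x} -> u = v.
Proof.
move=> uv; rewrite -(reprK u) -(reprK v); apply/eqP.
rewrite piE Quotient.equivE; apply/asboolP.
by apply: filterS uv => x h; rewrite -[LHS]/(rep u x - rep v x) h subrr.
Qed.

Lemma toL2_rep u : toL2 mu (rep u) = u.
Proof. by apply: L2P; apply: rep_toL2; exact: square_integrable_rep. Qed.

Lemma repD u v : {ae mu, forall x, rep (u + v) x = rep u x + rep v x}.
Proof.
have -> : u + v = \pi_(L2 mu) (repr u + repr v) by rewrite raddfD/= !reprK.
exact: rep_pi.
Qed.

Lemma repZ a u : {ae mu, forall x, rep (a *: u) x = a * rep u x}.
Proof.
have -> : a *: u = \pi_(L2 mu) (a *: repr u) by rewrite pi_L2scale reprK.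
exact: rep_pi.
Qed.

Lemma rep0 : {ae mu, forall x, rep 0 x = 0}.
Proof.
have -> : (0 : L2 mu) = \pi_(L2 mu) 0 by rewrite raddf0.
exact: rep_pi.
Qed.

Lemma repB u v : {ae mu, forall x, rep (u - v) x = rep u x - rep v x}.
Proof.
have -> : u - v = \pi_(L2 mu) (repr u - repr v) by rewrite raddfB/= !reprK.
exact: rep_pi.
Qed.

Lemma toL2_ae f g : square_integrable mu f -> square_integrable mu g ->
  {ae mu, forall x, f x = g x} -> toL2 mu f = toL2 mu g.
Proof.
move=> sf sg fg; apply: L2P.
by apply: filterS3 (rep_toL2 sf) (rep_toL2 sg) fg => x -> -> ->.
Qed.

Lemma square_integrableD f g : square_integrable mu f -> square_integrable mu g ->
  square_integrable mu (fun x => f x + g x).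
Proof.
move=> sf sg; apply/asboolP.
by apply: (@rpredD _ (sqint mu) f g); exact/asboolP.
Qed.

Lemma square_integrableZ a f : square_integrable mu f ->
  square_integrable mu (fun x => a * f x).
Proof.
by move=> sf; apply/asboolP; apply: (@rpredZ _ _ (sqint mu) a f); exact/asboolP.
Qed.

Lemma square_integrable_sum I (s : seq I) (f : I -> T -> R[i]) :
  (forall i, square_integrable mu (f i)) ->
  square_integrable mu (fun x => \sum_(i <- s) f i x).
Proof.
move=> sf; apply/asboolP; rewrite (_ : (fun x => _) = \sum_(i <- s) f i); last first.
  by apply/funext => x; rewrite fct_sumE.
by apply: (@rpred_sum _ (sqint mu)) => i _; exact/asboolP.
Qed.

Lemma toL2D f g : square_integrable mu f -> square_integrable mu g ->
  toL2 mu (fun x => f x + g x) = toL2 mu f + toL2 mu g.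
Proof.
move=> sf sg; apply: L2P.
apply: filterS (filterI (rep_toL2 (square_integrableD sf sg))
  (filterI (repD (toL2 mu f) (toL2 mu g)) (filterI (rep_toL2 sf) (rep_toL2 sg)))).
by move=> x /= [-> [-> [-> ->]]].
Qed.

Lemma toL2Z a f : square_integrable mu f ->
  toL2 mu (fun x => a * f x) = a *: toL2 mu f.
Proof.
move=> sf; apply: L2P.
apply: filterS3 (rep_toL2 (square_integrableZ a sf)) (repZ a (toL2 mu f)) (rep_toL2 sf).
by move=> x -> -> ->.
Qed.

Lemma cintegrable_dot u v : cintegrable mu (fun x => rep u x * (rep v x)^*).
Proof. by apply: square_integrableM; exact: square_integrable_rep. Qed.

Lemma L2dotE u v : L2dot u v = cintegral mu (fun x => rep u x * (rep v x)^*).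
Proof. by []. Qed.

Lemma L2dot_toL2 f g : square_integrable mu f -> square_integrable mu g ->
  L2dot (toL2 mu f) (toL2 mu g) = cintegral mu (fun x => f x * (g x)^*).
Proof.
move=> sf sg; rewrite L2dotE; apply: ae_eq_cintegral.
- by apply: cmeasurableM; [|apply: cmeasurableJ]; exact: cmeasurable_rep.
- by case: sf sg => ? ? ? [? ? ?]; apply: cmeasurableM; [|apply: cmeasurableJ].
- by apply: filterS2 (rep_toL2 sf) (rep_toL2 sg) => x -> ->.
Qed.

Lemma L2dot_toL2r u g : square_integrable mu g ->
  L2dot u (toL2 mu g) = cintegral mu (fun x => rep u x * (g x)^*).
Proof.
by move=> sf; rewrite -[u in LHS]toL2_rep L2dot_toL2//; exact: square_integrable_rep.
Qed.

Lemma L2dotDl u v w : L2dot (u + v) w = L2dot u w + L2dot v w.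
Proof.
rewrite !L2dotE -cintegralD; [|exact: cintegrable_dot..].
apply: ae_eq_cintegral.
- by apply: cmeasurableM; [|apply: cmeasurableJ]; exact: cmeasurable_rep.
- by apply: cmeasurableD; apply: cmeasurableM; (try apply: cmeasurableJ); exact: cmeasurable_rep.
- by apply: filterS (repD u v) => x ->; rewrite mulrDl.
Qed.

Lemma L2dotZl a u v : L2dot (a *: u) v = a * L2dot u v.
Proof.
rewrite !L2dotE -cintegralZ; last exact: cintegrable_dot.
apply: ae_eq_cintegral.
- by apply: cmeasurableM; [|apply: cmeasurableJ]; exact: cmeasurable_rep.
- apply: cmeasurableM; first exact: cmeasurable_cst.
  by apply: cmeasurableM; (try apply: cmeasurableJ); exact: cmeasurable_rep.
- by apply: filterS (repZ a u) => x ->; rewrite mulrA.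
Qed.

Lemma L2dotC u v : L2dot u v = (L2dot v u)^*.
Proof.
rewrite !L2dotE -cintegralJ; last exact: cintegrable_dot.
by apply: eq_cintegral => x; rewrite rmorphM/= conjCK mulrC.
Qed.

Lemma L2dotDr u v w : L2dot w (u + v) = L2dot w u + L2dot w v.
Proof. by rewrite L2dotC L2dotDl (L2dotC w u) (L2dotC w v) rmorphD. Qed.

Lemma L2dotZr a u v : L2dot u (a *: v) = a^* * L2dot u v.
Proof. by rewrite L2dotC L2dotZl (L2dotC u v) rmorphM. Qed.

Lemma L2dotNl u v : L2dot (- u) v = - L2dot u v.
Proof. by rewrite -scaleN1r L2dotZl mulN1r. Qed.

Lemma L2dotNr u v : L2dot u (- v) = - L2dot u v.
Proof. by rewrite L2dotC L2dotNl (L2dotC u v) rmorphN. Qed.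

Lemma L2dotBl u v w : L2dot (u - v) w = L2dot u w - L2dot v w.
Proof. by rewrite L2dotDl L2dotNl. Qed.

Lemma L2dotBr u v w : L2dot w (u - v) = L2dot w u - L2dot w v.
Proof. by rewrite L2dotDr L2dotNr. Qed.

Lemma L2dot0l u : L2dot 0 u = 0.
Proof. by rewrite -(scale0r u) L2dotZl mul0r. Qed.

Lemma L2dot0r u : L2dot u 0 = 0.
Proof. by rewrite -(scale0r u) L2dotZr rmorph0 mul0r. Qed.

Lemma L2dot_suml I (s : seq I) (P : pred I) (u : I -> L2 mu) v :
  L2dot (\sum_(i <- s | P i) u i) v = \sum_(i <- s | P i) L2dot (u i) v.
Proof. by apply: (big_morph (fun u => L2dot u v)) => [? ?|]; rewrite ?L2dotDl ?L2dot0l. Qed.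

Lemma L2dot_sumr I (s : seq I) (P : pred I) (u : I -> L2 mu) v :
  L2dot v (\sum_(i <- s | P i) u i) = \sum_(i <- s | P i) L2dot v (u i).
Proof. by apply: (big_morph (L2dot v)) => [? ?|]; rewrite ?L2dotDr ?L2dot0r. Qed.

Lemma L2dot_norm u : L2dot u u = (L2norm u ^+ 2)%:C.
Proof.
have E : L2dot u u = (\int[mu]_x (normc (rep u x) ^+ 2))%:C.
  rewrite L2dotE; apply: complexP => /=.
    by apply: eq_Rintegral => x _; rewrite mul_conjC.
  under eq_Rintegral do rewrite mul_conjC/=.
  by rewrite /Rintegral integral0_eq.
rewrite {1}E /L2norm E /= sqr_sqrtr// Rintegral_ge0// => x _.
exact: sqr_ge0.
Qed.

Lemma L2norm_ge0 u : 0 <= L2norm u.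
Proof. exact: sqrtr_ge0. Qed.

Lemma L2norm_sqr u : (L2norm u ^+ 2)%:E = (\int[mu]_x (normc (rep u x) ^+ 2)%:E)%E.
Proof.
have -> : L2norm u ^+ 2 = complex.Re (L2dot u u) by rewrite L2dot_norm.
rewrite L2dotE /=; under eq_Rintegral do rewrite mul_conjC/=.
rewrite /Rintegral fineK// ge0_fin_numE; last first.
  by apply: integral_ge0 => x _; rewrite lee_fin sqr_ge0.
by have [_ _] := square_integrable_rep u.
Qed.

Lemma L2norm_toL2 f : square_integrable mu f ->
  (L2norm (toL2 mu f) ^+ 2)%:E = (\int[mu]_x (normc (f x) ^+ 2)%:E)%E.
Proof.
move=> sf; rewrite L2norm_sqr; apply: ae_eq_integral => //.
- by apply: cmeasurable_normc2; exact: cmeasurable_rep.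
- by case: sf => ? ? _; apply: cmeasurable_normc2.
- by apply: filterS (rep_toL2 sf) => x -> _.
Qed.

Lemma L2norm_eq0 u : L2norm u = 0 -> u = 0.
Proof.
move=> u0; apply: L2P.
have : (\int[mu]_x `|(normc (rep u x) ^+ 2)%:E| = 0)%E.
  under eq_integral do rewrite gee0_abs ?lee_fin ?sqr_ge0//.
  by rewrite -L2norm_sqr u0 expr0n.
move/(ae_eq_integral_abs mu measurableT (cmeasurable_normc2 (cmeasurable_rep u))) => H.
apply: filterS2 H rep0 => x /= /(_ I) [] + ->.
by move/eqP; rewrite expf_eq0/= => /eqP /eq0_normc.
Qed.

Lemma L2dot_inj u v : (forall w, L2dot w u = L2dot w v) -> u = v.
Proof.
move=> h; apply/eqP; rewrite -subr_eq0; apply/eqP; apply: L2norm_eq0.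
apply/eqP; rewrite -sqrf_eq0; apply/eqP.
have := L2dot_norm (u - v); rewrite L2dotBr h subrr => /(congr1 (@complex.Re _)).
by move=> /= <-.
Qed.

Lemma L2_CS u v : normc (L2dot u v) <= L2norm u * L2norm v.
Proof.
have [v0|v0] := eqVneq (L2norm v) 0.
  by rewrite v0 (L2norm_eq0 v0) L2dot0r mulr0 normc0.
have vgt : 0 < L2norm v by rewrite lt_neqAle eq_sym v0 L2norm_ge0.
(* This is |v|^2 times the component of [u] orthogonal to [v]; scaling by |v|^2 avoids a
   division. *)
have := L2dot_norm ((L2norm v ^+ 2)%:C *: u - L2dot u v *: v).
rewrite L2dotBl !L2dotBr !L2dotZl !L2dotZr (L2dotC v u) !L2dot_norm. rewrite conj_real.
set a := L2norm v in vgt *; set b := L2norm u; set z := L2dot u v; set N := L2norm (_ - _).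
move=> /(congr1 (@complex.Re _)); rewrite [RHS]/= => H.
have : 0 <= a ^+ 2 * (a ^+ 2 * b ^+ 2 - normc z ^+ 2).
  rewrite (_ : _ * _ = N ^+ 2) ?sqr_ge0// -H normc_sqr.
  by case: (z) => x y /=; ring.
rewrite pmulr_rge0 ?exprn_gt0// subr_ge0 -exprMn.
by rewrite mulrC ler_pXn2r// nnegrE ?normc_ge0'// mulr_ge0 /b /a// L2norm_ge0.
Qed.

Lemma L2norm_sqrD u v :
  L2norm (u + v) ^+ 2 = L2norm u ^+ 2 + L2norm v ^+ 2 + complex.Re (L2dot u v) *+ 2.
Proof.
have := L2dot_norm (u + v); rewrite L2dotDl !L2dotDr !L2dot_norm (L2dotC v u).
move=> /(congr1 (@complex.Re _)); rewrite [RHS]/= => <-.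
case: (L2dot u v) => x y /=; ring.
Qed.

Lemma L2normD u v : L2norm (u + v) <= L2norm u + L2norm v.
Proof.
rewrite -(@ler_pXn2r _ 2)// ?nnegrE ?addr_ge0 ?L2norm_ge0// L2norm_sqrD sqrrD.
rewrite -addrA [leRHS]addrAC -addrA lerD2l lerD2l lerMn2r/=.
apply: le_trans (L2_CS u v); apply: le_trans (normc_Re _); exact: ler_norm.
Qed.

Lemma L2normZ a u : L2norm (a *: u) = normc a * L2norm u.
Proof.
have := L2dot_norm (a *: u); rewrite L2dotZl L2dotZr L2dot_norm mulrA mul_conjC.
move=> /(congr1 (@complex.Re _)) /=; rewrite mul0r subr0 => /eqP.
by rewrite -exprMn eq_sym eqrXn2// ?L2norm_ge0 ?mulr_ge0 ?normc_ge0' ?L2norm_ge0// => /eqP.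
Qed.

Lemma L2norm0 : L2norm (0 : L2 mu) = 0.
Proof. by rewrite -(scale0r 0) L2normZ normc0 mul0r. Qed.

Lemma L2normN u : L2norm (- u) = L2norm u.
Proof. by rewrite -scaleN1r L2normZ normcN normc1 mul1r. Qed.

Lemma L2norm_BD u v : `|L2norm u - L2norm v| <= L2norm (u - v).
Proof.
have A (x y : L2 mu) : L2norm x - L2norm y <= L2norm (x - y).
  by have := L2normD (x - y) y; rewrite subrK lerBlDr.
have := A v u; rewrite -(L2normN (v - u)) opprB => B.
by rewrite ler_norml A andbT lerNl opprB.
Qed.

End L2Hilbert.

(** * Plancherel's theorem *)

Section Kernel.
Context (R : realType).
Implicit Types (e b x u : R).
Local Notation mu := (@lebesgue_measure R).

Lemma is_derive_scale (k x : R) : is_derive x 1 (fun y : R => k * y) k.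
Proof. by have := @is_deriveZ R R R id k x 1 1 _; rewrite [_ *: _]mulr1; apply. Qed.

(** An antiderivative of exp(-e x) (1 + cos(b x)) that vanishes at infinity. The added 1 makes the
    integrand nonnegative, as the fundamental theorem on a half line used in [integral0y_prim]
    requires; [integral_laplace_cos] subtracts it again. *)
Definition laplace_prim e b x : R :=
  expR (- e * x) * ((b * sin (b * x) - e * cos (b * x)) / (e ^+ 2 + b ^+ 2) - e^-1).

Lemma is_derive_laplace_prim e b x : 0 < e ->
  is_derive x 1 (laplace_prim e b) (expR (- (e * x)) * (1 + cos (b * x))).
Proof.
move=> e0.
have dE : is_derive x 1 (fun y => expR (- e * y)) (expR (- e * x) * - e).
  exact: (is_derive1_comp (is_derive_expR _) (is_derive_scale _ _)).
have dS : is_derive x 1 (fun y => sin (b * y)) (cos (b * x) * b).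
  exact: (is_derive1_comp (is_derive_sin _) (is_derive_scale _ _)).
have dC : is_derive x 1 (fun y => cos (b * y)) (- sin (b * x) * b).
  exact: (is_derive1_comp (is_derive_cos _) (is_derive_scale _ _)).
pose c := (e ^+ 2 + b ^+ 2)^-1.
have d1 : is_derive x 1 (fun y => (b * c) * sin (b * y)) ((b * c) * (cos (b * x) * b)).
  exact: (is_deriveZ _ dS).
have d2 : is_derive x 1 (fun y => (e * c) * cos (b * y)) ((e * c) * (- sin (b * x) * b)).
  exact: (is_deriveZ _ dC).
have d3 := is_deriveB (is_deriveB d1 d2) (is_derive_cst (e^-1) x 1).
have d4 := is_deriveM dE d3.
have LE : laplace_prim e b = (fun y => expR (- e * y) *
    (b * c * sin (b * y) - e * c * cos (b * y) - e^-1)).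
  apply/funext => y; rewrite /laplace_prim; congr (_ * (_ - _)).
  by rewrite mulrBl -/c mulrAC [e * _ / _]mulrAC.
rewrite LE; apply: (is_derive_eq d4).
have D0 : e ^+ 2 + b ^+ 2 != 0 by rewrite gt_eqF// ltr_pwDl// ?exprn_gt0// sqr_ge0.
rewrite /GRing.scale /= !fctE mulNr /c; field.
by rewrite D0 gt_eqF.
Qed.

Lemma is_derive_continuous (F f : R -> R) (x : R) :
  is_derive x 1 F (f x) -> {for x, continuous F}.
Proof. by move=> h; apply/differentiable_continuous/derivable1_diffP. Qed.

Lemma integral0y_prim (f F : R -> R) (l : R) :
  (forall x, 0 <= f x) -> continuous f ->
  (forall x, is_derive x 1 F (f x)) -> F x @[x --> +oo] --> l ->
  (\int[mu]_(x in `[0%R, +oo[) (f x)%:E = (l - F 0)%:E)%E.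
Proof.
move=> f0 cf dF Fl; rewrite EFinB; apply: ge0_continuous_FTC2y => //.
- exact: continuous_subspaceT.
- by apply: cvg_at_right_filter; exact: (is_derive_continuous (dF 0)).
- by move=> x _; rewrite derive1E; apply: derive_val.
Qed.

Lemma integralT_even (f : R -> R) (l : R) :
  (forall x, 0 <= f x) -> continuous f -> (forall x, f (- x) = f x) ->
  (\int[mu]_(x in `[0%R, +oo[) (f x)%:E = l%:E)%E ->
  (\int[mu]_x (f x)%:E = (2 * l)%:E)%E.
Proof.
move=> f0 cf ef fl; rewrite ge0_symfun_integralT//; last by move=> x /=; rewrite ef.
rewrite EFinM -fl; congr (_ * integral _ _ _)%E.
by apply/seteqP; split => x /=; rewrite in_itv/= andbT.
Qed.

Lemma continuous_scale (k : R) : continuous (fun y : R => k * y).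
Proof. by move=> x; apply: (is_derive_continuous (f := cst k)); exact: is_derive_scale. Qed.

Lemma continuous_laplace e b : continuous (fun x => expR (- (e * `|x|)) * (1 + cos (b * x))).
Proof.
move=> x; apply: cvgM.
  apply: continuous_comp; last exact: continuous_expR.
  apply: cvgN; apply: (continuous_comp (f := @Num.norm R R) (g := fun y => e * y)).
    exact: norm_continuous.
  exact: continuous_scale.
apply: cvgD; first exact: cvg_cst.
apply: continuous_comp; first exact: continuous_scale.
exact: continuous_cos.
Qed.

Lemma cos_ge0D1 (x : R) : 0 <= 1 + cos x.
Proof. by have := cos_geN1 x; lra. Qed.

Lemma cvg_laplace_prim e b : 0 < e -> laplace_prim e b x @[x --> +oo] --> 0.
Proof.
move=> e0; pose K := (`|b| + e) / (e ^+ 2 + b ^+ 2) + e^-1.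
have D0 : 0 < e ^+ 2 + b ^+ 2 by rewrite ltr_pwDl// ?exprn_gt0// sqr_ge0.
have h : K * expR (- (e * x)) @[x --> +oo] --> 0.
  rewrite -(mulr0 K); apply: cvgM; first exact: cvg_cst.
  apply: (cvg_comp (fun x => e * x) (fun y => expR (- y)) _ (@cvgr_expR R)).
  by apply: gt0_cvgMry => //; exact: cvg_id.
apply: (@squeeze_cvgr _ _ _ _ (fun x => - (K * expR (- (e * x)))) (fun x => K * expR (- (e * x)))) => //.
  apply: nearW => x; rewrite -ler_norml /laplace_prim normrM mulNr.
  rewrite (ger0_norm (expR_ge0 _)) mulrC ler_wpM2r ?expR_ge0//.
  apply: le_trans (ler_normB _ _) _; apply: lerD.
    rewrite normrM normfV (ger0_norm (ltW D0)) ler_wpM2r ?invr_ge0 ?(ltW D0)//.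
    apply: le_trans (ler_normB _ _) _; rewrite !normrM (ger0_norm (ltW e0)).
    apply: lerD; first by rewrite ler_piMr// sin_max.
    by rewrite ler_piMr ?cos_max// ltW.
  by rewrite ger0_norm// invr_ge0 ltW.
by rewrite -oppr0; apply: cvgN.
Qed.

Lemma integral_laplace_cosD1 e b : 0 < e ->
  (\int[mu]_x (expR (- (e * `|x|)) * (1 + cos (b * x)))%:E =
   (2 / e + 2 * e / (e ^+ 2 + b ^+ 2))%:E)%E.
Proof.
move=> e0.
have D0 : e ^+ 2 + b ^+ 2 != 0 by rewrite gt_eqF// ltr_pwDl// ?exprn_gt0// sqr_ge0.
rewrite (@integralT_even _ (e^-1 + e / (e ^+ 2 + b ^+ 2))).
- by congr EFin; ring.
- by move=> x; rewrite mulr_ge0 ?expR_ge0 ?cos_ge0D1.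
- exact: continuous_laplace.
- by move=> x; rewrite normrN mulrN cosN.
  rewrite (eq_integral (fun x : measurableTypeR R => (expR (- (e * x)) * (1 + cos (b * x)))%:E)); last first.
    by move=> x; rewrite inE/= in_itv/= andbT => x0; rewrite ger0_norm.
  transitivity ((0 - laplace_prim e b 0)%:E); last first.
    congr EFin; rewrite /laplace_prim !mulr0 expR0 sin0 cos0; field.
    by rewrite D0 gt_eqF.
  apply: integral0y_prim.
  + by move=> x; rewrite mulr_ge0 ?expR_ge0 ?cos_ge0D1.
  + move=> x; apply: cvgM.
      apply: continuous_comp; last exact: continuous_expR.
      by apply: cvgN; exact: continuous_scale.
    apply: cvgD; first exact: cvg_cst.
    apply: continuous_comp; first exact: continuous_scale.
    exact: continuous_cos.
  + by move=> x; exact: is_derive_laplace_prim.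
  + exact: cvg_laplace_prim.
Qed.

(** The case b = 0 of [integral_laplace_cosD1], where 1 + cos 0 = 2. *)
Lemma integral_laplace e : 0 < e ->
  (\int[mu]_x (expR (- (e * `|x|)))%:E = (2 / e)%:E)%E.
Proof.
move=> e0; have := integral_laplace_cosD1 0 e0.
under eq_integral do rewrite mul0r cos0 mulrC EFinM.
rewrite ge0_integralZl//=.
- rewrite expr0n addr0 => /(congr1 (fun z => (2^-1)%:E * z)%E).
  rewrite muleA -!EFinM mulVf// mul1e => ->.
  by congr EFin; field; rewrite gt_eqF.
- apply/measurable_EFinP; apply: continuous_measurable_fun => x.
  apply: continuous_comp; last exact: continuous_expR.
  apply: cvgN; apply: (continuous_comp (f := @Num.norm R R) (g := fun y => e * y)).
    exact: norm_continuous.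
  exact: continuous_scale.
Qed.

(* The Fourier transform of [exp (- e |x|)] at [u]. *)
Definition cauchy_kernel e u : R := 2 * e / (e ^+ 2 + (2 * pi * u) ^+ 2).

Lemma cauchy_kernel_ge0 e u : 0 < e -> 0 <= cauchy_kernel e u.
Proof.
move=> e0; apply: divr_ge0; first by rewrite mulr_ge0// ltW.
by rewrite addr_ge0 ?sqr_ge0.
Qed.

Lemma continuous_cauchy_kernel e : 0 < e -> continuous (cauchy_kernel e).
Proof.
move=> e0 x; rewrite /cauchy_kernel; apply: cvgM; first exact: cvg_cst.
apply: cvgV; first by rewrite gt_eqF// ltr_pwDl// ?exprn_gt0// sqr_ge0.
apply: cvgD; first exact: cvg_cst.
apply: (continuous_comp (f := fun y => 2 * pi * y) (g := fun y => y ^+ 2)).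
  exact: continuous_scale.
exact: exprn_continuous.
Qed.

Lemma integral_cauchy_kernel e : 0 < e ->
  (\int[mu]_x (cauchy_kernel e x)%:E = 1)%E.
Proof.
move=> e0; have pi0 := pi_gt0 R.
rewrite (@integralT_even _ (2^-1)).
- by rewrite divff.
- by move=> x; exact: cauchy_kernel_ge0.
- exact: continuous_cauchy_kernel.
- by move=> x; rewrite /cauchy_kernel mulrN sqrrN.
- pose F (x : R) := pi^-1 * atan (2 * pi / e * x).
  transitivity ((pi^-1 * (pi / 2) - F 0)%:E); last first.
    by rewrite /F mulr0 atan0 mulr0 subr0 mulrA mulVf ?mul1r ?gt_eqF.
  apply: integral0y_prim.
  + by move=> x; exact: cauchy_kernel_ge0.
  + exact: continuous_cauchy_kernel.
  + move=> x.
    have d1 : is_derive x 1 (fun y => atan (2 * pi / e * y))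
       ((1 + (2 * pi / e * x) ^+ 2)^-1 * (2 * pi / e)).
      exact: (is_derive1_comp (is_derive1_atan _) (is_derive_scale _ _)).
    have d2 : is_derive x 1 (fun y => pi^-1 * atan (2 * pi / e * y))
       (pi^-1 * ((1 + (2 * pi / e * x) ^+ 2)^-1 * (2 * pi / e))).
      exact: (is_deriveZ _ d1).
    have h : 0 < e ^+ 2 + (2 * pi * x) ^+ 2.
      by rewrite ltr_pwDl// ?exprn_gt0// sqr_ge0.
    apply: (is_derive_eq d2); rewrite /cauchy_kernel.
    move: pi0 h; move: (pi) => p p0 h; field.
    by rewrite !gt_eqF.
  + apply: cvgM; first exact: cvg_cst.
    apply: (cvg_comp (fun x => 2 * pi / e * x) (@atan R) _ (@cvgy_atan R)).
    apply: gt0_cvgMry; last exact: cvg_id.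
    by rewrite divr_gt0// mulr_gt0.
Qed.

End Kernel.

(** * Lebesgue measure under translation, reflection and dilation *)

Section Invariance.
Context (R : realType).
Local Notation RT := (measurableTypeR R).
Local Notation mu := (@lebesgue_measure R).

Lemma measurable_shift (c : R) : measurable_fun setT (fun x : RT => x + c : RT).
Proof. exact: measurable_funD. Qed.

(** A measure with the right value on half-open intervals is Lebesgue measure, so only the preimage
    of an interval has to be computed. [lebesgue_measure_scale] follows the same scheme. *)
Lemma lebesgue_measure_shift (c : R) (A : set RT) : measurable A ->
  pushforward mu (fun x : RT => x + c : RT) A = mu A.
Proof.
move=> mA; have mphi := measurable_shift c.
pose m : {measure set RT -> \bar R} := measure_function_pushforward__canonical__measure_function_Measure mu mphi.
apply/esym; apply: (@lebesgue_measure_unique R m) => // _ [[a b]] _ <-.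
rewrite /m /= /pushforward (_ : _ @^-1` _ = `]a - c, b - c]%classic); last first.
  by apply/seteqP; split => x /=; rewrite !in_itv/= ltrBlDr lerBrDr.
rewrite /= !lebesgue_measure_itv/= !lte_fin ltrD2r.
by case: ifP => // _; rewrite -!EFinB; congr EFin; ring.
Qed.

Lemma integral_shift (c : R) (f : RT -> \bar R) : measurable_fun setT f ->
  (forall x, 0 <= f x)%E -> (\int[mu]_x f (x + c)%R = \int[mu]_x f x)%E.
Proof.
move=> mf f0; have mphi := measurable_shift c.
have := @ge0_integral_pushforward _ _ _ _ R _ mphi mu setT f measurableT mf (fun y _ => f0 y).
rewrite preimage_setT => <-; apply: eq_measure_integral => A mA _.
exact: lebesgue_measure_shift.
Qed.

Lemma integral_oppr (f : RT -> \bar R) : measurable_fun setT f ->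
  (forall x, 0 <= f x)%E -> (\int[mu]_x f (- x)%R = \int[mu]_x f x)%E.
Proof.
move=> mf f0; have mphi : measurable_fun setT (fun x : RT => - x : RT).
  exact: oppr_measurable.
have := @ge0_integral_pushforward _ _ _ _ R _ mphi mu setT f measurableT mf (fun y _ => f0 y).
rewrite preimage_setT => <-; apply: eq_measure_integral => A mA _.
exact: lebesgue_measureN.
Qed.

Lemma lebesgue_measure_scale (e : R) (e0 : 0 < e) (A : set RT) : measurable A ->
  (e%:E * mu ((fun x : RT => (e * x)%R : RT) @^-1` A) = mu A)%E.
Proof.
move=> mA; have mphi : measurable_fun setT (fun x : RT => e * x : RT).
  exact: measurable_funM.
pose m0 : {measure set RT -> \bar R} :=
  measure_function_pushforward__canonical__measure_function_Measure mu mphi.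
pose m : {measure set RT -> \bar R} := mscale (NngNum (ltW e0)) m0.
apply/esym; apply: (@lebesgue_measure_unique R m) => // _ [[a b]] _ <-.
rewrite /m /= /mscale/= /pushforward (_ : _ @^-1` _ = `](a / e), (b / e)]%classic); last first.
  by apply/seteqP; split => x /=; rewrite !in_itv/= ltr_pdivrMr// ler_pdivlMr// mulrC.
rewrite /= !lebesgue_measure_itv/= !lte_fin ltr_pM2r ?invr_gt0//.
case: ifP => // _; rewrite ?mule0// -!EFinB -EFinM; congr EFin; field.
by rewrite gt_eqF.
Qed.

Lemma integral_scale (e : R) (f : RT -> \bar R) : 0 < e -> measurable_fun setT f ->
  (forall x, 0 <= f x)%E -> (e%:E * \int[mu]_x f (e * x)%R = \int[mu]_x f x)%E.
Proof.
move=> e0 mf f0; have mphi : measurable_fun setT (fun x : RT => e * x : RT).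
  exact: measurable_funM.
have h := @ge0_integral_pushforward _ _ _ _ R _ mphi mu setT f measurableT mf (fun y _ => f0 y).
pose m0 : {measure set RT -> \bar R} :=
  measure_function_pushforward__canonical__measure_function_Measure mu mphi.
transitivity (\int[mscale (NngNum (ltW e0)) m0]_x f x)%E.
  by rewrite ge0_integral_mscale//= h preimage_setT.
by apply: eq_measure_integral => A mA _; exact: lebesgue_measure_scale.
Qed.

End Invariance.

Lemma cvge0_near_le (R : realType) (u : nat -> \bar R) (e : R) :
  u @ \oo --> 0%E -> 0 < e -> \forall n \near \oo, (u n <= e%:E)%E.
Proof.
move=> /fine_cvgP[fu cu] e0.
have /cvgrPdist_le/(_ _ e0) := cu; apply: filterS2 fu => n fun_ /=.
by rewrite sub0r normrN -[leRHS]/(fine e%:E) => /(le_trans (ler_norm _)); rewrite -lee_fin fineK.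
Qed.

Lemma near_le_cvge0 (R : realType) (u : nat -> \bar R) :
  (forall n, 0 <= u n)%E ->
  (forall e : R, 0 < e -> \forall n \near \oo, (u n <= e%:E)%E) ->
  u @ \oo --> 0%E.
Proof.
move=> u0 h.
have fin : \forall n \near \oo, u n \is a fin_num.
  apply: filterS (h _ (@ltr01 R)) => n h1.
  by rewrite ge0_fin_numE// (le_lt_trans h1)// ltry.
apply/fine_cvgP; split => //; apply/cvgrPdist_le => e e0.
apply: filterS2 fin (h _ e0) => n fn hn /=.
by rewrite sub0r normrN ger0_norm ?fine_ge0// -lee_fin fineK.
Qed.

(** * Continuity of translations in L2 of the line *)

Section TranslationContinuity.
Context (R : realType).
Local Notation RT := (measurableTypeR R).
Local Notation mu := (@lebesgue_measure R).
Implicit Types a b : RT -> R.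

(** The squared L2 modulus of continuity of [a]. *)
Definition l2shift a (u : R) : \bar R := (\int[mu]_t ((a (t + u)%R - a t) ^+ 2)%:E)%E.

Lemma measurable_shift_comp d (S : measurableType d) a (p q : S -> RT) :
  measurable_fun setT a -> measurable_fun setT p -> measurable_fun setT q ->
  measurable_fun setT (fun x => a (p x + q x)).
Proof.
move=> ma mp mq; apply: (measurableT_comp ma).
exact: measurable_funD.
Qed.

(** A difference of values of [b] is at most 2M in size, so its square is at most 2M times its
    absolute value. An L1 estimate is therefore enough, and it follows by approximating [b] in L1 by
    a continuous function. *)
Lemma l2shift_bounded b (M : R) (u : nat -> R) (e : R) : 0 < e -> 0 < M ->
  measurable_fun setT b -> (forall t, `|b t| <= M) -> (forall t, M < `|t| -> b t = 0) ->
  u @ \oo --> (0 : R) -> \forall n \near \oo, (l2shift b (u n) <= e%:E)%E.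
Proof.
move=> e0 M0 mb bM bs u0.
(* For shifts of size at most 1 the difference vanishes outside [K], and points of [K] are moved
   within [E], where the approximation [g] is controlled. *)
pose E : set RT := `[- (M + 2), M + 2]%classic.
pose K : set RT := `[- (M + 1), M + 1]%classic.
have mE : measurable E by exact: measurable_itv.
have mK : measurable K by exact: measurable_itv.
have Efin : (mu E < +oo)%E.
  by rewrite /E lebesgue_measure_itv/=; case: ifP => _; rewrite ?ltry// -EFinB ltry.
have Kfin : (mu K < +oo)%E.
  by rewrite /K lebesgue_measure_itv/=; case: ifP => _; rewrite ?ltry// -EFinB ltry.
have ib : mu.-integrable E (EFin \o b).
  apply: measurable_bounded_integrable => //; first exact: measurable_funS mb.
  by exists M; split; rewrite ?num_real// => r Mr x _ /=; rewrite (le_trans (bM x))// ltW.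
(* The final bound is 2M (dl + 2 dl + dl) = 8 M dl: two approximation errors and one shift of the
   continuous function. *)
pose dl : R := e / (8 * M).
have dl0 : 0 < dl by rewrite divr_gt0// mulr_gt0.
have [g_ [cg_ ig_ gb_]] := approximation_continuous_integrable mE Efin ib.
have [g [cg ig gb]] : exists g : R -> R, [/\ continuous g, mu.-integrable E (EFin \o g) &
    (\int[mu]_(z in E) `|(b z - g z)%:E| <= dl%:E)%E].
  have [n _ /(_ n (leqnn n))/= h] := cvge0_near_le gb_ dl0.
  by exists (g_ n).
have mg : measurable_fun setT g by exact: continuous_measurable_fun.
have [G gG] : exists G : R, forall x, E x -> `|g x| <= G.
  have /(@EVT_max _ (fun x => `|g x|)) : - (M + 2) <= M + 2 by move: M0; lra.
  case.
    apply: continuous_subspaceT => x; apply: (continuous_comp (g := @Num.norm R R)).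
      exact: cg.
    exact: norm_continuous.
  move=> c _ h; exists `|g c| => x; rewrite /E/= => xE; exact: h.
have G0 : 0 <= G.
  by apply: le_trans (gG 0 _) => //; rewrite /E/= in_itv/=; move: M0; lra.
pose phi : RT -> \bar R := (fun z => `|(b z - g z)%:E|%E) \_ E.
(* Since [G] bounds [g] on [E] only, the minimum provides a dominating constant for all n; it is
   inactive on [K] as soon as |u n| <= 1. *)
pose psi n : RT -> \bar R := fun t => (Num.min `|g (t + u n) - g t| (2 * G))%:E.
have phi0 t : (0 <= phi t)%E by rewrite /phi patchE; case: ifP.
have mphi : measurable_fun setT phi.
  apply/(measurable_restrictT _ _).1 => //; apply: measurable_funTS.
  by apply/measurableT_comp => //; apply/measurable_EFinP; exact: measurable_funB.
have psi0 n t : (0 <= psi n t)%E.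
  by rewrite /psi lee_fin le_min normr_ge0/= mulr_ge0.
have mpsi n : measurable_fun setT (psi n).
  apply/measurable_EFinP; apply: measurable_minr => //.
  apply: measurableT_comp => //; apply: measurable_funB => //.
  exact: measurable_shift_comp.
have psi_cvg : (\int[mu]_(t in K) psi n t)%E @[n --> \oo] --> 0%E.
  have [] := @dominated_convergence _ _ R mu K mK psi (cst 0%E) (cst (2 * G)%:E) _ _ _ _ _ => //.
  - by move=> n; exact: measurable_funTS.
  - apply: nearW => t _; rewrite /psi; apply/cvg_EFin; first exact: nearW.
    have h : `|g (t + u n) - g t| @[n --> \oo] --> (0 : R).
      rewrite -(normr0 R) -(subrr (g t)); apply: cvg_norm; apply: cvgB; last exact: cvg_cst.
      apply: (cvg_comp (fun n => t + u n) g); last exact: cg.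
      by rewrite -{2}(addr0 t); apply: cvgD; first exact: cvg_cst.
    apply: (@squeeze_cvgr _ _ _ _ (cst 0) (fun n => `|g (t + u n) - g t|)) => //.
      apply: nearW => n; rewrite /cst/= le_min normr_ge0/= mulr_ge0//=.
      by rewrite ge_min lexx.
    exact: cvg_cst.
  - rewrite (_ : cst _ = EFin \o cst (2 * G))//; apply: measurable_bounded_integrable => //.
    by exists (2 * G); split; rewrite ?num_real// => r Gr x _ /=; rewrite ger0_norm ?mulr_ge0// ltW.
  - apply: nearW => t n _; rewrite gee0_abs//= lee_fin ge_min.
    by rewrite lexx orbT.
  move=> _ _; rewrite (_ : (\int[mu]_(x in K) cst 0 x)%E = 0%E) ?integral0//.
have dl20 : 0 < 2 * dl by rewrite mulr_gt0.
have un1 : \forall n \near \oo, `|u n| <= 1.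
  by have /cvgrPdist_le/(_ 1 ltr01) := u0; apply: filterS => n; rewrite sub0r normrN.
apply: filterS2 un1 (cvge0_near_le psi_cvg dl20) => n un1 psin.
have -> : e%:E = ((2 * M)%:E * (dl%:E + (2 * dl)%:E + dl%:E))%E.
  rewrite -!EFinD -EFinM /dl; congr EFin; field; rewrite gt_eqF//.
have intphi : (\int[mu]_t phi t <= dl%:E)%E by rewrite /phi -integral_mkcond.
have mpsiK : measurable_fun setT (psi n \_ K).
  by apply/(measurable_restrictT _ _).1 => //; exact: measurable_funTS.
have psiK0 t : (0 <= (psi n \_ K) t)%E by rewrite patchE; case: ifP.
have mphiu : measurable_fun setT (fun t : RT => phi (t + u n)).
  exact: (measurableT_comp mphi (measurable_shift _)).
apply: (@le_trans _ _ (\int[mu]_t ((2 * M)%:E * (phi (t + u n)%R + (psi n \_ K) t + phi t)))%E).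
  apply: ge0_le_integral => //.
  - by move=> t _; rewrite lee_fin sqr_ge0.
  - apply/measurable_EFinP; apply: measurable_funX; apply: measurable_funB => //.
    exact: measurable_shift_comp.
  - apply: measurable_funeM; apply: emeasurable_funD => //; exact: emeasurable_funD.
  move=> t _; have [tK|tK] := pselect (K t); last first.
    have tM : M + 1 < `|t|.
      rewrite ltNge; apply/negP => h; apply: tK; rewrite /K/= in_itv/=.
      by move: h; rewrite ler_norml.
    have -> : b t = 0 by apply: bs; move: tM; lra.
    have -> : b (t + u n) = 0.
      apply: bs; have := lerB_normD t (u n); move: tM un1; lra.
    by rewrite subrr expr0n mule_ge0 ?adde_ge0// lee_fin mulr_ge0// ltW.
  have tE : E t by move: tK; rewrite /K /E/= !in_itv/=; lra.
  have tuE : E (t + u n).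
    move: tK un1; rewrite /K /E/= !in_itv/= ler_norml; lra.
  rewrite /phi !patchE !mem_set// /psi -!EFinD -EFinM lee_fin.
  rewrite (min_idPl _); last first.
    by apply: le_trans (ler_normB _ _) _; have := gG _ tE; have := gG _ tuE; lra.
  apply: (@le_trans _ _ (2 * M * `|b (t + u n) - b t|)).
    rewrite -(real_normK (num_real _)) expr2 ler_wpM2r//.
    by apply: le_trans (ler_normB _ _) _; have := bM t; have := bM (t + u n); lra.
  rewrite ler_wpM2l ?mulr_ge0 ?(ltW M0)//.
  rewrite (_ : b (t + u n) - b t = (b (t + u n) - g (t + u n)) + (g (t + u n) - g t)
    - (b t - g t)); last by ring.
  apply: le_trans (ler_normB _ _) _; rewrite lerD2r; exact: ler_normD.
rewrite ge0_integralZl//; last 3 first.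
- by apply: emeasurable_funD => //; exact: emeasurable_funD.
- by move=> t _; rewrite !adde_ge0.
- by rewrite lee_fin mulr_ge0// ltW.
rewrite lee_wpmul2l ?lee_fin ?mulr_ge0 ?(ltW M0)//.
rewrite ge0_integralD//; last 2 first.
- by move=> t _; rewrite adde_ge0.
- exact: emeasurable_funD.
have psiKE : (\int[mu]_t (psi n \_ K) t = \int[mu]_(t in K) psi n t)%E.
  by rewrite [RHS]integral_mkcond.
rewrite ge0_integralD// integral_shift// psiKE.
by apply: leeD => //; apply: leeD.
Qed.

Lemma l2shift_le a (u : R) : measurable_fun setT a ->
  (l2shift a u <= 4%:E * \int[mu]_t (a t ^+ 2)%:E)%E.
Proof.
move=> ma.
have ma2 : measurable_fun setT (fun t : RT => (a t ^+ 2)%:E).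
  by apply/measurable_EFinP; exact: measurable_funX.
have mau : measurable_fun setT (fun t : RT => (a (t + u) ^+ 2)%:E).
  by apply/measurable_EFinP; apply: measurable_funX; exact: measurable_shift_comp.
apply: (@le_trans _ _ (\int[mu]_t (2%:E * ((a (t + u)%R ^+ 2)%:E + (a t ^+ 2)%:E)))%E).
  apply: ge0_le_integral => //.
  - by move=> t _; rewrite lee_fin sqr_ge0.
  - apply/measurable_EFinP; apply: measurable_funX; apply: measurable_funB => //.
    exact: measurable_shift_comp.
  - by apply: measurable_funeM; exact: emeasurable_funD.
  - move=> t _; rewrite -EFinD -EFinM lee_fin.
    by have := sqr_ge0 (a (t + u) + a t); lra.
rewrite ge0_integralZl//; last 2 first.
- exact: emeasurable_funD.
- by move=> t _; rewrite -EFinD lee_fin addr_ge0// sqr_ge0.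
rewrite ge0_integralD//; [|by move=> t _; rewrite lee_fin sqr_ge0..].
rewrite (integral_shift u ma2); last by move=> t; rewrite lee_fin sqr_ge0.
set I := integral _ _ _.
have I0 : (0 <= I)%E by apply: integral_ge0 => t _; rewrite lee_fin sqr_ge0.
have -> : (I + I = 2%:E * I)%E.
  by rewrite (_ : 2%:E = 1 + 1)%E// ge0_muleDl// mul1e.
by rewrite muleA -EFinM (_ : 2 * 2 = 4)//; ring.
Qed.

(** Truncating [a] in both height and support gives functions covered by [l2shift_bounded]; the
    truncation error is small in L2 by dominated convergence and is unchanged by the shift. *)
Lemma l2shift_cvg a (u : nat -> R) : measurable_fun setT a ->
  (\int[mu]_t (a t ^+ 2)%:E < +oo)%E -> u @ \oo --> (0 : R) ->
  l2shift a (u n) @[n --> \oo] --> 0%E.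
Proof.
move=> ma ia u0.
have ma2 : measurable_fun setT (fun t : RT => (a t ^+ 2)%:E).
  by apply/measurable_EFinP; exact: measurable_funX.
pose am (k : nat) (t : RT) := if (`|t| <= k%:R) && (`|a t| <= k%:R) then a t else 0.
have mam k : measurable_fun setT (am k).
  apply: measurable_fun_ifT => //; apply: measurable_and.
  - by apply: measurable_fun_ler => //; exact: measurableT_comp.
  - by apply: measurable_fun_ler => //; exact: measurableT_comp.
pose r k := (\int[mu]_t ((a t - am k t) ^+ 2)%:E)%E.
have mr k : measurable_fun setT (fun t : RT => ((a t - am k t) ^+ 2)%:E).
  by apply/measurable_EFinP; apply: measurable_funX; exact: measurable_funB.
have rcvg : r k @[k --> \oo] --> 0%E.
  have [] := @dominated_convergence _ _ R mu setT measurableT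
    (fun k t => ((a t - am k t) ^+ 2)%:E) (cst 0%E) (fun t => (a t ^+ 2)%:E) mr _ _ _ _ => //.
  - apply: nearW => t _; apply: cvg_near_cst.
    near=> k; rewrite /am ifT ?subrr ?expr0n//; apply/andP; split.
      by near: k; exact: nbhs_infty_ger.
    by near: k; exact: nbhs_infty_ger.
  - apply/integrableP; split => //; under eq_integral do rewrite gee0_abs ?lee_fin ?sqr_ge0//.
    exact: ia.
  - apply: nearW => t k _; rewrite gee0_abs ?lee_fin ?sqr_ge0// /am.
    by case: ifP => _; rewrite ?subrr ?subr0 ?expr0n// sqr_ge0.
  by move=> _ _; rewrite (_ : (\int[mu]_x cst 0 x)%E = 0%E) ?integral0.
apply: near_le_cvge0.
  by move=> n; apply: integral_ge0 => t _; rewrite lee_fin sqr_ge0.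
(* There are three error terms, and (x + y + z)^2 <= 3 (x^2 + y^2 + z^2) contributes another factor
   3. *)
move=> e e0; have e9 : 0 < e / 9 by rewrite divr_gt0.
have [k _ /(_ k (leqnn k))/= rk] := cvge0_near_le rcvg e9.
(* The successor makes the truncation level positive; the error decreases with the level, so the
   bound found at [k] persists. *)
have := @l2shift_bounded (am k.+1) k.+1%:R u (e / 9) e9 _ (mam _) _ _ u0.
have rk1 : (r k.+1 <= (e / 9)%:E)%E.
  apply: le_trans rk; apply: ge0_le_integral => //.
  - by move=> t _; rewrite lee_fin sqr_ge0.
  - move=> t _; rewrite lee_fin /am; case: ifPn => [_|].
      by rewrite subrr expr0n sqr_ge0.
    rewrite subr0; case: ifPn => [/andP[h1 h2] /negP[]|_ _]; last by rewrite subr0.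
    apply/andP; split.
      by apply: le_trans h1 _; rewrite ler_nat.
    by apply: le_trans h2 _; rewrite ler_nat.
move=> H; have {}H : \forall n \near \oo, (l2shift (am k.+1) (u n) <= (e / 9)%:E)%E.
  apply: H => //.
  - by move=> t; rewrite /am; case: ifPn => [/andP[_ h]|_] //; rewrite normr0.
  - by move=> t tk; rewrite /am ifF// leNgt tk.
apply: filterS H => n Hn.
pose h t := a t - am k.+1 t.
have mh : measurable_fun setT h by exact: measurable_funB.
have mh2 : measurable_fun setT (fun t : RT => (h t ^+ 2)%:E) by exact: mr.
have mhu : measurable_fun setT (fun t : RT => (h (t + u n) ^+ 2)%:E).
  by apply/measurable_EFinP; apply: measurable_funX; exact: measurable_shift_comp.
have md (b : RT -> R) : measurable_fun setT b ->
    measurable_fun setT (fun t : RT => ((b (t + u n) - b t) ^+ 2)%:E).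
  move=> mb; apply/measurable_EFinP; apply: measurable_funX; apply: measurable_funB => //.
  exact: measurable_shift_comp.
apply: (@le_trans _ _ (\int[mu]_t (3%:E * ((h (t + u n)%R ^+ 2)%:E +
    ((am k.+1 (t + u n)%R - am k.+1 t) ^+ 2)%:E + (h t ^+ 2)%:E)))%E).
  apply: ge0_le_integral => //.
  - by move=> t _; rewrite lee_fin sqr_ge0.
  - exact: md.
  - apply: measurable_funeM; apply: emeasurable_funD => //; apply: emeasurable_funD => //.
    exact: md.
  - move=> t _; rewrite -!EFinD -EFinM lee_fin /h.
    set x := a (t + u n); set y := am _ (t + u n); set z := a t; set w := am _ t.
    have := sqr_ge0 ((x - y) - (y - w)); have := sqr_ge0 ((y - w) + (z - w)).
    have := sqr_ge0 ((x - y) + (z - w)); nra.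
rewrite ge0_integralZl//; last 2 first.
- by apply: emeasurable_funD => //; apply: emeasurable_funD => //; exact: md.
- by move=> t _; rewrite -!EFinD lee_fin !addr_ge0// sqr_ge0.
rewrite ge0_integralD//; first last.
- by move=> t _; rewrite lee_fin sqr_ge0.
- by apply: emeasurable_funD => //; exact: md.
- by move=> t _; rewrite -!EFinD lee_fin !addr_ge0// sqr_ge0.
rewrite ge0_integralD//; first last.
- exact: md.
- by move=> t _; rewrite lee_fin sqr_ge0.
- by move=> t _; rewrite lee_fin sqr_ge0.
rewrite (integral_shift (u n) mh2); last by move=> t; rewrite lee_fin sqr_ge0.
have -> : e%:E = (3%:E * ((e / 9)%:E + (e / 9)%:E + (e / 9)%:E))%E.
  by rewrite -!EFinD -EFinM; congr EFin; field.
by rewrite lee_wpmul2l// ?lee_fin//; apply: leeD => //; apply: leeD.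
Unshelve. all: by end_near. Qed.

Lemma measurable_l2shift a : measurable_fun setT a -> measurable_fun setT (l2shift a).
Proof.
move=> ma.
apply: (@measurable_fun_fubini_tonelli_F _ _ RT RT R mu
   (fun x : RT * RT => ((a (x.2 + x.1) - a x.2) ^+ 2)%:E)).
  apply/measurable_EFinP; apply: measurable_funX; apply: measurable_funB.
    exact: measurable_shift_comp.
  exact: measurableT_comp.
by move=> x; rewrite lee_fin sqr_ge0.
Qed.

(** The dilation u = e v replaces the moving kernel by the fixed one at parameter 1 and puts e
    inside the shift. Dominated convergence then applies: the shifts tend to 0 by [l2shift_cvg], and
    [l2shift_le] bounds the integrand by a multiple of the kernel, whose mass is 1. *)
Lemma integral_cauchy_l2shift a (e : nat -> R) : measurable_fun setT a ->
  (\int[mu]_t (a t ^+ 2)%:E < +oo)%E -> (forall n, 0 < e n) -> e @ \oo --> (0 : R) ->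
  (\int[mu]_u ((cauchy_kernel (e n) u)%:E * l2shift a u))%E @[n --> \oo] --> 0%E.
Proof.
move=> ma ia e0 ecvg.
have ms u : (0 <= l2shift a u)%E.
  by apply: integral_ge0 => t _; rewrite lee_fin sqr_ge0.
have mck k : 0 < k -> measurable_fun [set: RT] (fun u : RT => (cauchy_kernel k u)%:E).
  move=> k0; apply/measurable_EFinP; apply: continuous_measurable_fun.
  exact: continuous_cauchy_kernel.
have E n : (\int[mu]_u ((cauchy_kernel (e n) u)%:E * l2shift a u) =
    \int[mu]_v ((cauchy_kernel 1 v)%:E * l2shift a (e n * v)%R))%E.
  rewrite -(integral_scale (e0 n)); first last.
  - by move=> x; rewrite mule_ge0// lee_fin cauchy_kernel_ge0.
  - by apply: emeasurable_funM; [exact: mck|exact: measurable_l2shift].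
  rewrite -ge0_integralZl//; first last.
  - by rewrite lee_fin ltW.
  - by move=> x _; rewrite mule_ge0// lee_fin cauchy_kernel_ge0.
  - have h1 := emeasurable_funM (mck _ (e0 n)) (measurable_l2shift ma).
    apply: (measurableT_comp h1); exact: measurable_funM.
  apply: eq_integral => v _; rewrite muleA -EFinM; congr (_%:E * _)%E.
  rewrite /cauchy_kernel; have := e0 n; have := sqr_ge0 (2 * pi * v).
  move: (e n) (pi) => k p; move=> h k0; field.
  by apply/andP; split; rewrite gt_eqF// ltr_pwDl// ?exprn_gt0// sqr_ge0.
under eq_fun do rewrite E.
set A := (\int[mu]_t (a t ^+ 2)%:E)%E in ia.
have Afin : A \is a fin_num.
  by rewrite ge0_fin_numE//; apply: integral_ge0 => t _; rewrite lee_fin sqr_ge0.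
have ick : mu.-integrable setT (fun v : RT => (cauchy_kernel 1 v)%:E).
  apply/integrableP; split; first exact: mck.
  under eq_integral do rewrite gee0_abs ?lee_fin ?cauchy_kernel_ge0//.
  by rewrite integral_cauchy_kernel// ltry.
have [] := @dominated_convergence _ _ R mu setT measurableT
    (fun n (v : RT) => (cauchy_kernel 1 v)%:E * l2shift a (e n * v)%R)%E (cst 0%E)
    (fun v : RT => (4 * fine A)%:E * (cauchy_kernel 1 v)%:E)%E _ _ _ _ _ => //.
- move=> n; apply: emeasurable_funM; first exact: mck.
  apply: (measurableT_comp (measurable_l2shift ma)); exact: measurable_funM.
- apply: nearW => v _; rewrite /cst -(mule0 (cauchy_kernel 1 v)%:E).
  apply: cvgeZl => //; apply: l2shift_cvg => //.
  by rewrite -(mul0r v); apply: cvgM => //; exact: cvg_cst.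
- exact: integrableZl.
- apply: nearW => v n _; rewrite gee0_abs; last first.
    by rewrite mule_ge0// lee_fin cauchy_kernel_ge0.
  rewrite muleC lee_wpmul2r ?lee_fin ?cauchy_kernel_ge0// EFinM fineK//.
  exact: l2shift_le.
by move=> _ _; rewrite (_ : (\int[mu]_x cst 0 x)%E = 0%E) ?integral0.
Qed.

End TranslationContinuity.

(** * Fubini and Tonelli on products *)

Section ProductIntegrals.
Context d1 d2 (T1 : measurableType d1) (T2 : measurableType d2) (R : realType).
Variable m1 : {sigma_finite_measure set T1 -> \bar R}.
Variable m2 : {sigma_finite_measure set T2 -> \bar R}.

(** The positive and negative parts have measurable parameter integrals by Tonelli, and [fine] is
    measurable; this covers also those parameters at which the integral diverges and [fine] returns
    a default value. *)
Lemma measurable_param_Rintegral (f : T1 * T2 -> R) : measurable_fun setT f ->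
  measurable_fun setT (fun x => \int[m2]_y f (x, y)).
Proof.
move=> mf; have mEf : measurable_fun setT (EFin \o f) by exact/measurable_EFinP.
rewrite (_ : (fun x => _) = fine \o (fun x => fubini_F m2 (EFin \o f)^\+ x - fubini_F m2 (EFin \o f)^\- x)%E).
  apply: measurableT_comp; first exact: fine_measurable.
  by apply: emeasurable_funB; apply: measurable_fun_fubini_tonelli_F => //;
    [exact: measurable_funepos|exact: measurable_funeneg].
apply/funext => x; rewrite /= /Rintegral /fubini_F integralE; congr (fine (_ - _))%E; apply: eq_integral => y _; by rewrite !unlock.
Qed.

Lemma integrable_sfprodM (f : T1 -> R) (g : T2 -> R) :
  m1.-integrable setT (EFin \o f) -> m2.-integrable setT (EFin \o g) ->
  (sfprod m1 m2).-integrable setT (fun z => (f z.1 * g z.2)%:E).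
Proof.
move=> /integrableP[/measurable_EFinP mf fi] /integrableP[/measurable_EFinP mg gi].
have mfg : measurable_fun setT (fun z : T1 * T2 => (f z.1 * g z.2)%:E).
  apply/measurable_EFinP; apply: measurable_funM; exact: measurableT_comp.
apply/(@integrable12ltyP _ _ T1 T2 R m1 m2 _ mfg).
rewrite (eq_integral (fun x => `|(f x)%:E| * \int[m2]_y `|(g y)%:E|)%E); last first.
  move=> x _; under eq_integral do rewrite /= normrM EFinM.
  by rewrite ge0_integralZl//; apply/measurable_EFinP; exact: measurableT_comp.
rewrite ge0_integralZr//.
- by apply: lte_mul_pinfty => //; [exact: integral_ge0|rewrite ge0_fin_numE//; exact: integral_ge0].
- by apply/measurableT_comp => //; exact/measurable_EFinP.
- exact: integral_ge0.
Qed.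

Lemma Rintegral_sfprodM (f : T1 -> R) (g : T2 -> R) :
  m1.-integrable setT (EFin \o f) -> m2.-integrable setT (EFin \o g) ->
  \int[sfprod m1 m2]_z (f z.1 * g z.2) = (\int[m1]_x f x) * (\int[m2]_y g y).
Proof.
move=> fi gi; have fgi := integrable_sfprodM fi gi.
rewrite {1}/Rintegral -(@integral12_prod_meas1 _ _ T1 T2 R m1 m2 _ fgi) /fubini_F/=.
under eq_integral do (under eq_integral do rewrite EFinM; rewrite integralZl//).
have gfin : (\int[m2]_y (g y)%:E)%E \is a fin_num by exact: integrable_fin_num.
by rewrite -{1}(fineK gfin) integralZr// fineM//; exact: integrable_fin_num.
Qed.

Lemma sfprod_fubini (f : T1 * T2 -> \bar R) :
  (sfprod m1 m2).-integrable setT f ->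
  (\int[m1]_x \int[m2]_y f (x, y) = \int[m2]_y \int[m1]_x f (x, y))%E.
Proof.
move=> fi; have := @integral12_prod_meas1 _ _ T1 T2 R m1 m2 _ fi.
by have := @integral21_prod_meas1 _ _ T1 T2 R m1 m2 _ fi => <-.
Qed.

Lemma sfprod_tonelli1 (f : T1 * T2 -> \bar R) : measurable_fun setT f ->
  (forall x, 0 <= f x)%E ->
  (\int[sfprod m1 m2]_z f z = \int[m1]_x \int[m2]_y f (x, y))%E.
Proof. by move=> mf f0; exact: (@fubini_tonelli1 _ _ T1 T2 R m1 m2 f mf f0). Qed.

Lemma sfprod_tonelli2 (f : T1 * T2 -> \bar R) : measurable_fun setT f ->
  (forall x, 0 <= f x)%E ->
  (\int[sfprod m1 m2]_z f z = \int[m2]_y \int[m1]_x f (x, y))%E.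
Proof. by move=> mf f0; exact: (@fubini_tonelli2 _ _ T1 T2 R m1 m2 f mf f0). Qed.

Lemma sfprod_tonelli (f : T1 * T2 -> \bar R) : measurable_fun setT f ->
  (forall x, 0 <= f x)%E ->
  (\int[m1]_x \int[m2]_y f (x, y) = \int[m2]_y \int[m1]_x f (x, y))%E.
Proof. by move=> mf f0; rewrite -sfprod_tonelli1// sfprod_tonelli2. Qed.

End ProductIntegrals.

(** * Plancherel's theorem for real functions on the line *)

Section RealPlancherel.
Context (R : realType).
Local Notation RT := (measurableTypeR R).
Local Notation mu := (@lebesgue_measure R).
Local Notation mu2 := (sfprod mu mu).
Variable a : RT -> R.
Hypothesis ma : measurable_fun setT a.
Hypothesis ia : mu.-integrable setT (EFin \o a).
Hypothesis sa : (\int[mu]_t (a t ^+ 2)%:E < +oo)%E.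

(** With [sinT], the real part and the negated imaginary part of the Fourier transform of the real
    function [a]. *)
Definition cosT (x : R) : R := \int[mu]_t (a t * cos (2 * pi * (t * x))).
Definition sinT (x : R) : R := \int[mu]_t (a t * sin (2 * pi * (t * x))).

Lemma measurable_cosarg d (S : measurableType d) (p q : S -> RT) :
  measurable_fun setT p -> measurable_fun setT q ->
  measurable_fun setT (fun x => cos (2 * pi * (p x * q x) : R)).
Proof.
move=> mp mq; have mcos : measurable_fun [set: RT] (@cos R).
  by apply: continuous_measurable_fun; exact: continuous_cos.
apply: (measurableT_comp mcos); apply: measurable_funM => //; exact: measurable_funM.
Qed.

Lemma measurable_sinarg d (S : measurableType d) (p q : S -> RT) :
  measurable_fun setT p -> measurable_fun setT q ->
  measurable_fun setT (fun x => sin (2 * pi * (p x * q x) : R)).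
Proof.
move=> mp mq; have msin : measurable_fun [set: RT] (@sin R).
  by apply: continuous_measurable_fun; exact: continuous_sin.
apply: (measurableT_comp msin); apply: measurable_funM => //; exact: measurable_funM.
Qed.

Lemma measurable_cosT : measurable_fun setT (cosT : RT -> R).
Proof.
apply: (@measurable_param_Rintegral _ _ RT RT R mu
  (fun z : RT * RT => a z.2 * cos (2 * pi * (z.2 * z.1)))).
apply: measurable_funM; first exact: measurableT_comp.
exact: measurable_cosarg.
Qed.

Lemma measurable_sinT : measurable_fun setT (sinT : RT -> R).
Proof.
apply: (@measurable_param_Rintegral _ _ RT RT R mu
  (fun z : RT * RT => a z.2 * sin (2 * pi * (z.2 * z.1)))).
apply: measurable_funM; first exact: measurableT_comp.
exact: measurable_sinarg.
Qed.

Lemma integrable_cosT (x : R) : mu.-integrable setT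
  (EFin \o (fun t : RT => a t * cos (2 * pi * (t * x)))).
Proof.
apply: le_integrable ia => //.
  apply/measurable_EFinP; apply: measurable_funM => //; exact: measurable_cosarg.
by move=> t _; rewrite /= lee_fin normrM ler_piMr// cos_max.
Qed.

Lemma integrable_sinT (x : R) : mu.-integrable setT
  (EFin \o (fun t : RT => a t * sin (2 * pi * (t * x)))).
Proof.
apply: le_integrable ia => //.
  apply/measurable_EFinP; apply: measurable_funM => //; exact: measurable_sinarg.
by move=> t _; rewrite /= lee_fin normrM ler_piMr// sin_max.
Qed.

Let phase (z : RT * RT) (x : R) : R := cos (2 * pi * ((z.1 - z.2) * x)).

(** The formula for cos(A - B) splits the double integral into two products of single integrals. *)
Lemma cosT_sinT_sqr (x : R) : mu2.-integrable setT (fun z => (a z.1 * a z.2 * phase z x)%:E) /\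
  \int[mu2]_z (a z.1 * a z.2 * phase z x) = cosT x ^+ 2 + sinT x ^+ 2.
Proof.
have pE z : a z.1 * a z.2 * phase z x =
    a z.1 * cos (2 * pi * (z.1 * x)) * (a z.2 * cos (2 * pi * (z.2 * x)))
    + a z.1 * sin (2 * pi * (z.1 * x)) * (a z.2 * sin (2 * pi * (z.2 * x))).
  by rewrite /phase mulrBl mulrBr cosB; ring.
have ic := integrable_sfprodM (integrable_cosT x) (integrable_cosT x).
have is_ := integrable_sfprodM (integrable_sinT x) (integrable_sinT x).
split.
  by under eq_fun do rewrite pE EFinD; exact: integrableD.
under eq_Rintegral do rewrite pE.
rewrite RintegralD// (Rintegral_sfprodM (integrable_cosT x) (integrable_cosT x)).
by rewrite (Rintegral_sfprodM (integrable_sinT x) (integrable_sinT x)) -!expr2.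
Qed.

Lemma integrable_laplace (e : R) : 0 < e ->
  mu.-integrable setT (EFin \o (fun x : RT => expR (- (e * `|x|)))).
Proof.
move=> e0; apply/integrableP; split.
  apply/measurable_EFinP; apply: measurableT_comp => //; apply: measurableT_comp => //.
  by apply: measurable_funM => //; exact: measurableT_comp.
under eq_integral do rewrite gee0_abs ?lee_fin ?expR_ge0//.
by rewrite integral_laplace// ltry.
Qed.

Lemma integral_laplace_cos (e u : R) : 0 < e ->
  (\int[mu]_x (expR (- (e * `|x|)) * cos (2 * pi * (u * x)))%:E =
   (cauchy_kernel e u)%:E)%E.
Proof.
move=> e0; have iL := integrable_laplace e0.
have mL : measurable_fun setT (fun x : RT => expR (- (e * `|x|))).
  by have /measurable_EFinP := measurable_int _ iL.
have iC : mu.-integrable setT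
    (EFin \o (fun x : RT => expR (- (e * `|x|)) * (1 + cos (2 * pi * u * x)))).
  apply/integrableP; split.
    apply/measurable_EFinP; apply: measurable_funM => //; apply: measurable_funD => //.
    under eq_fun do rewrite -mulrA.
    exact: measurable_cosarg.
  under eq_integral do rewrite gee0_abs ?lee_fin ?mulr_ge0 ?expR_ge0 ?cos_ge0D1//.
  by rewrite integral_laplace_cosD1// ltry.
under eq_integral.
  move=> x _.
  have -> : expR (- (e * `|x|)) * cos (2 * pi * (u * x)) =
    expR (- (e * `|x|)) * (1 + cos (2 * pi * u * x)) - expR (- (e * `|x|)).
    by rewrite mulrA; ring.
  rewrite EFinB; over.
rewrite integralB_EFin//= integral_laplace// integral_laplace_cosD1// -EFinB.
by congr EFin; rewrite /cauchy_kernel; ring.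
Qed.

(** The damping makes the integrand integrable in all three variables together, so the x-integral
    can be done first; it yields the Cauchy kernel at the difference of the two remaining
    variables. *)
Lemma integral_damped (e : R) : 0 < e ->
  (\int[mu]_x (expR (- (e * `|x|)) * (cosT x ^+ 2 + sinT x ^+ 2))%:E =
   \int[mu2]_z (a z.1 * a z.2 * cauchy_kernel e (z.1 - z.2))%:E)%E.
Proof.
move=> e0.
pose F (y : (RT * RT) * RT) := (a y.1.1 * a y.1.2 * (expR (- (e * `|y.2|)) * phase y.1 y.2))%:E.
have iaa := integrable_sfprodM ia ia.
have iF : (sfprod mu2 mu).-integrable setT F.
  have := integrable_sfprodM (m1 := mu2) iaa (integrable_laplace e0).
  apply: le_integrable => //.
    apply/measurable_EFinP; apply: measurable_funM.
      by apply: measurable_funM; apply: measurableT_comp => //; exact: measurableT_comp.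
    apply: measurable_funM.
      apply: measurableT_comp => //; apply: measurableT_comp => //.
      by apply: measurable_funM => //; exact: measurableT_comp.
    apply: measurable_cosarg => //; apply: measurable_funB => //; exact: measurableT_comp.
  move=> y _; rewrite /F /= lee_fin mulrA normrM ler_piMr// /phase.
  exact: cos_max.
transitivity (\int[mu]_x \int[mu2]_z F (z, x))%E.
  apply: eq_integral => x _; have [iz <-] := cosT_sinT_sqr x.
  rewrite EFinM /Rintegral fineK; last exact: integrable_fin_num.
  rewrite -integralZl//; apply: eq_integral => z _.
  by rewrite /F /= -EFinM; congr EFin; ring.
rewrite -(sfprod_fubini iF); apply: eq_integral => z _.
rewrite /F /=; under eq_integral do rewrite EFinM.
rewrite integralZl//; first by rewrite integral_laplace_cos// EFinM.
apply: le_integrable (integrable_laplace e0) => //.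
  apply/measurable_EFinP; apply: measurable_funM.
    by have /measurable_EFinP := measurable_int _ (integrable_laplace e0).
  exact: measurable_cosarg.
by move=> x _ /=; rewrite lee_fin normrM ler_piMr// cos_max.
Qed.

End RealPlancherel.

Section RealPlancherel2.
Context (R : realType).
Local Notation RT := (measurableTypeR R).
Local Notation mu := (@lebesgue_measure R).
Local Notation mu2 := (sfprod mu mu).
Variable a : RT -> R.
Hypothesis ma : measurable_fun setT a.
Hypothesis ia : mu.-integrable setT (EFin \o a).
Hypothesis sa : (\int[mu]_t (a t ^+ 2)%:E < +oo)%E.

Lemma measurable_cauchy_kernel (e : R) : 0 < e ->
  measurable_fun setT (cauchy_kernel e : RT -> R).
Proof. by move=> e0; apply: continuous_measurable_fun; exact: continuous_cauchy_kernel. Qed.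

(* 2 a(s) a(t) = a(s)^2 + a(t)^2 - (a(s) - a(t))^2, and the kernel has mass 1. *)
Lemma integral_cauchy_product (e : R) : 0 < e ->
  (\int[mu2]_z (a z.1 * a z.2 * cauchy_kernel e (z.1 - z.2))%:E =
   \int[mu]_t (a t ^+ 2)%:E -
   (2^-1)%:E * \int[mu]_u ((cauchy_kernel e u)%:E * l2shift a u))%E.
Proof.
move=> e0; pose P := cauchy_kernel e; have P0 u : 0 <= P u by exact: cauchy_kernel_ge0.
have mP := measurable_cauchy_kernel e0.
have mPE : measurable_fun setT (fun u : RT => (P u)%:E) by exact/measurable_EFinP.
have PN u : P (- u) = P u by rewrite /P /cauchy_kernel mulrN sqrrN.
have intP (t : R) : (\int[mu]_s (P (s - t))%:E = 1)%E.
  rewrite (integral_shift (- t) mPE); first exact: integral_cauchy_kernel.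
  by move=> x; rewrite lee_fin P0.
have ma2 : measurable_fun setT (fun t : RT => (a t ^+ 2)%:E).
  by apply/measurable_EFinP; exact: measurable_funX.
have mP2 : measurable_fun setT (fun z : RT * RT => P (z.1 - z.2)).
  by apply: (measurableT_comp mP); exact: measurable_funB.
have mPt (t : R) : measurable_fun setT (fun s : RT => (P (s - t))%:E).
  by apply/measurable_EFinP; apply: (measurableT_comp mP); exact: measurable_funB.
have ma1 : measurable_fun setT (fun z : RT * RT => a z.1) by exact: measurableT_comp.
have ma22 : measurable_fun setT (fun z : RT * RT => a z.2) by exact: measurableT_comp.
set A := (\int[mu]_t (a t ^+ 2)%:E)%E.
have A0 : (0 <= A)%E by apply: integral_ge0 => t _; rewrite lee_fin sqr_ge0.
have Afin : A \is a fin_num by rewrite ge0_fin_numE.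
pose G1 z := (P (z.1 - z.2) * (a z.1 - a z.2) ^+ 2)%:E.
pose G2 z := (P (z.1 - z.2) * (a z.1) ^+ 2)%:E.
pose G3 z := (P (z.1 - z.2) * (a z.2) ^+ 2)%:E.
pose Y z := (a z.1 * a z.2 * P (z.1 - z.2))%:E.
have mG1 : measurable_fun setT G1.
  by apply/measurable_EFinP; apply: measurable_funM => //; apply: measurable_funX; exact: measurable_funB.
have mG2 : measurable_fun setT G2.
  by apply/measurable_EFinP; apply: measurable_funM => //; exact: measurable_funX.
have mG3 : measurable_fun setT G3.
  by apply/measurable_EFinP; apply: measurable_funM => //; exact: measurable_funX.
have mY : measurable_fun setT Y.
  by apply/measurable_EFinP; apply: measurable_funM => //; exact: measurable_funM.
have G10 z : (0 <= G1 z)%E by rewrite lee_fin mulr_ge0// sqr_ge0.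
have G20 z : (0 <= G2 z)%E by rewrite lee_fin mulr_ge0// sqr_ge0.
have G30 z : (0 <= G3 z)%E by rewrite lee_fin mulr_ge0// sqr_ge0.
have IG2 : (\int[mu2]_z G2 z = A)%E.
  rewrite sfprod_tonelli1//; apply: eq_integral => s _.
  rewrite /G2/=; under eq_integral do rewrite -PN opprB EFinM.
  rewrite ge0_integralZr//; first by rewrite intP mul1e.
  - by move=> t _; rewrite lee_fin P0.
  - by rewrite lee_fin sqr_ge0.
have IG3 : (\int[mu2]_z G3 z = A)%E.
  rewrite sfprod_tonelli2//; apply: eq_integral => t _.
  rewrite /G3/=; under eq_integral do rewrite EFinM.
  rewrite ge0_integralZr//; first by rewrite intP mul1e.
  - by move=> s _; rewrite lee_fin P0.
  - by rewrite lee_fin sqr_ge0.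
set X := (\int[mu]_u ((cauchy_kernel e u)%:E * l2shift a u))%E.
(* The substitution s = t + u moves the kernel onto the shift u alone; exchanging the integrals then
   leaves [l2shift] inside. *)
have IG1 : (\int[mu2]_z G1 z = X)%E.
  rewrite sfprod_tonelli2//.
  pose H (z : RT * RT) := (P z.2 * (a (z.1 + z.2) - a z.1) ^+ 2)%:E.
  have mH : measurable_fun setT H.
    apply/measurable_EFinP; apply: measurable_funM; first exact: (measurableT_comp mP).
    apply: measurable_funX; apply: measurable_funB => //.
    by apply: (measurableT_comp ma); exact: measurable_funD.
  have H0 z : (0 <= H z)%E by rewrite lee_fin mulr_ge0// sqr_ge0.
  transitivity (\int[mu]_t \int[mu]_u H (t, u))%E.
    apply: eq_integral => t _.
    pose h (s : RT) := (P (s - t) * (a s - a t) ^+ 2)%:E.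
    have mh : measurable_fun setT h.
      apply/measurable_EFinP; apply: measurable_funM.
        by apply: (measurableT_comp mP); exact: measurable_funB.
      by apply: measurable_funX; exact: measurable_funB.
    rewrite -[LHS]/(\int[mu]_s h s)%E -(integral_shift t mh); last first.
      by move=> s; rewrite lee_fin mulr_ge0// sqr_ge0.
    by apply: eq_integral => u _; rewrite /h /H/= addrK (addrC u t).
  rewrite (sfprod_tonelli mu mu mH)//; apply: eq_integral => u _.
  rewrite /H/=; under eq_integral do rewrite EFinM.
  rewrite ge0_integralZl//.
  - apply/measurable_EFinP; apply: measurable_funX; apply: measurable_funB => //.
    by apply: (measurableT_comp ma); exact: measurable_funD.
  - by move=> t _; rewrite lee_fin sqr_ge0.
  - by rewrite lee_fin P0.
have iG2 : mu2.-integrable setT G2.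
  apply/integrableP; split => //; under eq_integral do rewrite gee0_abs//.
  by rewrite IG2.
have iG3 : mu2.-integrable setT G3.
  apply/integrableP; split => //; under eq_integral do rewrite gee0_abs//.
  by rewrite IG3.
(* The signed product is dominated by the two terms of mass [A], since |a(s) a(t)| <= a(s)^2 +
   a(t)^2. *)
have iY : mu2.-integrable setT Y.
  apply: le_integrable (integrableD measurableT iG2 iG3) => //.
  move=> z _; rewrite [leRHS]gee0_abs ?adde_ge0// /Y/= lee_fin normrM (ger0_norm (P0 _)).
  rewrite mulrC -mulrDr ler_wpM2l// normrM.
  have := sqr_ge0 (`|a z.1| - `|a z.2|); rewrite sqrrB !real_normK ?num_real//.
  have := mulr_ge0 (normr_ge0 (a z.1)) (normr_ge0 (a z.2)).
  lra.
have iG1 : mu2.-integrable setT G1.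
  apply: le_integrable (integrableD measurableT (integrableD measurableT iG2 iG3)
     (integrableZl measurableT (-2) iY)) => //.
  move=> z _; rewrite le_eqVlt; apply/orP; left; apply/eqP; congr (`|_|)%E.
  by rewrite /G1 /G2 /G3 /Y -!EFinD /=; congr EFin; ring.
have : (\int[mu2]_z G1 z + 2%:E * \int[mu2]_z Y z = \int[mu2]_z G2 z + \int[mu2]_z G3 z)%E.
  rewrite -integralZl// -integralD//; last exact: integrableZl.
  rewrite -integralD//; apply: eq_integral => z _.
  by rewrite /G1 /G2 /G3 /Y -!EFinD; congr EFin; ring.
have Yfin : (\int[mu2]_z Y z)%E \is a fin_num by exact: integrable_fin_num.
have Xfin : X \is a fin_num by rewrite -IG1; exact: integrable_fin_num.
rewrite IG1 IG2 IG3 -[LHS]/(X + 2%:E * \int[mu2]_z Y z)%E -[LHS in _ -> LHS = _]/(\int[mu2]_z Y z)%E.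
rewrite -(fineK Yfin) -(fineK Xfin) -(fineK Afin) -!EFinM -EFinB -!EFinD => -[h].
congr EFin; move: h; lra.
Qed.

(** The damped integrals have two limits as e decreases to 0: by monotone convergence the undamped
    integral, and by [integral_cauchy_product] the integral of a^2, the correction by [l2shift]
    tending to 0. *)
Theorem real_plancherel :
  (\int[mu]_x (cosT a x ^+ 2 + sinT a x ^+ 2)%:E = \int[mu]_t (a t ^+ 2)%:E)%E.
Proof.
pose e n : R := n.+1%:R^-1.
have e0 n : 0 < e n by rewrite invr_gt0.
have ecvg : e @ \oo --> (0 : R) by exact: cvg_harmonic.
have mS : measurable_fun setT (fun x : RT => cosT a x ^+ 2 + sinT a x ^+ 2).
  by apply: measurable_funD; apply: measurable_funX; [exact: measurable_cosT|exact: measurable_sinT].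
have S0 x : 0 <= cosT a x ^+ 2 + sinT a x ^+ 2 by rewrite addr_ge0 ?sqr_ge0.
set A := (\int[mu]_t (a t ^+ 2)%:E)%E.
have A0 : (0 <= A)%E by apply: integral_ge0 => t _; rewrite lee_fin sqr_ge0.
have Afin : A \is a fin_num by rewrite ge0_fin_numE.
pose g n (x : RT) := (expR (- (e n * `|x|)) * (cosT a x ^+ 2 + sinT a x ^+ 2))%:E.
have cA : (\int[mu]_x g n x)%E @[n --> \oo] --> A.
  rewrite (_ : (fun n => _) = (fun n => A - (2^-1)%:E *
      \int[mu]_u ((cauchy_kernel (e n) u)%:E * l2shift a u))%E); last first.
    by apply/funext => n; rewrite integral_damped// integral_cauchy_product.
  rewrite -[X in _ --> X](sube0 A) -[X in (_ - X)%E](mule0 (2^-1)%:E).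
  apply: cvgeB => //; first by rewrite mule0 fin_num_adde_defl.
    exact: cvg_cst.
  apply: cvgeZl => //.
  exact: integral_cauchy_l2shift.
have cS : (\int[mu]_x g n x)%E @[n --> \oo] -->
    (\int[mu]_x (cosT a x ^+ 2 + sinT a x ^+ 2)%:E)%E.
  have gcvg x : g n x @[n --> \oo] --> (cosT a x ^+ 2 + sinT a x ^+ 2)%:E.
    apply/cvg_EFin; first exact: nearW.
    rewrite -[X in _ --> X]mul1r; apply: cvgM; last exact: cvg_cst.
    rewrite -[X in _ --> X]expR0 -[X in expR X]oppr0 -[X in expR (- X)](mul0r `|x|).
    apply: (cvg_comp (fun n => - (e n * `|x|)) (@expR R)); last exact: continuous_expR.
    by apply: cvgN; apply: cvgM => //; exact: cvg_cst.
  rewrite (_ : (\int[mu]_x (cosT a x ^+ 2 + sinT a x ^+ 2)%:E)%E =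
     (\int[mu]_x limn (g^~ x))%E); last first.
    by apply: eq_integral => x _; apply/esym/cvg_lim => //; exact: gcvg.
  apply: cvg_monotone_convergence => //.
  - move=> n; apply/measurable_EFinP; apply: measurable_funM => //.
    by have /measurable_EFinP := measurable_int _ (integrable_laplace (e0 n)).
  - by move=> n x _; rewrite lee_fin mulr_ge0// expR_ge0.
  - move=> x _ n m nm; rewrite lee_fin ler_wpM2r// ler_expR lerN2 ler_wpM2r//.
    by rewrite /e lef_pV2 ?posrE ?ltr0n// ler_nat ltnS.
exact: (cvg_unique _ cS cA).
Qed.

End RealPlancherel2.

(** * Plancherel kernels and their products *)

Section ComplexProduct.
Context d1 d2 (T1 : measurableType d1) (T2 : measurableType d2) (R : realType).
Variable m1 : {sigma_finite_measure set T1 -> \bar R}.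
Variable m2 : {sigma_finite_measure set T2 -> \bar R}.

Lemma cmeasurable_comp (f : T2 -> R[i]) (p : T1 -> T2) :
  cmeasurable f -> measurable_fun setT p -> cmeasurable (fun x => f (p x)).
Proof.
move=> [fr fi] mp; split; [exact: (measurableT_comp fr)|exact: (measurableT_comp fi)].
Qed.

Lemma cmeasurable_param (f : T1 * T2 -> R[i]) : cmeasurable f ->
  cmeasurable (fun x => cintegral m2 (fun y => f (x, y))).
Proof.
move=> [fr fi]; split.
- exact: (measurable_param_Rintegral m2 fr).
- exact: (measurable_param_Rintegral m2 fi).
Qed.

(** Fubini is known for extended real integrals. Here the inner integral passes through [fine],
    which is harmless wherever the section is integrable, hence for almost every y. *)
Lemma Rintegral_fubini2 (f : T1 * T2 -> R) :
  (sfprod m1 m2).-integrable setT (EFin \o f) ->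
  \int[sfprod m1 m2]_z f z = \int[m2]_y \int[m1]_x f (x, y).
Proof.
move=> fi; congr fine.
have mf : measurable_fun setT f by have /measurable_EFinP := measurable_int _ fi.
rewrite -[LHS](@integral21_prod_meas1 _ _ T1 T2 R m1 m2 _ fi).
have iG := @ae_integrable2 _ _ T1 T2 R m1 m2 _ fi.
have mG := @measurable_fubini_G _ _ T1 T2 R m1 m2 _ fi.
apply: ae_eq_integral => //.
  by apply/measurable_EFinP; apply: measurableT_comp => //; exact: fine_measurable.
by apply: filterS iG => y iy _; rewrite /= fineK//; exact: integrable_fin_num iy.
Qed.

Lemma cintegral_fubini2 (f : T1 * T2 -> R[i]) : cintegrable (sfprod m1 m2) f ->
  cintegral (sfprod m1 m2) f = cintegral m2 (fun y => cintegral m1 (fun x => f (x, y))).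
Proof.
by move=> [fr fi]; apply: complexP => /=; exact: Rintegral_fubini2.
Qed.

End ComplexProduct.

Lemma cmeasurable_swap d1 d2 (T1 : measurableType d1) (T2 : measurableType d2)
    (R : realType) (f : T1 * T2 -> R[i]) :
  cmeasurable f -> cmeasurable (fun z : T2 * T1 => f (z.2, z.1)).
Proof.
by move=> mf; apply: cmeasurable_comp mf _; exact: measurable_fun_pair.
Qed.

Section AbstractPlancherel.
Context (R : realType).

Definition L12 d (T : measurableType d) (mu : {measure set T -> \bar R}) (h : T -> R[i]) :=
  [/\ cmeasurable h, (\int[mu]_x (normc (h x))%:E < +oo)%E &
      (\int[mu]_x (normc (h x) ^+ 2)%:E < +oo)%E].

(** An abstract form of the Fourier kernel, made to be stable under products. Modulus 1 gives
    absolute convergence for h in L1, and the norm identity is asked only on L1 ∩ L2, where the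
    integral has a direct meaning. *)
Definition plancherel_kernel d1 d2 (X : measurableType d1) (Y : measurableType d2)
    (mu : {measure set X -> \bar R}) (nu : {measure set Y -> \bar R})
    (K : X * Y -> R[i]) : Prop :=
  [/\ cmeasurable K, forall z, normc (K z) = 1 &
      forall h, L12 mu h ->
        (\int[nu]_y (normc (cintegral mu (fun x => h x * K (x, y))) ^+ 2)%:E =
         \int[mu]_x (normc (h x) ^+ 2)%:E)%E].

Section Product.
Context dX1 dX2 dY1 dY2 (X1 : measurableType dX1) (X2 : measurableType dX2)
  (Y1 : measurableType dY1) (Y2 : measurableType dY2).
Variables (mu1 : {sigma_finite_measure set X1 -> \bar R})
  (mu2 : {sigma_finite_measure set X2 -> \bar R})
  (nu1 : {sigma_finite_measure set Y1 -> \bar R})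
  (nu2 : {sigma_finite_measure set Y2 -> \bar R})
  (K1 : X1 * Y1 -> R[i]) (K2 : X2 * Y2 -> R[i]).
Hypotheses (PK1 : plancherel_kernel mu1 nu1 K1) (PK2 : plancherel_kernel mu2 nu2 K2).

(** Transform one variable at a time: [K1] acts on the sections at fixed x2, then [K2] on the
    partial transform [H] at fixed y1. The sections lie in L1 ∩ L2 only almost everywhere, so each
    identity is used under an integral, with Tonelli in between. *)
Lemma plancherel_kernel_prod :
  plancherel_kernel (sfprod mu1 mu2) (sfprod nu1 nu2)
    (fun z => K1 (z.1.1, z.2.1) * K2 (z.1.2, z.2.2)).
Proof.
have [mK1 nK1 H1] := PK1; have [mK2 nK2 H2] := PK2.
have mK1' d (S : measurableType d) (p : S -> X1) (q : S -> Y1) :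
    measurable_fun setT p -> measurable_fun setT q -> cmeasurable (fun s => K1 (p s, q s)).
  by move=> mp mq; apply: cmeasurable_comp mK1 _; exact: measurable_fun_pair.
have mK2' d (S : measurableType d) (p : S -> X2) (q : S -> Y2) :
    measurable_fun setT p -> measurable_fun setT q -> cmeasurable (fun s => K2 (p s, q s)).
  by move=> mp mq; apply: cmeasurable_comp mK2 _; exact: measurable_fun_pair.
have m1 : measurable_fun setT (fun z : (X1 * X2) * (Y1 * Y2) => z.1.1).
  by apply: (measurableT_comp measurable_fst); exact: measurable_fst.
have m2 : measurable_fun setT (fun z : (X1 * X2) * (Y1 * Y2) => z.1.2).
  by apply: (measurableT_comp measurable_snd); exact: measurable_fst.
have m3 : measurable_fun setT (fun z : (X1 * X2) * (Y1 * Y2) => z.2.1).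
  by apply: (measurableT_comp measurable_fst); exact: measurable_snd.
have m4 : measurable_fun setT (fun z : (X1 * X2) * (Y1 * Y2) => z.2.2).
  by apply: (measurableT_comp measurable_snd); exact: measurable_snd.
have mK : cmeasurable (fun z : (X1 * X2) * (Y1 * Y2) => K1 (z.1.1, z.2.1) * K2 (z.1.2, z.2.2)).
  by apply: cmeasurableM; [exact: mK1'|exact: mK2'].
split => //; first by move=> z; rewrite normcM nK1 nK2 mulr1.
move=> h [mh h1 h2].
have mhn := cmeasurable_normc mh.
have mhn2 := cmeasurable_normc2 mh.
have mhnE : measurable_fun setT (fun z => (normc (h z))%:E) by exact/measurable_EFinP.
have hn0 z : (0 <= (normc (h z))%:E)%E by rewrite lee_fin normc_ge0'.
have hn20 z : (0 <= (normc (h z) ^+ 2)%:E)%E by rewrite lee_fin sqr_ge0.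
pose H (y1 : Y1) (x2 : X2) := cintegral mu1 (fun x1 => h (x1, x2) * K1 (x1, y1)).
have mH : cmeasurable (fun z : Y1 * X2 => H z.1 z.2).
  apply: (@cmeasurable_param _ _ _ _ _ mu1
    (fun w : (Y1 * X2) * X1 => h (w.2, w.1.2) * K1 (w.2, w.1.1))).
  apply: cmeasurableM.
    apply: cmeasurable_comp mh _; apply: measurable_fun_pair => //.
    exact: measurableT_comp.
  by apply: mK1' => //; exact: measurableT_comp.
have mHy y : cmeasurable (H y).
  by apply: (@cmeasurable_comp _ _ _ _ _ _ (fun x2 => (y, x2)) mH); exact: measurable_fun_pair.
have hs1 : {ae mu2, forall x2, (\int[mu1]_x1 (normc (h (x1, x2)))%:E < +oo)%E}.
  have ih : (sfprod mu1 mu2).-integrable setT (fun z => (normc (h z))%:E).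
    apply/integrableP; split => //.
    by under eq_integral do rewrite gee0_abs//.
  have := @ae_integrable2 _ _ X1 X2 R mu1 mu2 _ ih.
  apply: filterS => x2 /integrableP[_].
  by under eq_integral do rewrite gee0_abs//.
have hs2 : {ae mu2, forall x2, (\int[mu1]_x1 (normc (h (x1, x2)) ^+ 2)%:E < +oo)%E}.
  have ih : (sfprod mu1 mu2).-integrable setT (fun z => (normc (h z) ^+ 2)%:E).
    apply/integrableP; split => //.
    by under eq_integral do rewrite gee0_abs//.
  have := @ae_integrable2 _ _ X1 X2 R mu1 mu2 _ ih.
  apply: filterS => x2 /integrableP[_].
  by under eq_integral do rewrite gee0_abs//.
have mhx x2 : cmeasurable (fun x1 => h (x1, x2)).
  by apply: (@cmeasurable_comp _ _ _ _ _ _ (fun x1 => (x1, x2)) mh); exact: measurable_fun_pair.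
have mHn2 : measurable_fun setT (fun z : Y1 * X2 => (normc (H z.1 z.2) ^+ 2)%:E).
  exact: (cmeasurable_normc2 mH).
have Hn20 z : (0 <= (normc (H z.1 z.2) ^+ 2)%:E)%E by rewrite lee_fin sqr_ge0.
have HE : (\int[nu1]_y1 \int[mu2]_x2 (normc (H y1 x2) ^+ 2)%:E =
    \int[sfprod mu1 mu2]_z (normc (h z) ^+ 2)%:E)%E.
  rewrite (sfprod_tonelli nu1 mu2 mHn2)// (sfprod_tonelli2 mu1 mu2 mhn2)//.
  apply: ae_eq_integral => //.
  - have mHs : measurable_fun setT (fun z : X2 * Y1 => (normc (H z.2 z.1) ^+ 2)%:E).
      exact: (cmeasurable_normc2 (cmeasurable_swap mH)).
    apply: (measurable_fun_fubini_tonelli_F (m2 := nu1) _ mHs) => z.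
    by rewrite lee_fin sqr_ge0.
  - have mhs : measurable_fun setT (fun z : X2 * X1 => (normc (h (z.2, z.1)) ^+ 2)%:E).
      exact: (cmeasurable_normc2 (cmeasurable_swap mh)).
    apply: (measurable_fun_fubini_tonelli_F (m2 := mu1) _ mhs) => z.
    by rewrite lee_fin sqr_ge0.
  - apply: filterS2 hs1 hs2 => x2 a1 a2 _.
    exact: (H1 (fun x1 => h (x1, x2)) (And3 (mhx x2) a1 a2)).
(* The identity [HE] just obtained shows that these integrals have finite total mass, hence are
   finite for almost every y1; this is the L2 half of what [H2] needs. *)
have Hae : {ae nu1, forall y1, (\int[mu2]_x2 (normc (H y1 x2) ^+ 2)%:E < +oo)%E}.
  have iH : nu1.-integrable setT (fun y1 => \int[mu2]_x2 (normc (H y1 x2) ^+ 2)%:E)%E.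
    apply/integrableP; split; first exact: (measurable_fun_fubini_tonelli_F (m2 := mu2) _ mHn2).
    under eq_integral.
      move=> y1 _; rewrite gee0_abs; last first.
        by apply: integral_ge0 => x2 _; rewrite lee_fin sqr_ge0.
      over.
    by rewrite HE.
  have := integrable_ae measurableT iH; apply: filterS => y1 /(_ I).
  by rewrite ge0_fin_numE//; apply: integral_ge0 => x2 _; rewrite lee_fin sqr_ge0.
have hK1 y1 : {ae mu2, forall x2, cintegrable mu1 (fun x1 => h (x1, x2) * K1 (x1, y1))}.
  apply: filterS hs1 => x2 hx2; apply: cintegrableP.
    by apply: cmeasurableM => //; exact: mK1'.
  by under eq_integral do rewrite normcM nK1 mulr1.
pose hhat (y : Y1 * Y2) := cintegral (sfprod mu1 mu2)
  (fun x => h x * (K1 (x.1, y.1) * K2 (x.2, y.2))).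
have mhhat : cmeasurable hhat.
  apply: (@cmeasurable_param _ _ _ _ _ (sfprod mu1 mu2)
    (fun w : (Y1 * Y2) * (X1 * X2) => h w.2 * (K1 (w.2.1, w.1.1) * K2 (w.2.2, w.1.2)))).
  apply: cmeasurableM; first exact: cmeasurable_comp.
  exact: (cmeasurable_swap mK).
have hhatE y1 y2 : hhat (y1, y2) = cintegral mu2 (fun x2 => H y1 x2 * K2 (x2, y2)).
  have ih : cintegrable (sfprod mu1 mu2) (fun x => h x * (K1 (x.1, y1) * K2 (x.2, y2))).
    apply: cintegrableP; last first.
      by under eq_integral do rewrite !normcM nK1 nK2 !mulr1.
    by apply: cmeasurableM => //; apply: cmeasurableM; [exact: mK1'|exact: mK2'].
  rewrite /hhat cintegral_fubini2//; apply: ae_eq_cintegral.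
  - apply: (@cmeasurable_param _ _ _ _ _ mu1
      (fun w : X2 * X1 => h (w.2, w.1) * (K1 (w.2, y1) * K2 (w.1, y2)))).
    apply: cmeasurableM; first exact: (cmeasurable_swap mh).
    by apply: cmeasurableM; [exact: mK1'|exact: mK2'].
  - by apply: cmeasurableM => //; exact: mK2'.
  apply: filterS (hK1 y1) => x2 ihx; rewrite mulrC -cintegralZ//.
  by apply: eq_cintegral => x1 /=; rewrite mulrA mulrC.
rewrite -HE (sfprod_tonelli1 nu1 nu2 (cmeasurable_normc2 mhhat)); last first.
  by move=> y; rewrite lee_fin sqr_ge0.
apply: ae_eq_integral => //.
- apply: (measurable_fun_fubini_tonelli_F (m2 := nu2) _ (cmeasurable_normc2 mhhat)) => z.
  by rewrite lee_fin sqr_ge0.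
- exact: (measurable_fun_fubini_tonelli_F (m2 := mu2) _ mHn2).
- apply: filterS Hae => y1 Hy1 _.
  under eq_integral do rewrite hhatE.
  apply: H2; split => //.
  (* The L1 half holds for every y1, because |H(y1, x2)| is at most the L1 norm of the section of
     [h], for almost every x2. *)
  apply: (@le_lt_trans _ _ (\int[mu2]_x2 \int[mu1]_x1 (normc (h (x1, x2)))%:E)%E); last first.
    by rewrite -(sfprod_tonelli2 mu1 mu2 mhnE).
  have mhs : measurable_fun setT (fun z : X2 * X1 => (normc (h (z.2, z.1)))%:E).
    by apply/measurable_EFinP; apply: cmeasurable_normc; exact: (cmeasurable_swap mh).
  apply: ae_ge0_le_integral => //.
  + by move=> x2 _; rewrite lee_fin normc_ge0'.
  + by apply/measurable_EFinP; exact: cmeasurable_normc.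
  + by move=> x2 _; apply: integral_ge0.
  + exact: (measurable_fun_fubini_tonelli_F (m2 := mu1) _ mhs).
  + apply: filterS (hK1 y1) => x2 ihx _; apply: le_trans (le_normc_cintegral ihx) _.
    by under eq_integral do rewrite normcM nK1 mulr1.
Qed.

End Product.
End AbstractPlancherel.

Lemma Re_cintegral d (T : measurableType d) (R : realType) (mu : {measure set T -> \bar R})
  (f : T -> R[i]) : complex.Re (cintegral mu f) = \int[mu]_x complex.Re (f x).
Proof. by []. Qed.

Lemma Im_cintegral d (T : measurableType d) (R : realType) (mu : {measure set T -> \bar R})
  (f : T -> R[i]) : complex.Im (cintegral mu f) = \int[mu]_x complex.Im (f x).
Proof. by []. Qed.

(** * From real to complex functions on the line *)

Section Expi.
Context (R : realType).
Local Notation RT := (measurableTypeR R).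
Local Notation mu := (@lebesgue_measure R).

Lemma normc_expi2pi (x : R) : normc (expi2pi x) = 1.
Proof. by rewrite /= cos2Dsin2 sqrtr1. Qed.

Lemma expi2piD (x y : R) : expi2pi (x + y) = expi2pi x * expi2pi y.
Proof.
rewrite /expi2pi mulrDr cosD sinD; apply: complexP; rewrite /= //.
by rewrite addrC.
Qed.

Lemma cmeasurable_expi2pi d (S : measurableType d) (p : S -> RT) :
  measurable_fun setT p -> cmeasurable (fun x => expi2pi (p x)).
Proof.
move=> mp; split => /=.
- have mcos : measurable_fun [set: RT] (@cos R).
    by apply: continuous_measurable_fun; exact: continuous_cos.
  by apply: (measurableT_comp mcos); exact: measurable_funM.
- have msin : measurable_fun [set: RT] (@sin R).
    by apply: continuous_measurable_fun; exact: continuous_sin.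
  by apply: (measurableT_comp msin); exact: measurable_funM.
Qed.

(** The cross terms 2ps - 2rq are odd. Adding the integrand to its reflection cancels them
    pointwise, so their own integrability never comes up. *)
Lemma integral_even_odd (p q r s : RT -> R) :
  measurable_fun setT p -> measurable_fun setT q ->
  measurable_fun setT r -> measurable_fun setT s ->
  (forall x, p (- x) = p x) -> (forall x, q (- x) = - q x) ->
  (forall x, r (- x) = r x) -> (forall x, s (- x) = - s x) ->
  (\int[mu]_x ((p x + s x) ^+ 2 + (r x - q x) ^+ 2)%:E =
   \int[mu]_x (p x ^+ 2 + q x ^+ 2)%:E + \int[mu]_x (r x ^+ 2 + s x ^+ 2)%:E)%E.
Proof.
move=> mp mq mr ms pN qN rN sN.
pose N x := (p x + s x) ^+ 2 + (r x - q x) ^+ 2.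
have mN : measurable_fun setT (fun x => (N x)%:E).
  apply/measurable_EFinP; apply: measurable_funD; apply: measurable_funX.
    exact: measurable_funD.
  exact: measurable_funB.
have N0 x : (0 <= (N x)%:E)%E by rewrite lee_fin addr_ge0// sqr_ge0.
have mSa : measurable_fun setT (fun x : RT => (p x ^+ 2 + q x ^+ 2)%:E).
  by apply/measurable_EFinP; apply: measurable_funD; exact: measurable_funX.
have mSb : measurable_fun setT (fun x : RT => (r x ^+ 2 + s x ^+ 2)%:E).
  by apply/measurable_EFinP; apply: measurable_funD; exact: measurable_funX.
have mN' : measurable_fun setT (fun x : RT => (N (- x))%:E).
  by apply: (measurableT_comp mN); exact: oppr_measurable.
rewrite -[LHS]/(\int[mu]_x (N x)%:E)%E; set I := LHS.
have IN : I = (\int[mu]_x (N (- x))%:E)%E by rewrite (integral_oppr mN).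
have I0 : (0 <= I)%E by apply: integral_ge0 => x _; exact: N0.
rewrite -ge0_integralD//; first last.
- by move=> x _; rewrite lee_fin addr_ge0// sqr_ge0.
- by move=> x _; rewrite lee_fin addr_ge0// sqr_ge0.
set A := RHS.
have : (I + I = 2%:E * A)%E.
  rewrite {2}IN /I -ge0_integralD//.
  rewrite /A -ge0_integralZl//; first last.
  - by move=> x _; rewrite -EFinD lee_fin !addr_ge0// sqr_ge0.
  - exact: emeasurable_funD.
  apply: eq_integral => x _; rewrite /N pN qN rN sN.
  by rewrite -!EFinD -EFinM; congr EFin; ring.
have -> : (I + I = 2%:E * I)%E.
  by rewrite (_ : 2%:E = 1 + 1)%E// ge0_muleDl// mul1e.
move=> /(congr1 (fun z => (2^-1)%:E * z)%E).
by rewrite !muleA -EFinM mulVf// !mul1e.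
Qed.

(** For h = a + i b the transform is (cosT a + sinT b) + i (cosT b - sinT a). As [cosT] is even and
    [sinT] odd, [integral_even_odd] separates a from b, and the real theorem applies to each. *)
Lemma plancherel_kernel1 :
  plancherel_kernel mu mu (fun z : RT * RT => (expi2pi (z.1 * z.2))^*).
Proof.
split.
- by apply: cmeasurableJ; apply: cmeasurable_expi2pi; exact: measurable_funM.
- by move=> z; rewrite normc_conjC normc_expi2pi.
move=> h [mh h1 h2].
pose a (t : RT) := complex.Re (h t); pose b (t : RT) := complex.Im (h t).
have [ma mb] : measurable_fun setT a /\ measurable_fun setT b by [].
have [ia ib] : cintegrable mu h by exact: cintegrableP.
have h2E : (\int[mu]_x (normc (h x) ^+ 2)%:E =
    \int[mu]_x (a x ^+ 2)%:E + \int[mu]_x (b x ^+ 2)%:E)%E.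
  rewrite -ge0_integralD//.
  - by apply: eq_integral => x _; rewrite normc_sqr.
  - by move=> x _; rewrite lee_fin sqr_ge0.
  - by apply/measurable_EFinP; exact: measurable_funX.
  - by move=> x _; rewrite lee_fin sqr_ge0.
  - by apply/measurable_EFinP; exact: measurable_funX.
have a0 : (0 <= \int[mu]_x (a x ^+ 2)%:E)%E by apply: integral_ge0 => x _; rewrite lee_fin sqr_ge0.
have b0 : (0 <= \int[mu]_x (b x ^+ 2)%:E)%E by apply: integral_ge0 => x _; rewrite lee_fin sqr_ge0.
have sa : (\int[mu]_x (a x ^+ 2)%:E < +oo)%E by apply: le_lt_trans h2; rewrite h2E leeDl.
have sb : (\int[mu]_x (b x ^+ 2)%:E < +oo)%E by apply: le_lt_trans h2; rewrite h2E leeDr.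
pose N (x : RT) : R := (cosT a x + sinT b x) ^+ 2 + (cosT b x - sinT a x) ^+ 2.
have NE x : normc (cintegral mu (fun t : RT => h t * (expi2pi (t * x))^*)) ^+ 2 = N x.
  rewrite normc_sqr /N; congr (_ ^+ 2 + _ ^+ 2); rewrite ?Re_cintegral ?Im_cintegral.
  - rewrite /cosT /sinT -RintegralD//; [|exact: integrable_cosT|exact: integrable_sinT].
    by apply: eq_Rintegral => t _; rewrite cReM cReJ cImJ /= -/(a t) -/(b t); ring.
  - rewrite /cosT /sinT -RintegralB//; [|exact: integrable_cosT|exact: integrable_sinT].
    by apply: eq_Rintegral => t _; rewrite cImM cReJ cImJ /= -/(a t) -/(b t); ring.
have cosTN (f : RT -> R) x : cosT f (- x) = cosT f x.
  by apply: eq_Rintegral => t _; rewrite mulrN mulrN cosN.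
have sinTN (f : RT -> R) x : mu.-integrable setT (EFin \o f) -> sinT f (- x) = - sinT f x.
  move=> fi; have mf : measurable_fun setT f by have /measurable_EFinP := measurable_int _ fi.
  rewrite /sinT -[RHS]mulN1r -RintegralZl//; last exact: (integrable_sinT mf fi).
  by apply: eq_Rintegral => t _; rewrite mulrN mulrN sinN; ring.
rewrite h2E -(real_plancherel ma ia sa) -(real_plancherel mb ib sb).
under eq_integral do rewrite NE.
apply: integral_even_odd.
- exact: measurable_cosT.
- exact: measurable_sinT.
- exact: measurable_cosT.
- exact: measurable_sinT.
- by move=> x; rewrite cosTN.
- by move=> x; rewrite (sinTN a x ia).
- by move=> x; rewrite cosTN.
- by move=> x; rewrite (sinTN b x ib).
Qed.

End Expi.

(** * Plancherel's theorem on R^n *)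

Section Transport.
Context (R : realType).
Local Notation RT := (measurableTypeR R).
Context n (m : {sigma_finite_measure set (n.-tuple RT) -> \bar R}).
Local Notation prodm := (sfprod (@lebesgue_measure R) m).

Lemma integral_lebesgue_cons (f : n.+1.-tuple RT -> \bar R) : measurable_fun setT f ->
  (\int[lebesgue_cons m]_x f x = \int[prodm]_z f (cons_pair z))%E.
Proof.
move=> mf.
have h (g : n.+1.-tuple RT -> \bar R) : measurable_fun setT g -> (forall y, 0 <= g y)%E ->
    (\int[lebesgue_cons m]_x g x = \int[prodm]_z g (cons_pair z))%E.
  move=> mg g0; have := @ge0_integral_pushforward _ _ _ _ R _ (@measurable_cons_pair R n) prodm
    setT g measurableT mg (fun y _ => g0 y).
  by rewrite preimage_setT.
rewrite integralE [RHS]integralE; congr (_ - _)%E; rewrite h.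
- by apply: eq_integral => z _; rewrite !funeposE.
- exact: measurable_funepos.
- by move=> y; exact: funepos_ge0.
- by apply: eq_integral => z _; rewrite !funenegE.
- exact: measurable_funeneg.
- by move=> y; exact: funeneg_ge0.
Qed.

Lemma cintegral_lebesgue_cons (f : n.+1.-tuple RT -> R[i]) : cmeasurable f ->
  cintegral (lebesgue_cons m) f = cintegral prodm (fun z => f (cons_pair z)).
Proof.
move=> [fr fi]; apply: complexP => /=; congr fine; apply: integral_lebesgue_cons;
  exact/measurable_EFinP.
Qed.

End Transport.

Section TuplePlancherel.
Context (R : realType).
Local Notation RT := (measurableTypeR R).

Lemma measurable_vdot n d (S : measurableType d) (p q : S -> n.-tuple RT) :
  measurable_fun setT p -> measurable_fun setT q ->
  measurable_fun setT (fun x => vdot (p x) (q x) : RT).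
Proof.
move=> mp mq; apply: measurable_sum => i; apply: measurable_funM.
- exact: (measurableT_comp (@measurable_tnth _ _ _ i) mp).
- exact: (measurableT_comp (@measurable_tnth _ _ _ i) mq).
Qed.

Lemma vdot_cons n (x y : RT * n.-tuple RT) :
  vdot (cons_pair x) (cons_pair y) = x.1 * y.1 + vdot x.2 y.2.
Proof.
rewrite /vdot big_ord_recl; congr (_ + _).
by apply: eq_bigr => i _; rewrite !tnthS.
Qed.

(** In dimension 0 the measure is the Dirac mass at the empty tuple and the kernel has modulus 1. In
    the step, the exponential of [vdot] on a [cons_pair] factors into the kernel on R and the kernel
    on R^n. *)
Lemma plancherel_kernel_tuple n :
  plancherel_kernel (lebesgueT R n) (lebesgueT R n)
    (fun z : n.-tuple RT * n.-tuple RT => (expi2pi (vdot z.1 z.2))^*).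
Proof.
have mK k : cmeasurable (fun z : k.-tuple RT * k.-tuple RT => (expi2pi (vdot z.1 z.2))^*).
  by apply: cmeasurableJ; apply: cmeasurable_expi2pi; exact: measurable_vdot.
elim: n => [|n IH]; (split; first exact: mK).
- by move=> z; rewrite normc_conjC normc_expi2pi.
- move=> h [mh h1 h2] /=.
  have mt (f : 0.-tuple RT -> R[i]) : cmeasurable f -> cintegral \d_([tuple]) f = f [tuple].
    move=> [fr fi]; apply: complexP => /=.
      by rewrite /Rintegral integral_dirac ?diracT ?mul1e//; exact/measurable_EFinP.
    by rewrite /Rintegral integral_dirac ?diracT ?mul1e//; exact/measurable_EFinP.
  have mn := cmeasurable_normc2 mh.
  have ms : cmeasurable (fun y : 0.-tuple RT =>
      cintegral \d_([tuple]) (fun x => h x * (expi2pi (vdot (x, y).1 (x, y).2))^*)).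
    apply: (@cmeasurable_param _ _ _ _ R (lebesgueT R 0)
       (fun w : 0.-tuple RT * 0.-tuple RT => h w.2 * (expi2pi (vdot w.2 w.1))^*)).
    by apply: cmeasurableM; [exact: (cmeasurable_comp mh)|exact: (cmeasurable_swap (mK 0))].
  rewrite (integral_dirac _ _ mn)// (integral_dirac _ _ (cmeasurable_normc2 ms))// diracT !mul1e.
  rewrite mt; last first.
    apply: cmeasurableM => //.
    apply: (cmeasurable_comp (p := fun x => (x, [tuple])) (mK 0)).
    exact: measurable_fun_pair.
  by rewrite normcM normc_conjC normc_expi2pi mulr1.
- by move=> z; rewrite normc_conjC normc_expi2pi.
- move=> h [mh h1 h2].
  have [_ _ /(_ (fun z => h (cons_pair z)))] :=
    plancherel_kernel_prod (plancherel_kernel1 R) IH.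
  have mc := @measurable_cons_pair R n.
  have mhc : cmeasurable (fun z => h (cons_pair z)) by exact: cmeasurable_comp mh mc.
  have mhn2 := cmeasurable_normc2 mh.
  have H1 : L12 (sfprod (@lebesgue_measure R) (lebesgueT R n)) (fun z => h (cons_pair z)).
    split => //.
      rewrite -(integral_lebesgue_cons (lebesgueT R n) (f := fun x => (normc (h x))%:E))//.
      by apply/measurable_EFinP; exact: cmeasurable_normc.
    by rewrite -(integral_lebesgue_cons (lebesgueT R n) (f := fun x => (normc (h x) ^+ 2)%:E)).
  move=> /(_ H1).
  rewrite -(integral_lebesgue_cons (lebesgueT R n) (f := fun x => (normc (h x) ^+ 2)%:E))// => <-.
  rewrite (integral_lebesgue_cons (lebesgueT R n)); last first.
    apply: cmeasurable_normc2; apply: (@cmeasurable_param _ _ _ _ R (lebesgueT R n.+1)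
       (fun w => h w.2 * (expi2pi (vdot w.2 w.1))^*)).
    by apply: cmeasurableM; [exact: (cmeasurable_comp mh)|exact: (cmeasurable_swap (mK n.+1))].
  apply: eq_integral => y _; congr ((normc _) ^+ 2)%:E.
  rewrite (cintegral_lebesgue_cons (lebesgueT R n)).
    by apply: eq_cintegral => x /=; rewrite vdot_cons expi2piD rmorphM.
  apply: cmeasurableM => //.
  apply: (cmeasurable_comp (p := fun x => (x, cons_pair y)) (mK n.+1)).
  exact: measurable_fun_pair.
Qed.

End TuplePlancherel.

(** * Translations and reflections of R^n *)

Section TupleShift.
Context (R : realType).
Local Notation RT := (measurableTypeR R).
Local Notation mu := (@lebesgue_measure R).

Lemma integral_reflect (c : R) (f : RT -> \bar R) : measurable_fun setT f ->
  (forall x, 0 <= f x)%E -> (\int[mu]_x f (c - x)%R = \int[mu]_x f x)%E.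
Proof.
move=> mf f0; rewrite -(integral_shift c mf)//.
have mfc : measurable_fun setT (fun x : RT => f (x + c)).
  exact: (measurableT_comp mf (measurable_shift c)).
rewrite -(integral_oppr mfc)//.
by apply: eq_integral => x _; rewrite addrC.
Qed.

Lemma vsub_cons n (x y : RT * n.-tuple RT) :
  vsub (cons_pair x) (cons_pair y) = cons_pair (x.1 - y.1, vsub x.2 y.2).
Proof.
apply: eq_from_tnth => i; rewrite tnth_mktuple.
case: (unliftP ord0 i) => [j ->|->]; last by [].
by rewrite !tnthS tnth_mktuple.
Qed.

Lemma measurable_vsub n d (S : measurableType d) (p q : S -> n.-tuple RT) :
  measurable_fun setT p -> measurable_fun setT q ->
  measurable_fun setT (fun x => vsub (p x) (q x)).
Proof.
move=> mp mq; apply/measurable_fun_tnthP => i.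
rewrite (_ : _ \o _ = (fun x => tnth (p x) i - tnth (q x) i)); last first.
  by apply/funext => x /=; rewrite tnth_mktuple.
apply: measurable_funB.
- exact: (measurableT_comp (@measurable_tnth _ _ _ i) mp).
- exact: (measurableT_comp (@measurable_tnth _ _ _ i) mq).
Qed.

(** The reflected form serves [integral_stft_sqr], where v(t - x) is integrated in x. Both follow by
    induction on n, with the one-dimensional invariance in the first coordinate. *)
Lemma ge0_integral_vsub n (c : n.-tuple RT) (f : n.-tuple RT -> \bar R) :
  measurable_fun setT f -> (forall x, 0 <= f x)%E ->
  (\int[lebesgueT R n]_x f (vsub x c) = \int[lebesgueT R n]_x f x)%E /\
  (\int[lebesgueT R n]_x f (vsub c x) = \int[lebesgueT R n]_x f x)%E.
Proof.
elim: n c f => [|n IH] c f mf f0.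
  by split; apply: eq_integral => x _; congr f; rewrite [RHS]tuple0 [LHS]tuple0.
have cE : c = cons_pair (uncons c).
  by apply: val_inj => /=; case/tupleP: c => a t /=; rewrite theadE.
move: (uncons c) cE => [c1 c2] ->.
pose F z := f (cons_pair z).
have mF : measurable_fun setT F by exact: (measurableT_comp mf (@measurable_cons_pair R n)).
have F0 z : (0 <= F z)%E by exact: f0.
have mFs : measurable_fun setT (fun z : n.-tuple RT * RT => F (z.2, z.1)).
  by apply: (measurableT_comp mF); exact: measurable_fun_pair.
have mFx x : measurable_fun setT (fun t => F (x, t)).
  by apply: (measurableT_comp mF); exact: measurable_fun_pair.
have mI : measurable_fun setT (fun x => \int[lebesgueT R n]_t F (x, t))%E.
  exact: (measurable_fun_fubini_tonelli_F (m2 := lebesgueT R n) _ mF).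
have I0 x : (0 <= \int[lebesgueT R n]_t F (x, t))%E by exact: integral_ge0.
rewrite (integral_lebesgue_cons _ mf) (sfprod_tonelli1 _ _ mF)//; split.
- rewrite (integral_lebesgue_cons (lebesgueT R n) (f := fun x => f (vsub x _))); last first.
    by apply: (measurableT_comp mf); exact: measurable_vsub.
  under eq_integral do rewrite vsub_cons -/(F _).
  have mFc : measurable_fun setT (fun z : RT * n.-tuple RT => F (z.1 - c1, vsub z.2 c2)).
    apply: (measurableT_comp mF); apply: measurable_fun_pair.
      exact: measurable_funB.
    exact: measurable_vsub.
  rewrite (sfprod_tonelli1 _ _ mFc (fun=> F0 _)).
  under eq_integral do rewrite /= (IH c2 (fun t => F (_, t)) (mFx _) (fun=> F0 _)).1.
  exact: (integral_shift (- c1) mI I0).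
- rewrite (integral_lebesgue_cons (lebesgueT R n) (f := fun x => f (vsub _ x))); last first.
    by apply: (measurableT_comp mf); exact: measurable_vsub.
  under eq_integral do rewrite vsub_cons -/(F _).
  have mFc : measurable_fun setT (fun z : RT * n.-tuple RT => F (c1 - z.1, vsub c2 z.2)).
    apply: (measurableT_comp mF); apply: measurable_fun_pair.
      exact: measurable_funB.
    exact: measurable_vsub.
  rewrite (sfprod_tonelli1 _ _ mFc (fun=> F0 _)).
  under eq_integral do rewrite /= (IH c2 (fun t => F (_, t)) (mFx _) (fun=> F0 _)).2.
  exact: (integral_reflect c1 mI I0).
Qed.

Lemma integral_vsub n (c : n.-tuple RT) (f : n.-tuple RT -> \bar R) :
  measurable_fun setT f ->
  (\int[lebesgueT R n]_x f (vsub x c) = \int[lebesgueT R n]_x f x)%E.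
Proof.
move=> mf; rewrite integralE [RHS]integralE; congr (_ - _)%E.
- rewrite -((ge0_integral_vsub c (measurable_funepos mf) (funepos_ge0 _)).1).
  by apply: eq_integral => z _; rewrite !funeposE.
- rewrite -((ge0_integral_vsub c (measurable_funeneg mf) (funeneg_ge0 _)).1).
  by apply: eq_integral => z _; rewrite !funenegE.
Qed.

Lemma cintegral_vsub n (c : n.-tuple RT) (f : n.-tuple RT -> R[i]) :
  cmeasurable f ->
  cintegral (lebesgueT R n) (fun x => f (vsub x c)) = cintegral (lebesgueT R n) f.
Proof.
move=> [fr fi]; apply: complexP; rewrite ?Re_cintegral ?Im_cintegral; congr fine;
  [apply: (integral_vsub c (f := fun x => (complex.Re (f x))%:E))|
   apply: (integral_vsub c (f := fun x => (complex.Im (f x))%:E))]; exact/measurable_EFinP.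
Qed.

(** Translates of null sets are null, by translation invariance applied to an indicator.
    Time-frequency shifts evaluate representatives at translated points, so this is what makes them
    compatible with equality of classes. *)
Lemma ae_vsub n (c : n.-tuple RT) (P : n.-tuple RT -> Prop) :
  {ae lebesgueT R n, forall x, P x} -> {ae lebesgueT R n, forall x, P (vsub x c)}.
Proof.
move=> [N [mN N0 PN]].
have mv : measurable_fun setT (fun x : n.-tuple RT => vsub x c) by exact: measurable_vsub.
exists ((fun x => vsub x c) @^-1` N); split.
- by rewrite -[X in measurable X]setTI; exact: mv.
- have mpre : measurable ((fun x => vsub x c) @^-1` N).
    by rewrite -[X in measurable X]setTI; exact: mv.
  have mi : measurable_fun setT (fun x : n.-tuple RT => (\1_N x)%:E : \bar R).
    by apply/measurable_EFinP; exact: measurable_indic.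
  have := integral_vsub c mi.
  rewrite integral_indic// setIT => h; apply: (etrans _ N0).
  by apply: (etrans h); rewrite integral_indic// setIT.
- by move=> x /= nP; apply: PN.
Qed.

End TupleShift.

(** * Time-frequency shifts *)

Section Adjoint.
Context d (T : measurableType d) (R : realType) (mu : {measure set T -> \bar R}).
Implicit Types (A : L2 mu -> L2 mu) (u v w : L2 mu).

Lemma adjoint_eq A v w : (forall u, L2dot (A u) v = L2dot u w) -> adjoint A v = w.
Proof.
move=> h; apply: xget_unique => //= w' h'.
by apply: L2dot_inj => u; rewrite -h -h'.
Qed.

End Adjoint.

Section TFShift.
Context (R : realType) (d : nat).
Local Notation RT := (measurableTypeR R).
Local Notation Rd := (d.-tuple RT).
Local Notation mu := (lebesgueT R d).
Local Notation L2Rd := (L2 (lebesgueT R d)).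
Implicit Types (u v : L2Rd) (z : Rd * Rd).

Definition vopp (a : Rd) : Rd := [tuple - tnth a i | i < d].

Lemma vsubVK (a t : Rd) : vsub (vsub t a) (vopp a) = t.
Proof. by apply: eq_from_tnth => i; rewrite !tnth_mktuple opprK subrK. Qed.

Lemma vdotC (a t : Rd) : vdot a t = vdot t a.
Proof. by apply: eq_bigr => i _; rewrite mulrC. Qed.

Lemma measurable_vsubl (c : Rd) : measurable_fun setT (fun t : Rd => vsub t c).
Proof. exact: measurable_vsub. Qed.

Lemma square_integrable_shift (k f : Rd -> R[i]) (c : Rd) :
  cmeasurable k -> (forall t, normc (k t) = 1) -> square_integrable mu f ->
  square_integrable mu (fun t => k t * f (vsub t c)).
Proof.
move=> mk k1 [fr fi foo]; have mf : cmeasurable f by [].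
have [hr hi] : cmeasurable (fun t => k t * f (vsub t c)).
  by apply: cmeasurableM => //; exact: (cmeasurable_comp mf (measurable_vsubl c)).
split => //.
under eq_integral do rewrite normcM k1 mul1r.
by rewrite (integral_vsub c (f := fun t => (normc (f t) ^+ 2)%:E))//; exact: cmeasurable_normc2.
Qed.

Lemma cmeasurable_modulation (a : Rd) : cmeasurable (fun t : Rd => expi2pi (vdot a t)).
Proof. by apply: cmeasurable_expi2pi; exact: measurable_vdot. Qed.

Lemma square_integrable_tf z (f : Rd -> R[i]) : square_integrable mu f ->
  square_integrable mu (fun t => expi2pi (vdot z.2 t) * f (vsub t z.1)).
Proof.
move=> sf; apply: square_integrable_shift => //; first exact: cmeasurable_modulation.
by move=> t; exact: normc_expi2pi.
Qed.

Lemma rep_tf_shift z u : {ae mu, forall t,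
  rep (tf_shift z u) t = expi2pi (vdot z.2 t) * rep u (vsub t z.1)}.
Proof. by apply: rep_toL2; apply: square_integrable_tf; exact: square_integrable_rep. Qed.

Lemma tf_shiftE z u : tf_shift z u =
  toL2 mu (fun t => expi2pi (vdot z.2 t) * rep u (vsub t z.1)).
Proof. by []. Qed.

Lemma tf_shiftD z u v : tf_shift z (u + v) = tf_shift z u + tf_shift z v.
Proof.
have su := square_integrable_tf z (square_integrable_rep u).
have sv := square_integrable_tf z (square_integrable_rep v).
rewrite !tf_shiftE -toL2D//; apply: toL2_ae.
- exact: square_integrable_tf (square_integrable_rep _).
- exact: square_integrableD.
- by apply: filterS (ae_vsub z.1 (repD u v)) => t ->; rewrite mulrDr.
Qed.

Lemma tf_shiftZ z a u : tf_shift z (a *: u) = a *: tf_shift z u.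
Proof.
have su := square_integrable_tf z (square_integrable_rep u).
rewrite !tf_shiftE -toL2Z//; apply: toL2_ae.
- exact: square_integrable_tf (square_integrable_rep _).
- exact: square_integrableZ.
- by apply: filterS (ae_vsub z.1 (repZ a u)) => t ->; rewrite mulrCA.
Qed.

Lemma L2dot_tf_shift z u v : L2dot (tf_shift z u) (tf_shift z v) = L2dot u v.
Proof.
have su := square_integrable_tf z (square_integrable_rep u).
have sv := square_integrable_tf z (square_integrable_rep v).
rewrite !tf_shiftE L2dot_toL2// L2dotE.
rewrite -(cintegral_vsub z.1 (f := fun t => rep u t * (rep v t)^*)).
  apply: eq_cintegral => t; rewrite rmorphM/= mulrACA mul_conjC normc_expi2pi expr1n.
  by rewrite mul1r.
by apply: cmeasurableM; [|apply: cmeasurableJ]; exact: cmeasurable_rep.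
Qed.

Lemma L2norm_tf_shift z u : L2norm (tf_shift z u) = L2norm u.
Proof. by rewrite /L2norm L2dot_tf_shift. Qed.

(** The inverse of pi(z): it undoes the translation by evaluating at t + z.1, written as subtraction
    of [vopp], and undoes the modulation at that same point. Since pi(z) is isometric, this is also
    its adjoint. *)
Definition tf_inv z v : L2Rd := toL2 mu (fun t =>
  (expi2pi (vdot z.2 (vsub t (vopp z.1))))^* * rep v (vsub t (vopp z.1))).

Lemma tf_invK z v : tf_shift z (tf_inv z v) = v.
Proof.
have si : square_integrable mu (fun t =>
    (expi2pi (vdot z.2 (vsub t (vopp z.1))))^* * rep v (vsub t (vopp z.1))).
  apply: square_integrable_shift; last exact: square_integrable_rep.
    apply: cmeasurableJ.
    exact: (cmeasurable_comp (cmeasurable_modulation z.2) (measurable_vsubl _)).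
  by move=> t; rewrite normc_conjC normc_expi2pi.
apply: L2P; apply: filterS2 (rep_tf_shift z (tf_inv z v)) (ae_vsub z.1 (rep_toL2 si)) => t.
by move=> -> ->; rewrite !vsubVK mulrA mul_conjC normc_expi2pi expr1n mul1r.
Qed.

Lemma L2dot_tf_inv z u v : L2dot (tf_shift z u) v = L2dot u (tf_inv z v).
Proof. by rewrite -{1}(tf_invK z v) L2dot_tf_shift. Qed.

Lemma adjoint_tf_shift z : adjoint (tf_shift z) = tf_inv z.
Proof. by apply/funext => v; apply: adjoint_eq => u; exact: L2dot_tf_inv. Qed.

Lemma tf_shiftK z u : tf_inv z (tf_shift z u) = u.
Proof. by apply: L2dot_inj => w; rewrite -L2dot_tf_inv L2dot_tf_shift. Qed.

(** The short-time Fourier transform of [u] with window [v]. *)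
Definition stft u v z : R[i] := L2dot u (tf_shift z v).

Lemma stftE u v z : stft u v z = cintegral mu (fun t =>
  (rep u t * (rep v (vsub t z.1))^*) * (expi2pi (vdot t z.2))^*).
Proof.
rewrite /stft tf_shiftE L2dot_toL2r; last exact: square_integrable_tf (square_integrable_rep _).
by apply: eq_cintegral => t; rewrite rmorphM/= vdotC -mulrA [X in _ * X]mulrC.
Qed.

Lemma cmeasurable_stft u v : cmeasurable (stft u v).
Proof.
rewrite (funext (stftE u v)).
apply: (@cmeasurable_param _ _ _ _ _ mu (fun w : (Rd * Rd) * Rd =>
  (rep u w.2 * (rep v (vsub w.2 w.1.1))^*) * (expi2pi (vdot w.2 w.1.2))^*)).
have m1 : measurable_fun setT (fun w : (Rd * Rd) * Rd => w.1.1).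
  by apply: (measurableT_comp measurable_fst); exact: measurable_fst.
have m2 : measurable_fun setT (fun w : (Rd * Rd) * Rd => w.1.2).
  by apply: (measurableT_comp measurable_snd); exact: measurable_fst.
have m3 : measurable_fun setT (fun w : (Rd * Rd) * Rd => w.2) by exact: measurable_snd.
apply: cmeasurableM; last first.
  by apply: cmeasurableJ; apply: cmeasurable_expi2pi; exact: measurable_vdot.
apply: cmeasurableM; first exact: (cmeasurable_comp (cmeasurable_rep u) m3).
apply: cmeasurableJ; apply: (cmeasurable_comp (cmeasurable_rep v)).
exact: measurable_vsub.
Qed.

(** At fixed translation x, [stft u v (x, y)] is the Fourier transform in y of t |-> u(t) conj(v(t -
    x)). This function is in L1 for every x by square integrability of both factors, and in L2 for
    almost every x, so Plancherel applies; Tonelli then separates the two norms. *)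
Lemma integral_stft_sqr u v :
  (\int[lebesgue2T R d]_z (normc (stft u v z) ^+ 2)%:E =
   (L2norm u ^+ 2 * L2norm v ^+ 2)%:E)%E.
Proof.
have mV2 := cmeasurable_normc2 (cmeasurable_stft u v).
have ru := cmeasurable_rep u; have rv := cmeasurable_rep v.
have nu2 := cmeasurable_normc2 ru; have nv2 := cmeasurable_normc2 rv.
pose h (x t : Rd) := rep u t * (rep v (vsub t x))^*.
have mh : cmeasurable (fun w : Rd * Rd => h w.1 w.2).
  apply: cmeasurableM; first exact: (cmeasurable_comp ru measurable_snd).
  by apply: cmeasurableJ; apply: (cmeasurable_comp rv); exact: measurable_vsub.
have mh2 := cmeasurable_normc2 mh.
have h20 (w : Rd * Rd) : (0 <= (normc (h w.1 w.2) ^+ 2)%:E)%E by rewrite lee_fin sqr_ge0.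
have mhx x : cmeasurable (h x).
  apply: cmeasurableM => //; apply: cmeasurableJ.
  exact: (cmeasurable_comp rv (measurable_vsubl x)).
have I2 : (\int[mu]_x \int[mu]_t (normc (h x t) ^+ 2)%:E = (L2norm u ^+ 2 * L2norm v ^+ 2)%:E)%E.
  rewrite (sfprod_tonelli _ _ mh2)//.
  rewrite (eq_integral (fun t => (normc (rep u t) ^+ 2)%:E * (L2norm v ^+ 2)%:E))%E; last first.
    move=> t _; rewrite L2norm_sqr -(ge0_integral_vsub t nv2 _).2; last first.
      by move=> x; rewrite lee_fin sqr_ge0.
    rewrite -ge0_integralZl//.
    - by apply: eq_integral => x _; rewrite /h/= normcM normc_conjC exprMn EFinM.
    - apply: (measurableT_comp nv2 (f := fun x => (normc (rep v x) ^+ 2)%:E)).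
      exact: measurable_vsub.
    - by move=> x _; rewrite lee_fin sqr_ge0.
    - by rewrite lee_fin sqr_ge0.
  rewrite ge0_integralZr//.
  - by rewrite -L2norm_sqr EFinM.
  - by move=> t _; rewrite lee_fin sqr_ge0.
  - by rewrite lee_fin sqr_ge0.
have mIh : measurable_fun setT (fun x => \int[mu]_t (normc (h x t) ^+ 2)%:E)%E.
  exact: (measurable_fun_fubini_tonelli_F (m2 := mu) _ mh2).
have Ih0 x : (0 <= \int[mu]_t (normc (h x t) ^+ 2)%:E)%E.
  by apply: integral_ge0 => t _; rewrite lee_fin sqr_ge0.
have aeh : {ae mu, forall x, (\int[mu]_t (normc (h x t) ^+ 2)%:E < +oo)%E}.
  have ii : mu.-integrable setT (fun x => \int[mu]_t (normc (h x t) ^+ 2)%:E)%E.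
    apply/integrableP; split => //.
    by under eq_integral do rewrite gee0_abs//; rewrite I2 ltry.
  by have := integrable_ae measurableT ii; apply: filterS => x /(_ I); rewrite ge0_fin_numE.
rewrite -I2 (sfprod_tonelli1 _ _ mV2); last by move=> z; rewrite lee_fin sqr_ge0.
have [_ _ HP] := plancherel_kernel_tuple R d.
apply: ae_eq_integral => //.
  apply: (measurable_fun_fubini_tonelli_F (m2 := mu) _ mV2) => z.
  by rewrite lee_fin sqr_ge0.
apply: filterS aeh => x hx _.
have Lh : L12 mu (h x).
  split => //.
  (* The factor 1 is the trivial modulation, which brings the translate into the shape of
     [square_integrable_shift]. *)
  have sv : square_integrable mu (fun t => 1 * rep v (vsub t x)).
    apply: square_integrable_shift; [exact: cmeasurable_cst|by move=> t; rewrite normc1|].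
    exact: square_integrable_rep.
  have := cintegrable_lty (square_integrableM (square_integrable_rep u) sv).
  by under eq_integral do rewrite mul1r.
rewrite -(HP _ Lh).
by apply: eq_integral => y _; rewrite stftE.
Qed.

Lemma square_integrable_stft u v : square_integrable (lebesgue2T R d) (stft u v).
Proof.
have [hr hi] := cmeasurable_stft u v; split => //.
by rewrite integral_stft_sqr ltry.
Qed.

End TFShift.

(** * Completeness and orthonormal bases *)

Section ComplexLimits.
Context (R : realType).

(** Componentwise convergence lets the theory of real limits be used; [ccvg_cvg] connects it to the
    topology in which [trace] is stated. *)
Definition ccvg (u : nat -> R[i]) (l : R[i]) : Prop :=
  (complex.Re (u n) @[n --> \oo] --> complex.Re l) /\
  (complex.Im (u n) @[n --> \oo] --> complex.Im l).

Lemma ccvg_unique u l l' : ccvg u l -> ccvg u l' -> l = l'.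
Proof.
move=> [r i] [r' i']; apply: complexP.
- exact: (cvg_unique _ r r').
- exact: (cvg_unique _ i i').
Qed.

Lemma ccvg_cst l : ccvg (fun=> l) l.
Proof. by split; exact: cvg_cst. Qed.

Lemma ccvgD u v l k : ccvg u l -> ccvg v k -> ccvg (fun n => u n + v n) (l + k).
Proof.
move=> [ur ui] [vr vi]; split; rewrite ?cReD ?cImD.
- by under eq_fun do rewrite cReD; exact: cvgD.
- by under eq_fun do rewrite cImD; exact: cvgD.
Qed.

Lemma ccvgM u v l k : ccvg u l -> ccvg v k -> ccvg (fun n => u n * v n) (l * k).
Proof.
move=> [ur ui] [vr vi]; split; rewrite ?cReM ?cImM.
- by under eq_fun do rewrite cReM; apply: cvgB; exact: cvgM.
- by under eq_fun do rewrite cImM; apply: cvgD; exact: cvgM.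
Qed.

Lemma ccvgZ a u l : ccvg u l -> ccvg (fun n => a * u n) (a * l).
Proof. by move=> h; apply: ccvgM => //; exact: ccvg_cst. Qed.

Lemma ccvgJ u l : ccvg u l -> ccvg (fun n => (u n)^*) (l^*).
Proof.
move=> [ur ui]; split; rewrite ?cReJ ?cImJ.
- by under eq_fun do rewrite cReJ.
- by under eq_fun do rewrite cImJ; exact: cvgN.
Qed.

Lemma ccvg_normc2 u l : ccvg u l -> normc (u n) ^+ 2 @[n --> \oo] --> normc l ^+ 2.
Proof.
move=> [ur ui]; under eq_fun do rewrite normc_sqr; rewrite normc_sqr.
by apply: cvgD; apply: cvgM.
Qed.

Lemma ccvg_dist u l : normc (u n - l) @[n --> \oo] --> (0 : R) -> ccvg u l.
Proof.
move=> h; split; apply/cvgrPdist_le => e e0;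
  have /cvgrPdist_le/(_ _ e0) := h; apply: filterS => n;
  rewrite sub0r normrN (ger0_norm (normc_ge0' _)) distrC; apply: le_trans.
- by rewrite -cReN -cReD normc_Re.
- by rewrite -cImN -cImD normc_Im.
Qed.

Lemma ccvg_shift k u l : ccvg u l -> ccvg (fun n => u (n + k)%N) l.
Proof.
move=> [ur ui]; split.
- exact: (cvg_comp (fun n => (n + k)%N) (fun n => complex.Re (u n)) (cvg_addnr k) ur).
- exact: (cvg_comp (fun n => (n + k)%N) (fun n => complex.Im (u n)) (cvg_addnr k) ui).
Qed.

End ComplexLimits.

Section GeometricSteps.
Context (R : realType).

Lemma cReB (z w : R[i]) : complex.Re (z - w) = complex.Re z - complex.Re w.
Proof. by rewrite cReD cReN. Qed.

Lemma cImB (z w : R[i]) : complex.Im (z - w) = complex.Im z - complex.Im w.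
Proof. by rewrite cImD cImN. Qed.

Lemma ler_eq_norm (x y : R) : x = y -> `|x| <= `|y|.
Proof. by move=> ->. Qed.

Lemma geometric_steps_cvg (u : nat -> R) (C : R) : 0 <= C ->
  (forall k, `|u k.+1 - u k| <= geometric C 2^-1 k) ->
  exists l : R, u @ \oo --> l.
Proof.
move=> C0 h.
have cs : cvgn (series (telescope u)).
  apply: normed_cvg; apply: series_le_cvg (is_cvg_geometric_series (a := C) (z := 2^-1) _).
  - by move=> n /=.
  - by move=> n; rewrite /= mulr_ge0// exprn_ge0.
  - by move=> n; exact: h.
  - by rewrite ger0_norm// invf_lt1// ltr1n.
exists (u 0%N + limn (series (telescope u))).
have uE : (fun n => u 0%N + series (telescope u) n) = u.
  by apply/funext => n; rewrite -eq_sum_telescope.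
by rewrite -[X in X @ _ --> _]uE; apply: cvgD; [exact: cvg_cst|].
Qed.

End GeometricSteps.

Section Completeness.
Context d (T : measurableType d) (R : realType) (mu : {measure set T -> \bar R}).

(** The form of Fatou's lemma used for completeness and for orthogonal series: L2 distances to a
    fixed function stay bounded in a pointwise limit. Dropping the first [N] terms allows the bound
    to hold only eventually. *)
Lemma fatou_normc2 (F : nat -> T -> R[i]) (G H : T -> R[i]) (c : \bar R) (N : nat) :
  (forall n, cmeasurable (F n)) -> cmeasurable H ->
  (forall x, ccvg (F^~ x) (G x)) ->
  (forall n, (N <= n)%N -> (\int[mu]_x (normc (F n x - H x) ^+ 2)%:E <= c)%E) ->
  (\int[mu]_x (normc (G x - H x) ^+ 2)%:E <= c)%E.
Proof.
move=> mF mH FG Fc.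
pose f n x := (normc (F (n + N)%N x - H x) ^+ 2)%:E.
have mf n : measurable_fun setT (f n).
  by apply: cmeasurable_normc2; exact: cmeasurableB.
have f0 n x : setT x -> (0 <= f n x)%E by move=> _; rewrite lee_fin sqr_ge0.
have fcvg x : f n x @[n --> \oo] --> (normc (G x - H x) ^+ 2)%:E.
  apply/cvg_EFin; first exact: nearW.
  apply: ccvg_normc2; apply: ccvgD; first exact: (ccvg_shift N (FG x)).
  exact: ccvg_cst.
have fE : (\int[mu]_x (normc (G x - H x) ^+ 2)%:E = \int[mu]_x limn_einf (f^~ x))%E.
  by apply: eq_integral => x _; apply/esym; exact: (cvg_limn_einf_sup (fcvg x)).1.
rewrite fE; apply: le_trans (fatou mu measurableT mf f0) _.
rewrite limn_einf_lim; apply: lime_le; first exact: is_cvg_einfs.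
apply: nearW => n; apply: (@le_trans _ _ (\int[mu]_x f n x)%E); last exact: Fc (leq_addl _ _).
by apply: ereal_inf_lbound; exists n => /=.
Qed.

(* A subsequence with |v_(k+1) - v_k|^2 <= 8^-k converges pointwise wherever
   the sum of 4^k |v_(k+1) - v_k|^2 is finite, hence almost everywhere. *)
Lemma pointwise_limit (F : nat -> T -> R[i]) :
  (forall k, cmeasurable (F k)) ->
  (forall k, (\int[mu]_x (normc (F k.+1 x - F k x) ^+ 2)%:E <= ((8^-1) ^+ k)%:E)%E) ->
  exists (D : set T) (G : T -> R[i]), [/\ measurable D, cmeasurable G,
    {ae mu, forall x, D x} &
    forall x, ccvg (fun k => (\1_D x)%:C * F k x) (G x)].
Proof.
move=> mF bF.
pose s k x : \bar R := (4 ^+ k * normc (F k.+1 x - F k x) ^+ 2)%:E.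
have ms k : measurable_fun setT (s k).
  apply/measurable_EFinP; apply: measurable_funM => //; apply: measurable_funX.
  by apply: cmeasurable_normc; exact: cmeasurableB.
have s0 k x : (0 <= s k x)%E by rewrite lee_fin mulr_ge0 ?sqr_ge0// exprn_ge0.
pose S x := (\sum_(0 <= k <oo) s k x)%E.
have mS : measurable_fun setT S.
  by apply: ge0_emeasurable_sum => // k x _ _.
have S0 x : (0 <= S x)%E by apply: nneseries_ge0 => k _ _.
have IS : (\int[mu]_x S x < +oo)%E.
  rewrite integral_nneseries//.
  apply: (@le_lt_trans _ _ (\sum_(0 <= k <oo) ((2^-1) ^+ k)%:E)%E); last first.
    rewrite (_ : (\sum_(0 <= k <oo) _)%E = 2%:E) ?ltry//.
    have := @cvg_geometric_eseries_half R 2 0; rewrite expr0 divr1 => /cvg_lim <-//.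
    apply: congr_lim; apply/funext => n; apply: eq_bigr => k _; congr EFin.
    by rewrite addn1 natrX exprS exprVn; field; rewrite expf_neq0.
  apply: lee_nneseries => k _; first by move=> _; exact: integral_ge0.
  rewrite /s; under eq_integral do rewrite EFinM.
  rewrite ge0_integralZl//.
  - have -> : ((2^-1 : R) ^+ k)%:E = ((4 ^+ k)%:E * ((8^-1) ^+ k)%:E)%E.
      by rewrite -EFinM -exprMn; congr ((_ ^+ k)%:E); field.
    by apply: lee_wpmul2l; [rewrite lee_fin exprn_ge0|exact: bF].
  - by apply: cmeasurable_normc2; exact: cmeasurableB.
  - by move=> x _; rewrite lee_fin sqr_ge0.
pose D := [set x | S x \is a fin_num].
have mD : measurable D.
  by have := emeasurable_fin_num measurableT mS; rewrite setTI.
have aeD : {ae mu, forall x, D x}.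
  have iS : mu.-integrable setT S.
    by apply/integrableP; split => //; under eq_integral do rewrite gee0_abs//.
  by have := integrable_ae measurableT iS; apply: filterS => x /(_ I).
(* Cutting off outside [D] makes the sequence converge at every point, so that the limit is
   measurable. *)
pose F' k x := (\1_D x)%:C * F k x.
have mF' k : cmeasurable (F' k).
  apply: cmeasurableM => //; split => /=; last exact: measurable_cst.
  exact: measurable_indic.
have cF' x : exists l, ccvg (F'^~ x) l.
  have [xD|xD] := pselect (D x); last first.
    exists 0; rewrite /F' indicE memNset//=.
    by under eq_fun do rewrite mul0r; exact: ccvg_cst.
  pose C := fine (S x).
  have sC k : 4 ^+ k * normc (F k.+1 x - F k x) ^+ 2 <= C.
    rewrite -lee_fin /C fineK//; apply: le_trans (nneseries_lim_ge k.+1 _) => //.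
    by rewrite big_mkord big_ord_recr/= leeDr// sume_ge0.
  have C0 : 0 <= C by rewrite fine_ge0.
  have bnd k : normc (F k.+1 x - F k x) <= geometric (Num.sqrt C) 2^-1 k.
    rewrite -(@ler_pXn2r _ 2)// ?nnegrE ?normc_ge0' ?mulr_ge0 ?sqrtr_ge0 ?exprn_ge0//.
    rewrite exprMn sqr_sqrtr// -exprM mulnC exprM -(@ler_pM2l _ (4 ^+ k)) ?exprn_gt0//.
    apply: le_trans (sC k) _; rewrite mulrCA -exprMn.
    by rewrite (_ : 4 * _ = 1) ?expr1n ?mulr1//; field.
  have [lr hr] := @geometric_steps_cvg R (fun k => complex.Re (F k x)) (Num.sqrt C)
    (sqrtr_ge0 _) (fun k => le_trans (ler_eq_norm (esym (cReB _ _))) (le_trans (normc_Re _) (bnd k))).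
  have [li hi] := @geometric_steps_cvg R (fun k => complex.Im (F k x)) (Num.sqrt C)
    (sqrtr_ge0 _) (fun k => le_trans (ler_eq_norm (esym (cImB _ _))) (le_trans (normc_Im _) (bnd k))).
  exists (lr +i* li); rewrite /F' indicE mem_set//=.
  by under eq_fun do rewrite mul1r; split.
pose G x := projT1 (cid (cF' x)).
have FG x : ccvg (F'^~ x) (G x) by exact: projT2 (cid (cF' x)).
exists D, G; split => //.
split.
- apply: (measurable_fun_cvg (h := fun k x => complex.Re (F' k x))) => //.
  + by move=> k; have [] := mF' k.
  + by move=> x _; have [] := FG x.
- apply: (measurable_fun_cvg (h := fun k x => complex.Im (F' k x))) => //.
  + by move=> k; have [] := mF' k.
  + by move=> x _; have [] := FG x.
Qed.

End Completeness.

Section HilbertSpace.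
Context d (T : measurableType d) (R : realType) (mu : {measure set T -> \bar R}).
Implicit Types (u v w : L2 mu).

Lemma L2normB_integral u v :
  ((L2norm (u - v) ^+ 2)%:E = \int[mu]_x (normc (rep u x - rep v x) ^+ 2)%:E)%E.
Proof.
rewrite L2norm_sqr; apply: ae_eq_integral => //.
- by apply: cmeasurable_normc2; exact: cmeasurable_rep.
- by apply: cmeasurable_normc2; apply: cmeasurableB; exact: cmeasurable_rep.
- by apply: filterS (repB u v) => x -> _.
Qed.

Lemma L2_complete (u : nat -> L2 mu) :
  (forall e : R, 0 < e -> exists N, forall n m, (N <= n)%N -> (N <= m)%N ->
     L2norm (u n - u m) <= e) ->
  exists w, L2norm (u n - w) @[n --> \oo] --> (0 : R).
Proof.
move=> cau.
have e0 k : 0 < (8^-1 : R) ^+ k by rewrite exprn_gt0.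
pose N k := projT1 (cid (cau _ (e0 k))).
have NP k n m : (N k <= n)%N -> (N k <= m)%N -> L2norm (u n - u m) <= (8^-1) ^+ k.
  exact: (projT2 (cid (cau _ (e0 k)))).
(* Partial sums make the indices increasing and at least [N k]; the successor on each term also
   gives k <= phi k, so that the subsequence eventually passes any given index. *)
pose phi k := (\sum_(i < k.+1) (N i).+1)%N.
have phiS k : (phi k <= phi k.+1)%N by rewrite /phi [X in (_ <= X)%N]big_ord_recr/= leq_addr.
have phiN k : (N k <= phi k)%N.
  by rewrite /phi big_ord_recr/= (leq_trans (leqnSn _))// leq_addl.
have phik k : (k <= phi k)%N.
  elim: k => // k IH; rewrite /phi big_ord_recr/=.
  by rewrite -/(phi k) addnS ltnS (leq_trans IH)// leq_addr.
pose F k := rep (u (phi k)).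
have mF k : cmeasurable (F k) by exact: cmeasurable_rep.
have bF k : (\int[mu]_x (normc (F k.+1 x - F k x) ^+ 2)%:E <= ((8^-1) ^+ k)%:E)%E.
  rewrite -L2normB_integral lee_fin.
  have h : L2norm (u (phi k.+1) - u (phi k)) <= (8^-1) ^+ k.
    by apply: NP => //; apply: leq_trans (phiS k).
  (* The norm is at most 1, so its square is bounded by the norm itself. *)
  apply: le_trans h; rewrite expr2 ler_piMl ?L2norm_ge0//.
  by apply: le_trans (NP k _ _ _ _) _ => //; [exact: leq_trans (phiS k)|rewrite exprn_ile1// invf_le1// ler1n].
have [D [G [mD mG aeD cG]]] := pointwise_limit mF bF.
have mF' k : cmeasurable (fun x => (\1_D x)%:C * F k x).
  apply: cmeasurableM => //; split => /=; last exact: measurable_cst.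
  exact: measurable_indic.
have H (e : R) : 0 < e -> exists N, forall n, (N <= n)%N ->
    (\int[mu]_x (normc (G x - rep (u n) x) ^+ 2)%:E <= (e ^+ 2)%:E)%E.
  move=> egt; have [M HM] := cau _ egt; exists M => n Mn.
  apply: (@fatou_normc2 _ _ _ _ (fun k x => (\1_D x)%:C * F k x) G (rep (u n)) _ M) => //.
    exact: cmeasurable_rep.
  move=> k Mk.
  have -> : (\int[mu]_x (normc ((\1_D x)%:C * F k x - rep (u n) x) ^+ 2)%:E =
     (L2norm (u (phi k) - u n) ^+ 2)%:E)%E.
    rewrite L2normB_integral; apply: ae_eq_integral => //.
    - by apply: cmeasurable_normc2; apply: cmeasurableB => //; exact: cmeasurable_rep.
    - by apply: cmeasurable_normc2; apply: cmeasurableB => //; exact: cmeasurable_rep.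
    - by apply: filterS aeD => x xD _; rewrite indicE mem_set// mul1r.
  rewrite lee_fin ler_pXn2r// ?nnegrE ?L2norm_ge0 ?(ltW egt)//.
  by apply: HM => //; exact: leq_trans (phik k).
have sG : square_integrable mu G.
  have [M /(_ M (leqnn M)) HM] := H 1 ltr01.
  have sB : square_integrable mu (fun x => G x - rep (u M) x).
    have [hr hi] := cmeasurableB mG (cmeasurable_rep (u M)).
    by split => //; rewrite (le_lt_trans HM)// ltry.
  have := square_integrableD sB (square_integrable_rep (u M)).
  by under eq_fun do rewrite subrK.
exists (toL2 mu G); apply/cvgrPdist_le => e egt.
have [M HM] := H e egt; exists M => // n /= Mn.
rewrite sub0r normrN ger0_norm ?L2norm_ge0//.
rewrite -(@ler_pXn2r _ 2)// ?nnegrE ?L2norm_ge0 ?(ltW egt)// -lee_fin.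
rewrite -L2normN opprB L2normB_integral; apply: le_trans (HM n Mn).
rewrite le_eqVlt; apply/orP; left; apply/eqP; apply: ae_eq_integral => //.
- by apply: cmeasurable_normc2; apply: cmeasurableB; exact: cmeasurable_rep.
- by apply: cmeasurable_normc2; apply: cmeasurableB => //; exact: cmeasurable_rep.
- by apply: filterS (rep_toL2 sG) => x -> _.
Qed.

Lemma L2norm_sum_orth (g : nat -> L2 mu) (m k : nat) :
  (forall i j, i != j -> L2dot (g i) (g j) = 0) ->
  L2norm (\sum_(i < m + k) g i - \sum_(i < m) g i) ^+ 2 =
  \sum_(i < m + k) L2norm (g i) ^+ 2 - \sum_(i < m) L2norm (g i) ^+ 2.
Proof.
move=> og; elim: k => [|k IH]; first by rewrite addn0 !subrr L2norm0 expr0n.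
have h n : (n <= m + k)%N -> L2dot (\sum_(i < n) g i) (g (m + k)%N) = 0.
  move=> nmk; rewrite L2dot_suml big1// => i _; apply: og.
  by rewrite ltn_eqF// (leq_trans (ltn_ord i)).
rewrite addnS !big_ord_recr/= [_ + g _ - _]addrAC L2norm_sqrD IH.
by rewrite L2dotBl !h ?leq_addr// subr0 mul0rn addr0 addrAC.
Qed.

Lemma L2norm_sum_orth0 (g : nat -> L2 mu) (n : nat) :
  (forall i j, i != j -> L2dot (g i) (g j) = 0) ->
  L2norm (\sum_(i < n) g i) ^+ 2 = \sum_(i < n) L2norm (g i) ^+ 2.
Proof.
by move=> og; have := L2norm_sum_orth 0 n og; rewrite add0n !big_ord0 !subr0.
Qed.

Lemma riesz_fischer (g : nat -> L2 mu) (M : R) :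
  (forall i j, i != j -> L2dot (g i) (g j) = 0) ->
  (forall n, \sum_(i < n) L2norm (g i) ^+ 2 <= M) ->
  exists w, L2norm (\sum_(i < n) g i - w) @[n --> \oo] --> (0 : R).
Proof.
move=> og bM; apply: L2_complete => e e0.
pose a n := \sum_(i < n) L2norm (g i) ^+ 2.
have nda : nondecreasing_seq a.
  by apply/nondecreasing_seqP => n; rewrite /a big_ord_recr/= lerDl sqr_ge0.
have ca : cvgn a.
  apply: nondecreasing_is_cvgn => //; exists M => _ [n _ <-]; exact: bM.
(* The squared distance of two partial sums is a difference of two terms of [a], each within half of
   e^2 of the limit. *)
have e20 : 0 < e ^+ 2 / 2 by rewrite divr_gt0// exprn_gt0.
have /cvgrPdist_le/(_ _ e20)[N _ HN] := ca.
exists N.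
suff h n m : (N <= m)%N -> (m <= n)%N ->
    L2norm (\sum_(i < n) g i - \sum_(i < m) g i) <= e.
  move=> n m Nn Nm; have [mn|/ltnW nm] := leqP m n; first exact: h.
  by rewrite -L2normN opprB; exact: h.
move=> Nm mn.
rewrite -(@ler_pXn2r _ 2)// ?nnegrE ?L2norm_ge0 ?(ltW e0)//.
rewrite -(subnKC mn) L2norm_sum_orth// subnKC//.
have := HN _ Nm; have := HN _ (leq_trans Nm mn) => /=; rewrite /a !ler_norml.
lra.
Qed.

Lemma L2dot_cvgl (u : nat -> L2 mu) w v :
  L2norm (u n - w) @[n --> \oo] --> (0 : R) -> ccvg (fun n => L2dot (u n) v) (L2dot w v).
Proof.
move=> h; apply: ccvg_dist.
apply: (@squeeze_cvgr _ _ _ _ (cst 0) (fun n => L2norm (u n - w) * L2norm v)).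
- apply: nearW => n; apply/andP; split; first exact: normc_ge0'.
  have := L2_CS (u n - w) v; rewrite L2dotBl; exact.
- exact: cvg_cst.
- by rewrite -(mul0r (L2norm v)); apply: cvgM => //; exact: cvg_cst.
Qed.

Lemma L2dot_cvgr (u : nat -> L2 mu) w v :
  L2norm (u n - w) @[n --> \oo] --> (0 : R) -> ccvg (fun n => L2dot v (u n)) (L2dot v w).
Proof.
move=> h; have := ccvgJ (L2dot_cvgl v h); rewrite -L2dotC.
by under eq_fun do rewrite -L2dotC.
Qed.

End HilbertSpace.

Section NonnegSeries.
Context (R : realType).
Implicit Types (a : nat -> R) (l : R).

Lemma nneseries_cvg a l : (\sum_(i < n) a i) @[n --> \oo] --> l ->
  (\sum_(0 <= i <oo) (a i)%:E)%E = l%:E.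
Proof.
move=> h; apply/cvg_lim => //.
rewrite (_ : (fun n => _) = (fun n => (\sum_(i < n) a i)%:E)); last first.
  by apply/funext => n; rewrite big_mkord sumEFin.
by apply/cvg_EFin => //; exact: nearW.
Qed.

Lemma cvg_nneseries a : (forall n, 0 <= a n) ->
  (\sum_(0 <= i <oo) (a i)%:E < +oo)%E ->
  (\sum_(i < n) a i) @[n --> \oo] --> fine (\sum_(0 <= i <oo) (a i)%:E)%E.
Proof.
move=> a0 foo; set s := (\sum_(0 <= i <oo) _)%E.
have s0 : (0 <= s)%E by apply: nneseries_ge0 => n _ _; rewrite lee_fin.
have sf : s \is a fin_num by rewrite ge0_fin_numE.
have h : (\sum_(0 <= i < n) (a i)%:E)%E @[n --> \oo] --> s.
  by apply: is_cvg_nneseries => n _ _; rewrite lee_fin.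
rewrite -(fineK sf) in h; have /fine_cvgP[_] := h.
rewrite (_ : fine \o _ = (fun n => \sum_(i < n) a i))//.
by apply/funext => n; rewrite /= big_mkord sumEFin.
Qed.

End NonnegSeries.

(** * Parseval, sums of squares and existence of adjoints *)

Section OrthonormalBasis.
Context d (T : measurableType d) (R : realType) (mu : {measure set T -> \bar R}).
Implicit Types (u v w : L2 mu) (e f : nat -> L2 mu) (A B S : L2 mu -> L2 mu).

Lemma onb_orth e i j : orthonormal_basis e -> i != j -> L2dot (e i) (e j) = 0.
Proof. by move=> [h _] /negbTE ij; rewrite h ij. Qed.

Lemma onb_norm e i : orthonormal_basis e -> L2norm (e i) = 1.
Proof. by move=> [h _]; rewrite /L2norm h eqxx /= sqrtr1. Qed.

Lemma onb_expansion_orth e u i j : orthonormal_basis e -> i != j ->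
  L2dot (L2dot u (e i) *: e i) (L2dot u (e j) *: e j) = 0.
Proof. by move=> he ij; rewrite L2dotZl L2dotZr (onb_orth he ij) !mulr0. Qed.

Lemma parseval_cvg e u : orthonormal_basis e ->
  (\sum_(i < n) normc (L2dot u (e i)) ^+ 2) @[n --> \oo] --> L2norm u ^+ 2.
Proof.
move=> he; have [_ /(_ u) hu] := he.
pose p n := \sum_(i < n) L2dot u (e i) *: e i.
have pE n : L2norm (p n) ^+ 2 = \sum_(i < n) normc (L2dot u (e i)) ^+ 2.
  rewrite (L2norm_sum_orth0 (g := fun i => L2dot u (e i) *: e i)); last first.
    by move=> i j ij; exact: onb_expansion_orth.
  by apply: eq_bigr => i _; rewrite L2normZ (onb_norm _ he) mulr1.
under eq_fun do rewrite -pE.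
suff h : L2norm (p n) @[n --> \oo] --> L2norm u by apply: cvgM.
apply/cvgrPdist_le => eps e0; have /cvgrPdist_le/(_ _ e0) := hu; apply: filterS => n.
rewrite sub0r normrN ger0_norm ?L2norm_ge0//; apply: le_trans; exact: L2norm_BD.
Qed.

Lemma parseval e u : orthonormal_basis e ->
  (\sum_(0 <= i <oo) (normc (L2dot u (e i)) ^+ 2)%:E)%E = (L2norm u ^+ 2)%:E.
Proof. by move=> he; apply: nneseries_cvg; exact: parseval_cvg. Qed.

Definition hsq A e : \bar R := (\sum_(0 <= n <oo) (L2norm (A (e n)) ^+ 2)%:E)%E.

(** Stated as a relation because it is symmetric and compatible with linear combinations, while
    [adjoint] is a choice that has to be identified each time. *)
Definition adjoint_pair A B := forall u v, L2dot (A u) v = L2dot u (B v).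

Lemma adjoint_pair_sym A B : adjoint_pair A B -> adjoint_pair B A.
Proof. by move=> h u v; rewrite L2dotC -h -L2dotC. Qed.

Lemma hsq_ge0 A e : (0 <= hsq A e)%E.
Proof. by apply: nneseries_ge0 => n _ _; rewrite lee_fin sqr_ge0. Qed.

(** Parseval turns both sides into the double series of |<A e_n, f_m>|^2, whose nonnegative terms
    may be summed in either order. As [e] and [f] are unrelated, using this twice gives independence
    of the basis. *)
Lemma hsq_adjoint A B e f : orthonormal_basis e -> orthonormal_basis f ->
  adjoint_pair A B -> hsq A e = hsq B f.
Proof.
move=> he hf AB; rewrite /hsq.
under eq_eseriesr do rewrite -(parseval (A _) hf).
rewrite nneseries_interchange; last by move=> i j; rewrite lee_fin sqr_ge0.
apply: eq_eseriesr => m _; rewrite -(parseval (B (f m)) he).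
by apply: eq_eseriesr => n _; rewrite AB L2dotC normc_conjC.
Qed.

Lemma eq_hsq A B e : (forall u, L2norm (A u) = L2norm (B u)) -> hsq A e = hsq B e.
Proof. by move=> h; apply: eq_eseriesr => n _; rewrite h. Qed.

Lemma hsq_lin A B e (c : R[i]) : (hsq A e < +oo)%E -> (hsq B e < +oo)%E ->
  (hsq (fun u => (A u + c *: B u)%R) e < +oo)%E.
Proof.
move=> hA hB; pose k : R := 2 * normc c ^+ 2.
have k0 : 0 <= k by rewrite mulr_ge0// sqr_ge0.
apply: (@le_lt_trans _ _ (\sum_(0 <= n <oo) (2%:E * (L2norm (A (e n)) ^+ 2)%:E +
   k%:E * (L2norm (B (e n)) ^+ 2)%:E))%E).
  apply: lee_nneseries => [n _ _|n _]; first by rewrite lee_fin sqr_ge0.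
  rewrite -!EFinM -EFinD lee_fin.
  have h : L2norm (A (e n) + c *: B (e n)) <= L2norm (A (e n)) + normc c * L2norm (B (e n)).
    by rewrite -L2normZ L2normD.
  apply: (@le_trans _ _ ((L2norm (A (e n)) + normc c * L2norm (B (e n))) ^+ 2)).
    by rewrite ler_pXn2r// ?nnegrE ?L2norm_ge0// addr_ge0 ?mulr_ge0 ?L2norm_ge0 ?normc_ge0'.
  rewrite /k -mulrA -exprMn; have := sqr_ge0 (L2norm (A (e n)) - normc c * L2norm (B (e n))).
  lra.
rewrite nneseriesD; first last.
- by move=> n _ _; rewrite mule_ge0// lee_fin sqr_ge0.
- by move=> n _ _; rewrite mule_ge0// lee_fin sqr_ge0.
rewrite !nneseriesZl; try by move=> n _; rewrite lee_fin sqr_ge0.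
have h1 : (2%:E * hsq A e < +oo)%E by apply: lte_mul_pinfty hA; rewrite ?lee_fin.
have h2 : (k%:E * hsq B e < +oo)%E by apply: lte_mul_pinfty hB; rewrite ?lee_fin.
exact: (lte_add_pinfty h1 h2).
Qed.

Lemma bounded_cvg A (u : nat -> L2 mu) w : bounded_operator A ->
  L2norm (u n - w) @[n --> \oo] --> (0 : R) ->
  L2norm (A (u n) - A w) @[n --> \oo] --> (0 : R).
Proof.
move=> [lA [M bM]] h.
have AB x y : A (x - y) = A x - A y.
  by rewrite -scaleN1r addrC lA scaleN1r addrC.
apply: (@squeeze_cvgr _ _ _ _ (cst 0) (fun n => M * L2norm (u n - w))).
- by apply: nearW => n; apply/andP; split; [exact: L2norm_ge0|rewrite -AB].
- exact: cvg_cst.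
- by rewrite -(mulr0 M); apply: cvgM => //; exact: cvg_cst.
Qed.

Lemma linear_op_sum A n (c : nat -> R[i]) (x : nat -> L2 mu) : linear A ->
  A (\sum_(i < n) c i *: x i) = \sum_(i < n) c i *: A (x i).
Proof.
move=> lA; have A0 : A 0 = 0.
  have := lA 1 0 0; rewrite !scale1r addr0 => /eqP.
  by rewrite -subr_eq0 opprD addrA subrr sub0r oppr_eq0 => /eqP.
elim: n => [|n IH]; first by rewrite !big_ord0.
by rewrite !big_ord_recr/= addrC lA IH addrC.
Qed.

(** The adjoint at v is the series of <v, A e_i> e_i. Its coefficients are square summable, being
    bounded by |v| |A e_i|, so [riesz_fischer] gives a sum; continuity of [A] along the expansion of
    u identifies it. *)
Lemma adjoint_exists A e : bounded_operator A -> orthonormal_basis e ->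
  (hsq A e < +oo)%E -> adjoint_pair A (adjoint A).
Proof.
move=> bA he hA; have [lA _] := bA.
suff H v : exists w, forall u, L2dot (A u) v = L2dot u w.
  by move=> u v; have [w hw] := H v; rewrite (adjoint_eq hw) hw.
pose c i := L2dot v (A (e i)).
have cA := cvg_nneseries (fun n => sqr_ge0 (L2norm (A (e n)))) hA.
have [||w hw] := @riesz_fischer _ _ _ mu (fun i => c i *: e i)
    (L2norm v ^+ 2 * fine (hsq A e)).
- by move=> i j ij; rewrite L2dotZl L2dotZr (onb_orth he ij) !mulr0.
- move=> n; apply: (@le_trans _ _ (\sum_(i < n) L2norm v ^+ 2 * L2norm (A (e i)) ^+ 2)).
    apply: ler_sum => i _; rewrite L2normZ (onb_norm _ he) mulr1 -exprMn.
    by rewrite ler_pXn2r// ?nnegrE ?normc_ge0' ?mulr_ge0 ?L2norm_ge0// L2_CS.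
  rewrite -mulr_sumr ler_wpM2l ?sqr_ge0//.
  rewrite -lee_fin fineK ?ge0_fin_numE ?hsq_ge0// -sumEFin.
  have := @nneseries_lim_ge R (fun i => (L2norm (A (e i)) ^+ 2)%:E) xpredT 0 n.
  by rewrite big_mkord; apply => k _; rewrite lee_fin sqr_ge0.
exists w => u; have [_ /(_ u) hu] := he.
have {}hu : L2norm (\sum_(i < n) L2dot u (e i) *: e i - u) @[n --> \oo] --> (0 : R).
  by under eq_fun do rewrite -L2normN opprB.
have h1 := L2dot_cvgl v (bounded_cvg bA hu).
have h2 := L2dot_cvgr u hw.
apply: (ccvg_unique h1).
rewrite (_ : (fun n => _) = (fun n => L2dot u (\sum_(i < n) c i *: e i)))//.
apply/funext => n; rewrite (linear_op_sum n (fun i => L2dot u (e i)) e lA) L2dot_suml L2dot_sumr.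
by apply: eq_bigr => i _; rewrite L2dotZl L2dotZr /c -L2dotC mulrC.
Qed.

Lemma adjoint_pair_lin A A' B B' (c : R[i]) : adjoint_pair A A' -> adjoint_pair B B' ->
  adjoint_pair (fun u => A u + c *: B u) (fun u => A' u + c^* *: B' u).
Proof. by move=> hA hB u v; rewrite L2dotDl L2dotDr L2dotZl L2dotZr conjCK hA hB. Qed.

End OrthonormalBasis.

Lemma ccvg_cvg (R : realType) (u : nat -> R[i]) (l : R[i]) : ccvg u l ->
  (u : nat -> (R[i])^o) @ \oo --> (l : (R[i])^o).
Proof.
move=> [ur ui]; apply/cvgrPdist_le => e e0.
have [r r0 re] : exists2 r : R, 0 < r & e = r%:C.
  exists (complex.Re e); first by move: e0; rewrite ltcE => /andP[].
  by apply: complexP => //=; move: e0; rewrite ltcE => /andP[/eqP].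
have r20 : 0 < r / 2 by rewrite divr_gt0.
have /cvgrPdist_le/(_ _ r20) hr := ur.
have /cvgrPdist_le/(_ _ r20) hi := ui.
apply: filterS2 hr hi => n hr hi.
rewrite re -[X in X <= _]/((normc (l - u n))%:C) lecR.
apply: le_trans (normc_le _) _; rewrite cReD cReN cImD cImN.
by move: hr hi; lra.
Qed.

(** * The Hilbert-Schmidt inner product *)

Section Trace.
Context d (T : measurableType d) (R : realType) (mu : {measure set T -> \bar R}).
Implicit Types (u v w : L2 mu) (e f : nat -> L2 mu) (A B S : L2 mu -> L2 mu).

(** The given basis makes the value chosen by [xget] unique, by uniqueness of limits along it. *)
Lemma trace_eq A (l : R[i]) : (exists e : nat -> L2 mu, orthonormal_basis e) ->
  (forall e, orthonormal_basis e -> ccvg (fun n => \sum_(i < n) L2dot (A (e i)) (e i)) l) ->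
  trace A = l.
Proof.
move=> [e he] h.
have H f : orthonormal_basis f ->
    series (fun n => L2dot (A (f n)) (f n) : (R[i])^o) @ \oo --> (l : (R[i])^o).
  move=> hf; rewrite (_ : series _ = (fun n => \sum_(i < n) L2dot (A (f i)) (f i))).
    exact: ccvg_cvg (h f hf).
  by apply/funext => n; rewrite /series/= big_mkord.
apply: xget_unique => //= l' /(_ e he) hl'.
exact: (cvg_unique (@norm_hausdorff _ _) hl' (H e he)).
Qed.

Lemma Re_L2dot u v : complex.Re (L2dot u v) =
  (L2norm (u + v) ^+ 2 - L2norm (u - v) ^+ 2) / 4.
Proof.
rewrite (L2norm_sqrD u v) (L2norm_sqrD u (- v)) (L2normN v) (L2dotNr u v) cReN.
by move: (complex.Re _) (L2norm u ^+ 2) (L2norm v ^+ 2) => x a b; lra.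
Qed.

Lemma Im_L2dot u v : complex.Im (L2dot u v) = complex.Re (L2dot u ('i%C *: v)).
Proof. by rewrite L2dotZr; case: (L2dot u v) => x y /=; ring. Qed.

(** [P] and [M] are names for A + B and A - B, so that the sum and difference can be supplied in the
    shape A + c B that occurs in [hs_form]. *)
Lemma Re_L2dot_sum A B P M e :
  (forall u, P u = A u + B u) -> (forall u, M u = A u - B u) ->
  (hsq P e < +oo)%E -> (hsq M e < +oo)%E ->
  \sum_(i < n) complex.Re (L2dot (A (e i)) (B (e i))) @[n --> \oo] -->
   (fine (hsq P e) - fine (hsq M e)) / 4.
Proof.
move=> PE ME h1 h2.
have c1 := cvg_nneseries (fun n => sqr_ge0 (L2norm (P (e n)))) h1.
have c2 := cvg_nneseries (fun n => sqr_ge0 (L2norm (M (e n)))) h2.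
rewrite (_ : (fun n => _) = (fun n => (\sum_(i < n) L2norm (P (e i)) ^+ 2 -
   \sum_(i < n) L2norm (M (e i)) ^+ 2) / 4)); last first.
  apply/funext => n; rewrite -sumrB mulr_suml; apply: eq_bigr => i _.
  by rewrite PE ME; exact: Re_L2dot.
exact: (cvgM (cvgB c1 c2) (cvg_cst _)).
Qed.

(* Polarisation of the quadratic form sum_n |A e_n|^2. *)
Definition hs_form A B e : R[i] :=
  let q (c : R[i]) := fine (hsq (fun u => A u + c *: B u) e) in
  ((q 1 - q (-1)) / 4) +i* ((q 'i%C - q (- 'i%C)) / 4).

Lemma hs_form_cvg A B e : (hsq A e < +oo)%E -> (hsq B e < +oo)%E ->
  ccvg (fun n => \sum_(i < n) L2dot (A (e i)) (B (e i))) (hs_form A B e).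
Proof.
move=> hA hB.
have ReS n (c : nat -> R[i]) : complex.Re (\sum_(i < n) c i) = \sum_(i < n) complex.Re (c i).
  by apply: (big_morph (@complex.Re R)) => // x y; rewrite cReD.
have ImS n (c : nat -> R[i]) : complex.Im (\sum_(i < n) c i) = \sum_(i < n) complex.Im (c i).
  by apply: (big_morph (@complex.Im R)) => // x y; rewrite cImD.
split.
- under eq_fun do rewrite (ReS _ (fun i => L2dot (A (e i)) (B (e i)))).
  apply: Re_L2dot_sum; [| |exact: hsq_lin|exact: hsq_lin] => u.
    by rewrite scale1r.
  by rewrite scaleN1r.
- under eq_fun do rewrite (ImS _ (fun i => L2dot (A (e i)) (B (e i)))).
  under eq_fun do under eq_bigr do rewrite Im_L2dot.
  apply: (@Re_L2dot_sum A (fun u => 'i%C *: B u));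
    [| |exact: hsq_lin|exact: hsq_lin] => u; first by [].
  by rewrite scaleNr.
Qed.

(** Each of the four terms is moved by [hsq_adjoint]: the adjoint of B' + c A' is B + conj(c) A, and
    multiplying by c, which has modulus 1, turns it into A + c B without changing norms. Hence the
    reversed order of B' and A'. *)
Lemma hs_form_adjoint A A' B B' e f : orthonormal_basis e -> orthonormal_basis f ->
  adjoint_pair A A' -> adjoint_pair B B' ->
  hs_form B' A' e = hs_form A B f.
Proof.
move=> he hf hA hB; have hA' := adjoint_pair_sym hA; have hB' := adjoint_pair_sym hB.
have key (c : R[i]) : normc c = 1 ->
    hsq (fun u => B' u + c *: A' u) e = hsq (fun u => A u + c *: B u) f.
  move=> nc; rewrite (hsq_adjoint he hf (adjoint_pair_lin c hB' hA')).
  apply: eq_hsq => u; rewrite -[LHS]mul1r -nc -L2normZ scalerDr scalerA mul_conjC.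
  by rewrite nc expr1n scale1r addrC.
have n1 : normc (1 : R[i]) = 1 by exact: normc1.
have ni : normc ('i%C : R[i]) = 1 by rewrite /= expr0n expr1n add0r sqrtr1.
have n1' : normc (- 1 : R[i]) = 1 by rewrite normcN.
have ni' : normc (- 'i%C : R[i]) = 1 by rewrite normcN.
exact: (f_equal4 (fun x y z t : R => ((x - y) / 4) +i* ((z - t) / 4))
  (congr1 fine (key _ n1)) (congr1 fine (key _ n1'))
  (congr1 fine (key _ ni)) (congr1 fine (key _ ni'))).
Qed.

(** Finiteness passes from the basis [f] in the definition to [e] because both sums equal that of
    the adjoint in [e]. *)
Lemma hs_basis A e : hilbert_schmidt A -> orthonormal_basis e ->
  adjoint_pair A (adjoint A) /\ (hsq A e < +oo)%E.
Proof.
move=> [bA [f hf Af]] he; have AA := adjoint_exists bA hf Af.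
split; first exact: AA.
have h := etrans (hsq_adjoint he he AA) (esym (hsq_adjoint hf he AA)).
exact: (eq_ind_r (fun x => x < +oo)%E Af h).
Qed.

(** In any basis f the trace sums <A B* f_i, f_i> = <B* f_i, A* f_i>, which converges to the form of
    B* and A* in f; [hs_form_adjoint] makes this the form of A and B in the fixed basis [e],
    whatever f is. *)
Lemma hs_dotE A B e : hilbert_schmidt A -> hilbert_schmidt B -> orthonormal_basis e ->
  hs_dot A B = hs_form A B e.
Proof.
move=> hA hB he; apply: trace_eq; first by exists e.
move=> f hf; have [AA Af] := hs_basis hA hf; have [BB Bf] := hs_basis hB hf.
rewrite -(hs_form_adjoint hf he AA BB).
rewrite (_ : (fun n => _) = (fun n => \sum_(i < n) L2dot (adjoint B (f i)) (adjoint A (f i)))).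
  apply: hs_form_cvg.
    exact: (eq_ind _ (fun x => x < +oo)%E Bf _ (hsq_adjoint hf hf BB)).
  exact: (eq_ind _ (fun x => x < +oo)%E Af _ (hsq_adjoint hf hf AA)).
by apply/funext => n; apply: eq_bigr => i _; exact: AA.
Qed.

Lemma hs_dot_cvg A B e : hilbert_schmidt A -> hilbert_schmidt B -> orthonormal_basis e ->
  ccvg (fun n => \sum_(i < n) L2dot (A (e i)) (B (e i))) (hs_dot A B).
Proof.
move=> hA hB he; rewrite (hs_dotE hA hB he).
have [_ Af] := hs_basis hA he; have [_ Bf] := hs_basis hB he.
exact: hs_form_cvg.
Qed.

Lemma hs_norm_sqr A e : hilbert_schmidt A -> orthonormal_basis e ->
  ((hs_norm A ^+ 2)%:E = hsq A e)%E.
Proof.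
move=> hA he; have [_ Af] := hs_basis hA he.
have [h _] := hs_dot_cvg hA hA he.
have h2 := cvg_nneseries (fun n => sqr_ge0 (L2norm (A (e n)))) Af.
have E : complex.Re (hs_dot A A) = fine (hsq A e).
  have pE : (fun n => complex.Re (\sum_(i < n) L2dot (A (e i)) (A (e i)))) =
      (fun n => \sum_(i < n) L2norm (A (e i)) ^+ 2).
    apply/funext => n; rewrite (eq_bigr (fun i : 'I_n => (L2norm (A (e i)) ^+ 2)%:C)).
      by apply: (big_ind2 (fun (x : R[i]) y => complex.Re x = y)) => // x1 x2 y1 y2 <- <-; rewrite cReD.
    by move=> i _; exact: L2dot_norm.
  rewrite pE in h.
  exact: (cvg_unique _ h h2).
have f0 := hsq_ge0 A e.
have ff : hsq A e \is a fin_num by rewrite ge0_fin_numE.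
rewrite /hs_norm E sqr_sqrtr; last exact: fine_ge0.
exact: fineK.
Qed.

Lemma bounded_lin A B (a : R[i]) : bounded_operator A -> bounded_operator B ->
  bounded_operator (a *: A + B).
Proof.
move=> [lA [M bM]] [lB [N bN]]; split.
  move=> k u v; rewrite -[LHS]/(a *: A (k *: u + v) + B (k *: u + v)) lA lB.
  rewrite -[(_ + _) u]/(a *: A u + B u) -[(_ + _) v]/(a *: A v + B v).
  by rewrite !scalerDr !scalerA mulrC addrACA.
exists (normc a * M + N) => u; rewrite -[(_ + _) u]/(a *: A u + B u).
apply: le_trans (L2normD _ _) _; rewrite mulrDl L2normZ -mulrA lerD//.
by rewrite ler_wpM2l// normc_ge0'.
Qed.

Lemma hilbert_schmidt_lin A B (a : R[i]) : hilbert_schmidt A -> hilbert_schmidt B ->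
  hilbert_schmidt (a *: A + B).
Proof.
move=> hA hB; have [bA [e he Ae]] := hA; have [bB _] := hB.
(* The basis that witnesses [B] may differ from [e]. *)
have [_ Be] := hs_basis hB he.
split; first exact: bounded_lin.
exists e; first exact: he.
have h := hsq_lin a Be Ae; apply: (eq_ind _ (fun x => x < +oo)%E h).
apply: eq_eseriesr => n _; congr ((L2norm _ ^+ 2)%:E); exact: addrC.
Qed.

Lemma hs_dot_linl A B S (a : R[i]) :
  hilbert_schmidt A -> hilbert_schmidt B -> hilbert_schmidt S ->
  hs_dot (a *: A + B) S = a * hs_dot A S + hs_dot B S.
Proof.
move=> hA hB hS; have [_ [e he _]] := hA.
have h1 := hs_dot_cvg hA hS he; have h2 := hs_dot_cvg hB hS he.
have h3 := hs_dot_cvg (hilbert_schmidt_lin a hA hB) hS he.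
apply: (ccvg_unique h3).
rewrite (_ : (fun n => _) = (fun n => a * (\sum_(i < n) L2dot (A (e i)) (S (e i))) +
  \sum_(i < n) L2dot (B (e i)) (S (e i)))).
  by apply: ccvgD => //; exact: ccvgZ.
apply/funext => n; rewrite mulr_sumr -big_split/=; apply: eq_bigr => i _.
by rewrite -L2dotZl -L2dotDl.
Qed.

End Trace.

(** * Moyal's identity *)

(** Norms of sums and differences determine the real part of the inner product, and replacing v by i
    v gives the imaginary part. *)
Lemma isometry_dot d d' (T : measurableType d) (T' : measurableType d') (R : realType)
    (mu : {measure set T -> \bar R}) (mu' : {measure set T' -> \bar R})
    (A : L2 mu -> L2 mu') (c : R) :
  linear A -> (forall u, L2norm (A u) ^+ 2 = c * L2norm u ^+ 2) ->
  forall u v, L2dot (A u) (A v) = c%:C * L2dot u v.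
Proof.
move=> lA nA.
have A0 : A 0 = 0 by apply: L2norm_eq0; apply/eqP; rewrite -sqrf_eq0 nA L2norm0 expr0n mulr0.
have AD u v : A (u + v) = A u + A v by rewrite -{1}[u]scale1r lA scale1r.
have AB u v : A (u - v) = A u - A v.
  by rewrite -scaleN1r addrC lA scaleN1r addrC.
have re u v : complex.Re (L2dot (A u) (A v)) = c * complex.Re (L2dot u v).
  rewrite (Re_L2dot (A u)) (Re_L2dot u) -AD -AB (nA (u + v)) (nA (u - v)).
  by rewrite -mulrBr mulrA.
move=> u v; apply: complexP; first by rewrite re cReM Re_real Im_real mul0r subr0.
rewrite cImM Re_real Im_real mul0r addr0 (Im_L2dot (A u)) (Im_L2dot u) -re.
by rewrite -[in RHS](addr0 ('i%C *: v)) lA A0 addr0.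
Qed.

Section Moyal.
Context (R : realType) (d : nat).
Local Notation RT := (measurableTypeR R).
Local Notation Rd := (d.-tuple RT).
Local Notation L2Rd := (L2 (lebesgueT R d)).
Implicit Types (u v : L2Rd).

Definition stft2 u v : L2 (lebesgue2T R d) := toL2 (lebesgue2T R d) (stft u v).

Lemma stft2_linl v : linear (stft2^~ v).
Proof.
move=> a u u'; rewrite /stft2 -toL2Z; last exact: square_integrable_stft.
rewrite -toL2D; [|apply: square_integrableZ|]; try exact: square_integrable_stft.
by congr toL2; apply/funext => z; rewrite /stft L2dotDl L2dotZl.
Qed.

Lemma stft2_linr u a v v' : stft2 u (a *: v + v') = a^* *: stft2 u v + stft2 u v'.
Proof.
rewrite /stft2 -toL2Z; last exact: square_integrable_stft.
rewrite -toL2D; [|apply: square_integrableZ|]; try exact: square_integrable_stft.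
by congr toL2; apply/funext => z; rewrite /stft tf_shiftD tf_shiftZ L2dotDr L2dotZr.
Qed.

Lemma L2norm_stft2 u v : L2norm (stft2 u v) ^+ 2 = L2norm v ^+ 2 * L2norm u ^+ 2.
Proof.
apply: EFin_inj; rewrite L2norm_toL2; last exact: square_integrable_stft.
by rewrite integral_stft_sqr mulrC.
Qed.

(** With equal windows this is [isometry_dot] for the map u |-> stft2 u v, which multiplies squared
    norms by |v|^2. Different windows need a second polarisation, as the dependence on the window is
    conjugate linear. *)
Lemma moyal u v u' v' :
  L2dot (stft2 u v) (stft2 u' v') = L2dot u u' * L2dot v' v.
Proof.
pose B x y := L2dot (stft2 u x) (stft2 u' y) - L2dot u u' * L2dot y x.
have alg (c P Q U X Y : R[i]) :
  c * P + Q - U * (c * X + Y) = c * (P - U * X) + (Q - U * Y) by ring.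
have diag x : B x x = 0.
  rewrite /B (isometry_dot (stft2_linl x) (L2norm_stft2^~ x)) L2dot_norm.
  by rewrite mulrC subrr.
have BDl a x y z : B (a *: x + y) z = a^* * B x z + B y z.
  rewrite /B (stft2_linr u a x y) (L2dotDl (_ *: _)) (L2dotZl _ (stft2 u x)).
  by rewrite (L2dotDr (_ *: _)) (L2dotZr _ z x); exact: alg.
have BDr a x y z : B z (a *: x + y) = a * B z x + B z y.
  rewrite /B (stft2_linr u' a x y) (L2dotDr (_ *: _)) (L2dotZr _ _ (stft2 u' x)) conjCK.
  by rewrite (L2dotDl (_ *: _)) (L2dotZl _ x z); exact: alg.
(* B is sesquilinear and vanishes on the diagonal. *)
apply/eqP; rewrite -subr_eq0 -/(B v v').
(* The first vector gives B(v', v) + B(v, v') = 0, the second -i B(v', v) + i B(v, v') = 0; together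
   they force 2 i B(v, v') = 0. *)
have h1 := diag (1 *: v' + v); have h2 := diag ('i%C *: v' + v).
move: h1 h2; rewrite !BDl !BDr !diag rmorph1 !mul1r !mulr0 !addr0 !add0r => h1.
have -> : ('i%C : R[i])^* = - 'i%C by apply: complexP => /=; rewrite ?oppr0.
move=> h2.
have xy : B v' v = - B v v' by apply/eqP; rewrite -addr_eq0; apply/eqP.
have : 2 * 'i%C * B v v' = 0.
  by rewrite -[RHS]h2 xy; ring.
move/eqP; rewrite !mulf_eq0 pnatr_eq0/= => /orP[|//].
by rewrite eq_complex/= oner_eq0 andbF.
Qed.

Lemma stft2_orthonormal (e : nat -> L2Rd) m n m' n' : orthonormal_basis e ->
  L2dot (stft2 (e m) (e n)) (stft2 (e m') (e n')) = ((m, n) == (m', n'))%:R.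
Proof.
move=> [he _]; rewrite moyal !he xpair_eqE (eq_sym n').
by case: (m == m'); case: (n == n'); rewrite ?mulr1 ?mulr0.
Qed.

End Moyal.

(** * Norms of pointwise limits of orthogonal series *)

Section OrthogonalLimit.
Context d (T : measurableType d) (R : realType) (mu : {measure set T -> \bar R}).

(** The hypotheses describe partial sums of an orthogonal series in terms of the norms of their
    increments. Fatou gives |G - F_n|^2 <= a - al n, which tends to 0, so the pointwise limit is
    also the L2 limit and the norms converge to that of [G]. Starting from F_0 = 0 makes the norm of
    F_n itself an increment. *)
Lemma orthogonal_limit (F : nat -> T -> R[i]) (G : T -> R[i]) (al : nat -> R) (a : R) :
  (forall n, cmeasurable (F n)) -> (forall x, ccvg (F^~ x) (G x)) ->
  (forall x, F 0%N x = 0) -> al 0%N = 0 -> al @ \oo --> a ->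
  (forall n m, (n <= m)%N ->
     (\int[mu]_x (normc (F m x - F n x) ^+ 2)%:E = (al m - al n)%:E)%E) ->
  cmeasurable G /\ (\int[mu]_x (normc (G x) ^+ 2)%:E = a%:E)%E.
Proof.
move=> mF FG F0 al0 cal HF.
have mG : cmeasurable G.
  split.
  - apply: (measurable_fun_cvg (h := fun k x => complex.Re (F k x))) => //.
    + by move=> k; have [] := mF k.
    + by move=> x _; have [] := FG x.
  - apply: (measurable_fun_cvg (h := fun k x => complex.Im (F k x))) => //.
    + by move=> k; have [] := mF k.
    + by move=> x _; have [] := FG x.
have ndal : nondecreasing_seq al.
  move=> n m nm; rewrite -subr_ge0 -lee_fin -HF//.
  by apply: integral_ge0 => x _; rewrite lee_fin sqr_ge0.
have al_le n : al n <= a.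
  have -> : a = limn al by apply/esym/cvg_lim.
  by apply: nondecreasing_cvgn_le => //; apply/cvg_ex; exists a.
have HG n : (\int[mu]_x (normc (G x - F n x) ^+ 2)%:E <= (a - al n)%:E)%E.
  apply: (@fatou_normc2 _ _ _ _ F G (F n) _ n) => // m nm.
  by rewrite HF// lee_fin lerB.
have nF n : (\int[mu]_x (normc (F n x) ^+ 2)%:E = (al n)%:E)%E.
  by have := HF 0%N n (leq0n n); rewrite al0 subr0; under eq_integral do rewrite F0 subr0.
have sF n : square_integrable mu (F n).
  by have [hr hi] := mF n; split => //; rewrite nF ltry.
have sG : square_integrable mu G.
  have [hr hi] := mG; split => //; have := HG 0%N.
  under eq_integral do rewrite F0 subr0.
  by move=> h; rewrite (le_lt_trans h)// ltry.
split => //; rewrite -(L2norm_toL2 sG); congr EFin.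
pose g := toL2 mu G; pose f n := toL2 mu (F n).
have nf n : L2norm (f n) ^+ 2 = al n by apply: EFin_inj; rewrite L2norm_toL2.
have dfg n : L2norm (g - f n) ^+ 2 <= a - al n.
  rewrite -lee_fin; apply: le_trans (HG n).
  rewrite L2normB_integral le_eqVlt; apply/orP; left; apply/eqP; apply: ae_eq_integral => //.
  - by apply: cmeasurable_normc2; apply: cmeasurableB; exact: cmeasurable_rep.
  - by apply: cmeasurable_normc2; apply: cmeasurableB.
  - by apply: filterS2 (rep_toL2 sG) (rep_toL2 (sF n)) => x -> -> _.
have cf : L2norm (f n) @[n --> \oo] --> L2norm g.
  apply/cvgrPdist_le => eps e0; have e20 : 0 < eps ^+ 2 by rewrite exprn_gt0.
  have /cvgrPdist_le/(_ _ e20) := cal; apply: filterS => n h.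
  apply: le_trans (L2norm_BD _ _) _.
  rewrite -(@ler_pXn2r _ 2)// ?nnegrE ?L2norm_ge0 ?(ltW e0)//.
  apply: le_trans (dfg n) _; apply: le_trans h; exact: ler_norm.
have cf2 : al @ \oo --> L2norm g ^+ 2.
  by rewrite -(funext nf); apply: cvgM.
exact: (cvg_unique _ cf2 cal).
Qed.

End OrthogonalLimit.

(** * The polarised Cohen class *)

Lemma ccvg_sum (R : realType) I (s : seq I) (u : I -> nat -> R[i]) (l : I -> R[i]) :
  (forall i, ccvg (u i) (l i)) ->
  ccvg (fun n => \sum_(i <- s) u i n) (\sum_(i <- s) l i).
Proof.
move=> h; elim: s => [|i s IH].
  rewrite big_nil; under eq_fun do rewrite big_nil; exact: ccvg_cst.
by rewrite big_cons; under eq_fun do rewrite big_cons; exact: ccvgD.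
Qed.

Section PolarisedCohen.
Context (R : realType) (d : nat).
Local Notation RT := (measurableTypeR R).
Local Notation Rd := (d.-tuple RT).
Local Notation L2Rd := (L2 (lebesgueT R d)).
Implicit Types (u v : L2Rd) (w z : Rd * Rd) (e : nat -> L2Rd) (S T : L2Rd -> L2Rd).

Lemma tf_shift_inj w u v : tf_shift w u = tf_shift w v -> u = v.
Proof. by move=> /(congr1 (tf_inv w)); rewrite !tf_shiftK. Qed.

Lemma tf_inv_linear w : linear (tf_inv w).
Proof.
move=> a u v; apply: (@tf_shift_inj w).
by rewrite tf_shiftD tf_shiftZ !tf_invK.
Qed.

Lemma L2norm_tf_inv w v : L2norm (tf_inv w v) = L2norm v.
Proof. by rewrite -(L2norm_tf_shift w) tf_invK. Qed.

Lemma tf_shift_sum w (n : nat) (x : nat -> L2Rd) :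
  tf_shift w (\sum_(i < n) x i) = \sum_(i < n) tf_shift w (x i).
Proof.
apply: (big_morph (tf_shift w)) => [u v|]; first exact: tf_shiftD.
by have := tf_shiftZ w 0 0; rewrite !scale0r.
Qed.

(** Completeness transfers because pi(w) is onto: the expansion of u in the shifted basis is the
    image of the expansion of [tf_inv w u]. *)
Lemma orthonormal_basis_tf_shift w e : orthonormal_basis e ->
  orthonormal_basis (fun n => tf_shift w (e n)).
Proof.
move=> [oe he]; split; first by move=> i j; rewrite L2dot_tf_shift.
move=> u; have := he (tf_inv w u).
move=> h; apply: (eq_ind _ (fun f : nat -> R => f @ \oo --> (0 : R)) h).
apply/funext => n; rewrite -[LHS](L2norm_tf_shift w); congr L2norm.
rewrite -scaleN1r tf_shiftD tf_shiftZ tf_invK scaleN1r.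
rewrite (tf_shift_sum w n (fun i => L2dot (tf_inv w u) (e i) *: e i)).
congr (_ - _); apply: eq_bigr => i _; rewrite tf_shiftZ; congr (_ *: _).
by rewrite L2dotC -L2dot_tf_inv -L2dotC.
Qed.

Lemma op_shift_tf_shift w z S u :
  op_shift w z S (tf_shift w u) = tf_shift z (S u).
Proof. by rewrite /op_shift /= adjoint_tf_shift tf_shiftK. Qed.

Lemma hilbert_schmidt_op_shift w z S : hilbert_schmidt S ->
  hilbert_schmidt (op_shift w z S).
Proof.
move=> [[lS [M bM]] [e he Se]]; split.
  split.
    move=> a u v; rewrite /op_shift /= adjoint_tf_shift tf_inv_linear lS.
    by rewrite tf_shiftD tf_shiftZ.
  exists M => u; rewrite /op_shift /= adjoint_tf_shift L2norm_tf_shift.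
  by rewrite -(L2norm_tf_inv w u).
exists (fun n => tf_shift w (e n)); first exact: orthonormal_basis_tf_shift.
apply: (eq_ind _ (fun x => x < +oo)%E Se); apply: eq_eseriesr => n _.
by rewrite op_shift_tf_shift L2norm_tf_shift.
Qed.

Lemma polarised_cohen_cvg S T e w z :
  hilbert_schmidt S -> hilbert_schmidt T -> orthonormal_basis e ->
  ccvg (fun N => \sum_(n < N) L2dot (T (tf_shift w (e n))) (tf_shift z (S (e n))))
    (polarised_cohen S T (w, z)).
Proof.
move=> hS hT he.
have h := hs_dot_cvg hT (hilbert_schmidt_op_shift w z hS) (orthonormal_basis_tf_shift w he).
rewrite -[polarised_cohen S T (w, z)]/(hs_dot T (op_shift w z S)).
move: (hs_dot T _) h => l h.
apply: (eq_ind _ (fun f => ccvg f l) h); apply/funext => N; apply: eq_bigr => n _.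
by rewrite op_shift_tf_shift.
Qed.

(** The first factor depends on w alone and is the coefficient of pi(w) e_n along e_m; the second
    depends on z alone. This separation is what allows integrating in w and then in z. *)
Definition cohen_term S T e (m n : nat) (wz : (Rd * Rd) * (Rd * Rd)) : R[i] :=
  (stft (e m) (e n) wz.1)^* * stft (T (e m)) (S (e n)) wz.2.

Lemma cohen_term_cvg S T e n w z : bounded_operator T -> orthonormal_basis e ->
  ccvg (fun M => \sum_(m < M) cohen_term S T e m n (w, z))
    (L2dot (T (tf_shift w (e n))) (tf_shift z (S (e n)))).
Proof.
move=> bT [oe he]; set x := tf_shift w (e n); set v := tf_shift z _.
have hx : L2norm (\sum_(i < k) L2dot x (e i) *: e i - x) @[k --> \oo] --> (0 : R).
  by have := he x; under eq_fun do rewrite -L2normN opprB.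
have [lT _] := bT.
have h := L2dot_cvgl v (bounded_cvg bT hx).
apply: (eq_ind _ (fun f => ccvg f _) h); apply/funext => M.
rewrite (linear_op_sum M (fun i => L2dot x (e i)) e lT) L2dot_suml.
by apply: eq_bigr => m _; rewrite L2dotZl /cohen_term /stft/= -L2dotC.
Qed.

Lemma cmeasurable_cohen_term S T e m n : cmeasurable (cohen_term S T e m n).
Proof.
apply: cmeasurableM.
  apply: cmeasurableJ; apply: (cmeasurable_comp (cmeasurable_stft _ _)).
  exact: measurable_fst.
apply: (cmeasurable_comp (cmeasurable_stft _ _)); exact: measurable_snd.
Qed.

(** At fixed z the sum is, up to conjugation, a linear combination of the [stft2 (e m) (e n)],
    orthonormal by Moyal; [uniq s] prevents an index from being counted twice. The remaining
    z-integrals of the squared coefficients are given by [integral_stft_sqr]. *)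
Lemma integral_cohen_sum S T e (s : seq (nat * nat)) : orthonormal_basis e -> uniq s ->
  (\int[lebesgue4T R d]_x (normc (\sum_(p <- s) cohen_term S T e p.1 p.2 x) ^+ 2)%:E =
   (\sum_(p <- s) L2norm (T (e p.1)) ^+ 2 * L2norm (S (e p.2)) ^+ 2)%:E)%E.
Proof.
move=> he us.
pose F x := \sum_(p <- s) cohen_term S T e p.1 p.2 x.
have mF : cmeasurable F.
  apply: (@cmeasurable_sum _ _ _ _ s (fun p => cohen_term S T e p.1 p.2)) => p.
  exact: cmeasurable_cohen_term.
rewrite (sfprod_tonelli2 _ _ (cmeasurable_normc2 mF)); last first.
  by move=> x; rewrite lee_fin sqr_ge0.
pose psi (p : nat * nat) z := stft (T (e p.1)) (S (e p.2)) z.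
have inner z : (\int[lebesgue2T R d]_w (normc (F (w, z)) ^+ 2)%:E =
    (\sum_(p <- s) normc (psi p z) ^+ 2)%:E)%E.
  pose g (p : nat * nat) : L2 (lebesgue2T R d) := (psi p z)^* *: stft2 (e p.1) (e p.2).
  have dg p q : L2dot (g p) (g q) = (psi p z)^* * psi q z * (p == q)%:R.
    rewrite /g L2dotZl L2dotZr conjCK stft2_orthonormal// mulrA.
    by case: p q => [? ?] [? ?].
  have ng : L2norm (\sum_(p <- s) g p) ^+ 2 = \sum_(p <- s) normc (psi p z) ^+ 2.
    have := L2dot_norm (\sum_(p <- s) g p); rewrite L2dot_suml.
    rewrite big_seq (eq_bigr (fun p => (normc (psi p z) ^+ 2)%:C)); last first.
      move=> p ps; rewrite (L2dot_sumr s xpredT g (g p)) (bigD1_seq p ps us).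
      rewrite (big1 _ (fun q => q != p)); last first.
        by move=> q /negbTE qp; rewrite (dg p q) eq_sym qp mulr0.
      by rewrite (dg p p) eqxx; move: (psi p z) => a; rewrite /= addr0 mulr1 mulrC mul_conjC.
    rewrite -big_seq => /(congr1 (@complex.Re _)) /= <-.
    by apply: (big_ind2 (fun (x : R[i]) y => complex.Re x = y)) => // x1 x2 y1 y2 <- <-; rewrite cReD.
  have sg (p : nat * nat) : square_integrable (lebesgue2T R d)
      (fun w => (psi p z)^* * stft (e p.1) (e p.2) w).
    by apply: square_integrableZ; exact: square_integrable_stft.
  have gE : \sum_(p <- s) g p = toL2 (lebesgue2T R d)
      (fun w => \sum_(p <- s) (psi p z)^* * stft (e p.1) (e p.2) w).
    elim: (s) => [|p t IH].
      rewrite big_nil -(scale0r (toL2 _ (stft (e 0%N) (e 0%N)))) -toL2Z; last first.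
        exact: square_integrable_stft.
      by congr toL2; apply/funext => w; rewrite big_nil mul0r.
    rewrite big_cons IH /g -toL2Z; last exact: square_integrable_stft.
    rewrite -toL2D; [|exact: sg|exact: (square_integrable_sum t sg)].
    by congr toL2; apply/funext => w; rewrite big_cons.
  rewrite -ng gE L2norm_toL2; last first.
    exact: (square_integrable_sum s sg).
  (* Conjugating the whole sum leaves its modulus unchanged and moves the bar from the functions of
     w to the coefficients, so that it matches [g]. *)
  have FE w : normc (F (w, z)) = normc (\sum_(p <- s) (psi p z)^* * stft (e p.1) (e p.2) w).
    apply: (etrans (esym (normc_conjC (F (w, z))))); apply: (congr1 (@normc R)).
    apply: (etrans (rmorph_sum Num.conj s xpredT _)); apply: eq_bigr => p _.
    rewrite -[cohen_term _ _ _ _ _ _]/((stft (e p.1) (e p.2) w)^* * psi p z).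
    by move: (psi p z) (stft _ _ _) => a b; rewrite rmorphM/= conjCK mulrC.
  by apply: eq_integral => w _; exact: (congr1 (fun r => (r ^+ 2)%:E) (FE w)).
under eq_integral do rewrite inner -sumEFin.
rewrite ge0_integral_sum//.
- rewrite -sumEFin; apply: eq_bigr => p _; exact: integral_stft_sqr.
- by move=> p; apply: cmeasurable_normc2; exact: cmeasurable_stft.
- by move=> p z _; rewrite lee_fin sqr_ge0.
Qed.

Let pairs a b c k := [seq (m, n) | m <- index_iota a b, n <- index_iota c k].

Lemma sum_pairs (V : nmodType) (a b c k : nat) (f : nat -> nat -> V) :
  \sum_(p <- pairs a b c k) f p.1 p.2 = \sum_(a <= m < b) \sum_(c <= n < k) f m n.
Proof. by rewrite big_allpairs. Qed.

(** The inner limit: m runs to infinity while n stays in a finite range. Ranges [a, b) are allowed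
    because the outer limit needs the norms of differences of partial sums. *)
Lemma cohen_block S T e (a b : nat) :
  hilbert_schmidt S -> hilbert_schmidt T -> orthonormal_basis e ->
  let G wz := \sum_(a <= n < b) L2dot (T (tf_shift wz.1 (e n))) (tf_shift wz.2 (S (e n))) in
  cmeasurable G /\
  (\int[lebesgue4T R d]_x (normc (G x) ^+ 2)%:E =
    (hs_norm T ^+ 2 * \sum_(a <= n < b) L2norm (S (e n)) ^+ 2)%:E)%E.
Proof.
move=> hS hT he G.
set c := \sum_(a <= n < b) _.
have [bT _] := hT.
have [_ Te] := hs_basis hT he.
have cT : \sum_(i < n) L2norm (T (e i)) ^+ 2 @[n --> \oo] --> hs_norm T ^+ 2.
  have h := cvg_nneseries (fun n => sqr_ge0 (L2norm (T (e n)))) Te.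
  apply: (eq_ind _ (fun l : R => _ --> l) h).
  exact: (congr1 fine (esym (hs_norm_sqr hT he))).
pose P M wz := \sum_(p <- pairs 0 M a b) cohen_term S T e p.1 p.2 wz.
pose al M := (\sum_(i < M) L2norm (T (e i)) ^+ 2) * c.
apply: (@orthogonal_limit _ _ _ _ P G al).
- move=> M; apply: (@cmeasurable_sum _ _ _ _ _ (fun p => cohen_term S T e p.1 p.2)) => p.
  exact: cmeasurable_cohen_term.
- move=> [w z]; rewrite /P /G.
  have h := ccvg_sum (index_iota a b) (fun n => cohen_term_cvg S n w z bT he).
  apply: (eq_ind _ (fun f => ccvg f _) h); apply/funext => M.
  rewrite (sum_pairs 0 M a b (fun m n => cohen_term S T e m n (w, z))) [RHS]exchange_big /=.
  by apply: eq_bigr => n _; rewrite big_mkord.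
- move=> x; rewrite /P (sum_pairs _ _ _ _ (fun i j => cohen_term S T e i j x)).
  by rewrite big_geq.
- by rewrite /al big_ord0 mul0r.
- exact: (cvgM cT (cvg_cst c)).
move=> n m nm.
have PE x : P m x - P n x = \sum_(p <- pairs n m a b) cohen_term S T e p.1 p.2 x.
  rewrite /P 3!(sum_pairs _ _ a b (fun i j => cohen_term S T e i j x)).
by rewrite (big_cat_nat (leq0n n) nm)/= [X in X - _]addrC addrK.
transitivity (\int[lebesgue4T R d]_x
    (normc (\sum_(p <- pairs n m a b) cohen_term S T e p.1 p.2 x) ^+ 2)%:E)%E.
  by apply: eq_integral => x _; exact: (congr1 (fun r => (normc r ^+ 2)%:E) (PE x)).
rewrite integral_cohen_sum//; last first.
  by apply: allpairs_uniq; rewrite ?iota_uniq// => -[? ?] [? ?].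
congr EFin; rewrite (sum_pairs n m a b (fun i j => L2norm (T (e i)) ^+ 2 * L2norm (S (e j)) ^+ 2)).
under eq_bigr do rewrite -mulr_sumr.
rewrite -mulr_suml -mulrBl; congr (_ * _).
rewrite -!(big_mkord xpredT (fun i => L2norm (T (e i)) ^+ 2)).
by rewrite (big_cat_nat (leq0n n) nm)/= [X in X - _]addrC addrK.
Qed.

(** The outer limit: [orthogonal_limit] along the partial sums of the trace in the basis pi(w) e_n,
    with the increments computed by [cohen_block]. *)
Lemma polarised_cohen_isometry S T : hilbert_schmidt S -> hilbert_schmidt T ->
  cmeasurable (polarised_cohen S T) /\
  (\int[lebesgue4T R d]_x (normc (polarised_cohen S T x) ^+ 2)%:E =
    (hs_norm T ^+ 2 * hs_norm S ^+ 2)%:E)%E.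
Proof.
move=> hS hT; have [_ [e he _]] := hS.
have [_ Se] := hs_basis hS he.
have cS : \sum_(i < n) L2norm (S (e i)) ^+ 2 @[n --> \oo] --> hs_norm S ^+ 2.
  have h := cvg_nneseries (fun n => sqr_ge0 (L2norm (S (e n)))) Se.
  apply: (eq_ind _ (fun l : R => _ --> l) h).
  exact: (congr1 fine (esym (hs_norm_sqr hS he))).
pose g n wz := L2dot (T (tf_shift wz.1 (e n))) (tf_shift wz.2 (S (e n))).
pose F N (wz : (Rd * Rd) * (Rd * Rd)) := \sum_(0 <= n < N) g n wz.
pose al N := hs_norm T ^+ 2 * \sum_(i < N) L2norm (S (e i)) ^+ 2.
apply: (@orthogonal_limit _ _ _ _ F _ al).
- by move=> N; have [] := cohen_block 0 N hS hT he.
- move=> [w z]; have h := polarised_cohen_cvg w z hS hT he.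
  apply: (eq_ind _ (fun f => ccvg f _) h); apply/funext => N.
  by rewrite /F big_mkord.
- by move=> x; rewrite /F big_geq.
- by rewrite /al big_ord0 mulr0.
- exact: (cvgM (cvg_cst _) cS).
move=> n m nm.
have FE x : F m x - F n x = \sum_(n <= k < m) g k x.
  by rewrite /F (big_cat_nat (leq0n n) nm)/= [X in X - _]addrC addrK.
transitivity (\int[lebesgue4T R d]_x (normc (\sum_(n <= k < m) g k x) ^+ 2)%:E)%E.
  by apply: eq_integral => x _; exact: (congr1 (fun r => (normc r ^+ 2)%:E) (FE x)).
have [_ ->] := cohen_block n m hS hT he.
congr EFin; rewrite -mulrBr; congr (_ * _).
rewrite -!(big_mkord xpredT (fun i => L2norm (S (e i)) ^+ 2)).
by rewrite (big_cat_nat (leq0n n) nm)/= [X in X - _]addrC addrK.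
Qed.

End PolarisedCohen.

Local Open Scope complex_scope.

Theorem proposition3p4 (R : realType) (d : nat) (d_gt0 : (0 < d)%N)
    (S : L2 (lebesgueT R d) -> L2 (lebesgueT R d))
    (HS_S : hilbert_schmidt S) (S_norm : hs_norm S = 1) :
  [/\ (* Q_S maps HS into L^2(R^(4d)), *)
      forall T, hilbert_schmidt T ->
        square_integrable (lebesgue4T R d) (polarised_cohen S T),
      (* linearly *)
      forall (a : R[i]) T T', hilbert_schmidt T -> hilbert_schmidt T' ->
        polarised_cohen_L2 S (a *: T + T') =
        a *: polarised_cohen_L2 S T + polarised_cohen_L2 S T' &
      (* and preserving distances *)
      forall T T', hilbert_schmidt T -> hilbert_schmidt T' ->
        L2norm (polarised_cohen_L2 S T - polarised_cohen_L2 S T') =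
        hs_norm (T - T')].
Proof.
(* This excludes the default value 0 of [toL2], so that the class in L2 really is that of Q_S T. *)
have sq T : hilbert_schmidt T -> square_integrable (lebesgue4T R d) (polarised_cohen S T).
  move=> hT; have [[mr mi] e] := polarised_cohen_isometry HS_S hT.
  split; [exact: mr|exact: mi|].
  exact: (eq_ind_r (fun x => x < +oo)%E (ltry _) e).
have lin (a : R[i]) T T' : hilbert_schmidt T -> hilbert_schmidt T' ->
    polarised_cohen_L2 S (a *: T + T') =
    a *: polarised_cohen_L2 S T + polarised_cohen_L2 S T'.
  move=> hT hT'; rewrite /polarised_cohen_L2 -toL2Z; last exact: sq.
  rewrite -toL2D; [|exact: (square_integrableZ a (sq _ hT))|exact: sq].
  apply: (congr1 (toL2 (lebesgue4T R d))); apply/funext => -[w z].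
  exact: (hs_dot_linl a hT hT' (hilbert_schmidt_op_shift w z HS_S)).
split; [exact: sq|exact: lin|move=> T T' hT hT'].
(* In this form linearity applies to the difference, and the norm identity for a single operator
   yields preservation of distances. *)
have E : T - T' = -1 *: T' + T by rewrite scaleN1r addrC.
have hB : hilbert_schmidt (T - T') by rewrite E; exact: hilbert_schmidt_lin.
have -> : polarised_cohen_L2 S T - polarised_cohen_L2 S T' = polarised_cohen_L2 S (T - T').
  by rewrite E lin// scaleN1r addrC.
apply/eqP; rewrite -(@eqrXn2 _ 2) ?L2norm_ge0 ?sqrtr_ge0//; apply/eqP/EFin_inj.
rewrite L2norm_toL2; last exact: sq.
by have [_ ->] := polarised_cohen_isometry HS_S hB; rewrite S_norm expr1n mulr1.
Qed.
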